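(* Let $(\Sigma,\alpha)$ be an $R$-Cartan structure on a 3-manifold $\Sigma$ subject to the conditions $$R_3=0,\qquad R_{11}=1-R-R_1^2,\qquad R_{12}=R_{21}=-R_1R_2,\qquad R_{22}=1-R-R_2^2.$$ Then $(\Sigma,\alpha)$ induces on the leaf space $\Lambda=\Sigma/_{\{\alpha^1=0,\alpha^2=0\}}$ a family of smooth rotationally symmetric Riemannian metrics $$g=\eta^2(r)\,dr^2+\varphi^2(r)\,d\theta^2,$$ where $$\eta(r)=\frac{r\,e^{-\frac14r^2}}{2\Phi(r)},\qquad \varphi(r)=\frac{\Phi(r)}{R_0-1},$$ and $$\Phi(r)=\Bigl[\bigl(R_0-\tfrac32\bigr)-\bigl(R_0-\tfrac32-\tfrac14r^2\bigr)e^{-\frac12r^2}\Bigr]^{1/2}.$$ Here $(r,\theta)\in I\times S^1$ are the induced local coordinates on $\Lambda$, and $R_0>1$ is a real constant.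
   Context: An $R$-Cartan structure on a 3-manifold $\Sigma$ ($R$ a smooth function) is a coframing $\alpha=(\alpha^1,\alpha^2,\alpha^3)$ with $d\alpha^1=\alpha^2\wedge\alpha^3$, $d\alpha^2=-\alpha^1\wedge\alpha^3$, $d\alpha^3=R\,\alpha^1\wedge\alpha^2$. Subscripts $1,2,3$ on $R$ denote directional derivatives with respect to $\alpha$: $dR=R_1\alpha^1+R_2\alpha^2+R_3\alpha^3$, and $R_{ij}=(R_i)_j$ ($R_0$ is not a derivative but a constant). $\Lambda$ is the space of leaves of the codimension-two foliation $\{\alpha^1=0,\alpha^2=0\}$ of $\Sigma$; the metric induced on $\Lambda$ by $\alpha$ is $g=(\alpha^1)^2+(\alpha^2)^2$, meaning that its pull-back to $\Sigma$ is this quadratic form. $I\subset\mathbb R$ denotes an interval.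
   Formalization: The formal theorem gives coordinates only where dR ≠ 0, or where dR = 0 and R > 1; elsewhere the claim fails (e.g. R ≡ 1 meets all conditions, but its round metric has constant curvature, whereas the stated metric has curvature R_0 − r²/4). *)

(* Defs.v *)
From mathcomp Require Export all_boot all_order all_algebra.
From mathcomp Require Export all_classical all_reals all_analysis.

Set Implicit Arguments.
Unset Strict Implicit.
Unset Printing Implicit Defensive.

Export Order.TTheory GRing.Theory Num.Theory.
Export numFieldNormedType.Exports.

#[export] Set Implicit Arguments.
#[export] Unset Strict Implicit.
#[export] Unset Printing Implicit Defensive.

Global Open Scope classical_set_scope.
Global Open Scope ring_scope.

Section EuclideanSmoothness.
Context {R : realType} {n : nat}.
Implicit Types (U : set 'rV[R]_n) (f : 'rV[R]_n -> R).

Definition partial (i : 'I_n) f : 'rV[R]_n -> R :=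
  fun x => 'D_(delta_mx 0 i) f x.

Definition partials (s : seq 'I_n) f : 'rV[R]_n -> R := foldr partial f s.

(* [f] is C^oo on [U] (used for open [U]): all iterated partial derivatives
   exist and are continuous at the points of [U]. *)
Definition smooth_on U f : Prop :=
  forall (s : seq 'I_n) x, U x ->
    {for x, continuous (partials s f)} /\
    forall i, derivable (partials s f) x (delta_mx 0 i).

End EuclideanSmoothness.

Section Manifold.
Variables (R : realType) (n : nat).

Record chart (M : topologicalType) := Chart {
  cdom : set M;
  cmap : M -> 'rV[R]_n;
  cinv : 'rV[R]_n -> M;
  cdom_open : open cdom;
  cimg_open : open (cmap @` cdom);
  cmapK : forall p, cdom p -> cinv (cmap p) = p;
  cmap_continuous : forall p, cdom p -> {for p, continuous cmap};
  cinv_continuous : forall p, cdom p -> {for cmap p, continuous cinv}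
}.

Record manifold := Manifold {
  mspace :> topologicalType;
  atlas : set (chart mspace);
  manifold_hausdorff : hausdorff_space mspace;
  manifold_second_countable : @second_countable mspace;
  atlas_cover : forall p, exists2 c, atlas c & cdom c p;
  atlas_compatible : forall c c', atlas c -> atlas c' -> forall i,
    smooth_on (cmap c @` (cdom c `&` cdom c')) (fun x => cmap c' (cinv c x) 0 i)
}.

End Manifold.

Section Forms.
Context {R : realType} {n : nat} (M : manifold R n).
Implicit Types (c : chart R n M) (p : M) (U : set M) (f : M -> R).

Definition msmooth_on U f : Prop :=
  forall c, atlas c -> smooth_on (cmap c @` (U `&` cdom c)) (f \o cinv c).

Definition cpartial c (i : 'I_n) f p : R := partial i (f \o cinv c) (cmap c p).

(* A covector field is given by its components [w c p 0 i], the value of [w]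
   at [p] on the i-th coordinate vector field of [c]; only [atlas c] and
   [cdom c p] are meaningful.  A 2-form has likewise components
   [w c p i j], the value on the i-th and j-th coordinate vector fields. *)
Definition covector_field := chart R n M -> M -> 'rV[R]_n.
Definition two_tensor := chart R n M -> M -> 'M[R]_n.

Definition one_form (w : covector_field) : Prop :=
  (forall c, atlas c -> forall i,
     msmooth_on (cdom c) (fun p => w c p 0 i)) /\
  (forall c c', atlas c -> atlas c' -> forall p, cdom c p -> cdom c' p ->
     forall i, w c p 0 i =
       \sum_(j < n) w c' p 0 j * cpartial c i (fun q => cmap c' q 0 j) p).

Definition differential f : covector_field :=
  fun c p => \row_i cpartial c i f p.

Definition ext_d (w : covector_field) : two_tensor := fun c p =>
  \matrix_(i, j) (cpartial c i (fun q => w c q 0 j) p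
                  - cpartial c j (fun q => w c q 0 i) p).

Definition wedge (v w : covector_field) : two_tensor := fun c p =>
  \matrix_(i, j) (v c p 0 i * w c p 0 j - v c p 0 j * w c p 0 i).

(* The quadratic form [w^2], as the symmetric tensor [w (x) w]. *)
Definition square (w : covector_field) : two_tensor := fun c p =>
  (w c p)^T *m w c p.

Definition on_charts U (P : chart R n M -> M -> Prop) : Prop :=
  forall c p, atlas c -> cdom c p -> U p -> P c p.

End Forms.

Section Cartan.
Context {R : realType} (M : manifold R 3).
Implicit Types (a : covector_field M) (U : set M) (p q : M).

Definition coframing a1 a2 a3 : Prop :=
  [/\ one_form a1, one_form a2, one_form a3 &
      on_charts setT (fun c p => row_free
        (col_mx (a1 c p) (col_mx (a2 c p) (a3 c p)) : 'M[R]_(1 + (1 + 1), 3)))].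

(* [R] is the field of real numbers throughout; the curvature function of an
   "R-Cartan structure" is named [K], and the constant R_0 is named [K0]. *)
Definition Cartan_structure (K : M -> R) a1 a2 a3 : Prop :=
  [/\ msmooth_on setT K, coframing a1 a2 a3 &
      on_charts setT (fun c p =>
        [/\ ext_d a1 c p = wedge a2 a3 c p,
            ext_d a2 c p = - wedge a1 a3 c p &
            ext_d a3 c p = K p *: wedge a1 a2 c p])].

(* [f1], [f2], [f3] are the directional derivatives of [f] w.r.t. the
   coframing: df = f1 a1 + f2 a2 + f3 a3. *)
Definition coframe_derivatives a1 a2 a3 (f f1 f2 f3 : M -> R) : Prop :=
  on_charts setT (fun c p => differential f c p =
    f1 p *: a1 c p + f2 p *: a2 c p + f3 p *: a3 c p).

(* [p] and [q] lie on the same leaf of the restriction to [U] of the foliation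
   {a1 = 0, a2 = 0}: they are joined in [U] by a curve tangent to it. *)
Definition same_leaf a1 a2 U p q : Prop :=
  exists gamma : R -> M, [/\ gamma 0 = p, gamma 1 = q &
    forall t : R, 0 <= t <= 1 ->
      [/\ U (gamma t), {for t, continuous gamma} &
        forall c, atlas c -> cdom c (gamma t) ->
          let x := fun s : R => cmap c (gamma s) in
          [/\ derivable x t 1,
              a1 c (gamma t) *m (derive1 x t)^T = 0 &
              a2 c (gamma t) *m (derive1 x t)^T = 0]]].

Definition circle : set (R * R) := [set u | u.1 ^+ 2 + u.2 ^+ 2 = 1].

(* The differential dtheta of an angular function theta : M -> S^1, written
   as the pair (cos theta, sin theta). *)
Definition dangle (th : M -> R * R) : covector_field M := fun c p =>
  (th p).1 *: differential (fun q => (th q).2) c p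
  - (th p).2 *: differential (fun q => (th q).1) c p.

(* [(r, th)] are local coordinates with values in [I * S^1] on the space of
   leaves of [U]: smooth functions on [U] with independent differentials that
   are equal at two points of [U] exactly when these are on the same leaf. *)
Definition leaf_coordinates a1 a2 U (I : set R)
    (r : M -> R) (th : M -> R * R) : Prop :=
  [/\ open U,
      [/\ msmooth_on U r, msmooth_on U (fun q => (th q).1) &
          msmooth_on U (fun q => (th q).2)],
      (forall q, U q -> I (r q) /\ circle (th q)),
      on_charts U (fun c q => row_free
        (col_mx (differential r c q) (dangle th c q) : 'M[R]_(1 + 1, 3))) &
      forall q q', U q -> U q' ->
        (same_leaf a1 a2 U q q' <-> r q = r q' /\ th q = th q')].

(* The metric eta(r)^2 dr^2 + phi(r)^2 dtheta^2 on the space of leaves of [U]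
   is the one induced by the coframing: its pull-back is a1^2 + a2^2. *)
Definition induced_metric a1 a2 U (eta phi : R -> R)
    (r : M -> R) (th : M -> R * R) : Prop :=
  on_charts U (fun c q => square a1 c q + square a2 c q =
    eta (r q) ^+ 2 *: square (differential r) c q
    + phi (r q) ^+ 2 *: square (dangle th) c q).

End Cartan.

Section Profile.
Context {R : realType}.
Implicit Types (K r : R).

Definition Phi K0 r : R :=
  Num.sqrt ((K0 - 3 / 2) - (K0 - 3 / 2 - r ^+ 2 / 4) * expR (- (r ^+ 2 / 2))).

Definition eta K0 r : R := r * expR (- (r ^+ 2 / 4)) / (2 * Phi K0 r).

Definition phi K0 r : R := Phi K0 r / (K0 - 1).

Definition smooth_positive_on (I : set R) (f : R -> R) : Prop :=
  forall x, I x -> 0 < f x /\ forall k, derivable (derive1n k f) x 1.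

End Profile.

(* Main.v *)
From HB Require Import structures.
Require Import Defs.
From mathcomp Require Import ring lra.

(** Why the metric is rotationally symmetric.

    Differentiating [dK = K1 a1 + K2 a2] once more and comparing with the
    structure equations gives [K13 = - K2] and [K23 = K1]
    ([curvature_second_derivatives]): along a leaf the gradient [(K1, K2)] only
    rotates, and [S = K1^2 + K2^2] is a function on the space of leaves.  The
    equations for [K11, K12, K21, K22] say that [dS = 2 (1 - K - S) dK], so that
    [(S + K - 3/2) e^(2 K)] is constant on a connected open set
    ([first_integral_constant]).  The function [x |-> (x - 3/2) e^(2 x)] has its
    minimum at [x = 1] and grows without bound, so the constant is its value at
    some [K0 > 1] as soon as [S > 0] or [K > 1] somewhere
    ([exists_maximal_curvature]); otherwise no leaf calls for coordinates.  In
    terms of [u = K0 - K] this reads [S = u D(u)], where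
    [D(u) = (K0 - 3/2) (e^(2 u) - 1) / u + 1] is smooth at [u = 0] as well.

    The radius is [r = 2 sqrt u]; then [Phi(r)^2 = e^(-2 u) S] and
    [eta(r)^2 dr^2 = dK^2 / S].  The rest of the metric is the square of
    [(K1 a2 - K2 a1) / sqrt S], and it remains to see that
    [(K0 - 1) e^u (K1 a2 - K2 a1) / S] is locally the differential of an angle.
    To include the leaves with [dK = 0], where the angle has no limit,
    Cartesian coordinates are found first.  With a suitable smooth function
    [m(u)] the form [a3 + m(u) (K1 a2 - K2 a1)] is closed
    ([angle_form_closed]), hence locally [d chi] ([poincare], [exists_angle]);
    the gradient turned back by the angle [chi], reflected, and rescaled by
    [2 / sqrt D(u)] is a pair [(X, Y)] of smooth functions, defined also where [dK = 0], with
    [X^2 + Y^2 = 4 u = r^2] and with differentials that are independent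
    combinations of [a1] and [a2] ([polar_coordinates]).  The coordinates asked
    for are the polar coordinates of [(X, Y)].

    Two points are on the same leaf of a small neighbourhood exactly when
    [(X, Y)] agrees on them ([leaf_constant], [flow_box]): adding one coordinate
    function to [X] and [Y] gives a local diffeomorphism onto a box in [R^3],
    by the inverse function theorem ([local_inverse]), and in the box the fibres
    of [(X, Y)] are segments. *)

(** * Directional derivatives *)

Section DirectionalDerivatives.
Context {R : realType}.

Lemma derive_line (V W : normedModType R) (f : V -> W) x v :
  'D_1 (fun t : R => f (t *: v + x)) 0 = 'D_v f x.
Proof.
rewrite /derive; set g1 := fun h => h^-1 *: _; set g2 := fun h => h^-1 *: _.
suff -> : g1 = g2 by [].
by rewrite funeqE /g1 /g2 => t /=; rewrite addr0 scale0r add0r [_%:A]mulr1.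
Qed.

(** The form in which the chain rule and the mean value theorem for functions of
    one variable apply to directional derivatives. *)
Lemma is_derive_line (V W : normedModType R) (f : V -> W) x v (b : W) :
  is_derive x v f b <-> is_derive (0 : R) 1 (fun t : R => f (t *: v + x)) b.
Proof.
split=> -[df <-]; apply: DeriveDef.
- by move/derivable1P : df.
- exact: derive_line.
- by apply/derivable1P.
- by rewrite derive_line.
Qed.

Lemma is_derive_along (V W : normedModType R) (f : V -> W) x v t (b : W) :
  is_derive (t *: v + x) v f b -> is_derive t 1 (fun u : R => f (u *: v + x)) b.
Proof.
move=> /is_derive_line D; apply/is_derive_line.
set g := (X in is_derive _ _ X _) in D; set g' := (X in is_derive _ _ X _).
suff -> : g' = g by [].
by apply/funext => h; rewrite /g /g' /= [_%:A]mulr1 scalerDl addrA.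
Qed.

Lemma is_derive_mulr (s t : R) : is_derive t 1 (fun u : R => u * s) s.
Proof.
apply: is_derive_eq (is_deriveM (is_derive_id t 1) (is_derive_cst s t 1)) _.
by rewrite scaler0 add0r [_ *: _]mulr1.
Qed.

Lemma is_derive_scale (V : normedModType R) (f : V -> R) x v (s b : R) :
  is_derive x v f b -> is_derive x (s *: v) f (s * b).
Proof.
move=> /is_derive_line D; apply/is_derive_line.
have D0 : is_derive ((0 : R) * s) 1 (fun t : R => f (t *: v + x)) b.
  by rewrite mul0r.
have Dm : is_derive (0 : R) 1 (fun t : R => t * s) s.
  exact: is_derive_mulr.
have := is_derive1_comp (f := fun t : R => f (t *: v + x)) (g := fun t => t * s) D0 Dm.
rewrite mulrC.
set g := (X in is_derive _ _ X _); set g' := (X in _ -> is_derive _ _ X _).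
suff -> : g' = g by [].
by apply/funext => h; rewrite /g /g' /= scalerA.
Qed.

Lemma derive_rule_comp (V : normedModType R) (h : R -> R) (f : V -> R) x v (a b : R) :
  is_derive x v f b -> is_derive (f x) 1 h a ->
  is_derive x v (fun y => h (f y)) (a * b).
Proof.
move=> /is_derive_line Df Dh; apply/is_derive_line.
have Dh0 : is_derive (f ((0 : R) *: v + x)) 1 h a by rewrite scale0r add0r.
exact: (is_derive1_comp Dh0 Df).
Qed.

Lemma differentiable_linear_approx (V W : normedModType R) (f : V -> W)
    (F : {linear V -> W}) x : continuous F ->
  (forall e : R, 0 < e ->
     \forall h \near (0 : V), `|f (h + x) - f x - F h| <= e * `|h|) ->
  differentiable f x /\ 'd f x = F :> (V -> W).
Proof.
move=> Fc Fo; have dF : 'd f x = F :> (V -> W).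
  apply: diff_unique => //; apply/eqaddoP => e e0; near=> h.
  by rewrite !fctE /= opprD addrA; near: h; exact: Fo.
split=> //; apply/diff_locallyP; rewrite dF; split=> //.
apply/eqaddoP => e e0; near=> h.
by rewrite !fctE /= opprD addrA; near: h; exact: Fo.
Unshelve. all: by end_near. Qed.

End DirectionalDerivatives.

(** * Functions with continuous partial derivatives up to a given order *)

Section SmoothCalculus.
Context {R : realType} {n : nat}.
Implicit Types (U : set 'rV[R]_n) (f g : 'rV[R]_n -> R).

(** The finite orders of [smooth_on].  Closure of [smooth_on] under sums,
    products, composition and so on is proved by induction on the order: a
    product rule of order [k + 1] uses the rules of order [k] for the partial
    derivatives, which [smooth_on], speaking of all orders at once, does not
    offer. *)
Fixpoint Ck (k : nat) U f : Prop :=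
  (forall x, U x -> {for x, continuous f}) /\
  (if k is k'.+1 then
     (forall x i, U x -> derivable f x (delta_mx 0 i)) /\
     forall i, Ck k' U (partial i f)
   else True).

Lemma partials_rcons (s : seq 'I_n) i f :
  partials (rcons s i) f = partials s (partial i f).
Proof. by rewrite /partials foldr_rcons. Qed.

Lemma smooth_partial U f i : smooth_on U f -> smooth_on U (partial i f).
Proof. by move=> sf s x Ux; have := sf (rcons s i) x Ux; rewrite partials_rcons. Qed.

Lemma smooth_onP U f : smooth_on U f <-> forall k, Ck k U f.
Proof.
split=> [sf k|sf s].
  elim: k f sf => [|k IH] f sf /=.
    by split=> // x Ux; have [] := sf [::] x Ux.
  split; first by move=> x Ux; have [] := sf [::] x Ux.
  split=> [x i Ux|i]; first by have [_ ] := sf [::] x Ux; apply.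
  by apply: IH; apply: smooth_partial.
elim/last_ind: s f sf => [|s i IH] f sf x Ux.
  by split=> [|i]; have [cf [df _]] := sf 1%N; [exact: cf|exact: df].
rewrite partials_rcons; apply: IH => // k.
by have [_ [_ H]] := sf k.+1; exact: H.
Qed.

Lemma Ck_continuous k U f x : Ck k U f -> U x -> {for x, continuous f}.
Proof. by case: k => [|k] [cf _]; apply: cf. Qed.

Lemma Ck_derivable k U f x i :
  Ck k.+1 U f -> U x -> derivable f x (delta_mx 0 i).
Proof. by move=> [_ [df _]]; apply: df. Qed.

Lemma Ck_partial k U f i : Ck k.+1 U f -> Ck k U (partial i f).
Proof. by move=> [_ [_ H]]; exact: H. Qed.

Lemma CkW k U f : Ck k.+1 U f -> Ck k U f.
Proof.
elim: k f => [|k IH] f; first by case.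
move=> [cf [df pf]]; split=> //; split=> // i; exact: IH.
Qed.

Lemma Ck_sub k U V f : V `<=` U -> Ck k U f -> Ck k V f.
Proof.
move=> VU; elim: k f => [|k IH] f.
  by case=> cf _; split=> // x /VU; exact: cf.
case=> cf [df pf]; split=> [x /VU|]; first exact: cf.
split=> [x i /VU Ux|i]; first by apply: df.
by apply: IH; apply: pf.
Qed.

Lemma eq_continuous_at U f g x : open U -> U x -> (forall y, U y -> f y = g y) ->
  {for x, continuous f} -> {for x, continuous g}.
Proof.
move=> oU Ux fg cf; have nU : \forall y \near x, U y by exact: open_nbhs_nbhs.
rewrite /prop_for /continuous_at -(fg x Ux); apply: cvg_trans cf.
by apply: (@near_eq_cvg _ _ (nbhs x)); apply: filterS nU => y; exact: fg.
Qed.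

Lemma Ck_eq k U f g : open U -> (forall x, U x -> f x = g x) ->
  Ck k U f -> Ck k U g.
Proof.
move=> oU; elim: k f g => [|k IH] f g fg [cf H]; split=> //.
- by move=> x Ux; apply: (eq_continuous_at oU Ux fg); exact: cf.
- by move=> x Ux; apply: (eq_continuous_at oU Ux fg); exact: cf.
have nfg x : U x -> {near x, f =1 g}.
  move=> Ux; have nU : \forall y \near x, U y by exact: open_nbhs_nbhs.
  by apply: filterS nU.
case: H => df pf; split=> [x i Ux|i].
  by apply: near_eq_derivable (nfg x Ux) _; exact: df.
apply: IH (pf i) => x Ux; rewrite /partial.
by apply: near_eq_derive; exact: nfg.
Qed.

(** The engine of the inductions below: one order is gained by exhibiting the
    partial derivatives explicitly. *)
Lemma Ck_step k U f (df : 'I_n -> 'rV[R]_n -> R) : open U ->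
  (forall x, U x -> {for x, continuous f}) ->
  (forall x i, U x -> is_derive x (delta_mx 0 i : 'rV[R]_n) f (df i x)) ->
  (forall i, Ck k U (df i)) -> Ck k.+1 U f.
Proof.
move=> oU cf Df Cdf; split=> //; split=> [x i Ux|i].
  by have := Df x i Ux.
apply: Ck_eq (Cdf i) => // x Ux.
by rewrite /partial; have D := Df x i Ux; rewrite derive_val.
Qed.

Lemma Ck_is_derive k U f x i : Ck k.+1 U f -> U x ->
  is_derive x (delta_mx 0 i : 'rV[R]_n) f (partial i f x).
Proof. by move=> cf Ux; apply/derivableP; exact: Ck_derivable cf Ux. Qed.

Lemma Ck_cst k U (a : R) : open U -> Ck k U (fun=> a).
Proof.
move=> oU; elim: k a => [|k IH] a.
  by split=> // x _; exact: cst_continuous.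
apply: (Ck_step (df := fun _ _ => 0)) => //.
by move=> x _; exact: cst_continuous.
Qed.

Lemma Ck_add k U f g : open U -> Ck k U f -> Ck k U g ->
  Ck k U (fun x => f x + g x).
Proof.
move=> oU; elim: k f g => [|k IH] f g Cf Cg.
  by split=> // x Ux; apply: continuousD; apply: Ck_continuous Ux; eassumption.
apply: (Ck_step (df := fun i x => partial i f x + partial i g x)) => //.
- by move=> x Ux; apply: continuousD; apply: Ck_continuous Ux; eassumption.
- move=> x i Ux; have := Ck_is_derive i Cf Ux; have := Ck_is_derive i Cg Ux.
  by move=> ? ?; apply: is_deriveD.
- by move=> i; apply: IH; exact: Ck_partial.
Qed.

Lemma Ck_mul k U f g : open U -> Ck k U f -> Ck k U g ->
  Ck k U (fun x => f x * g x).
Proof.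
move=> oU; elim: k f g => [|k IH] f g Cf Cg.
  by split=> // x Ux; apply: continuousM; apply: Ck_continuous Ux; eassumption.
apply: (Ck_step (df := fun i x => f x * partial i g x + g x * partial i f x)) => //.
- by move=> x Ux; apply: continuousM; apply: Ck_continuous Ux; eassumption.
- move=> x i Ux; have := Ck_is_derive i Cf Ux; have := Ck_is_derive i Cg Ux.
  by move=> ? ?; apply: is_deriveM.
- move=> i; apply: Ck_add => //; apply: IH;
    by [exact: CkW|exact: Ck_partial].
Qed.

Definition smooth1 (V : set R) (h : R -> R) : Prop :=
  forall x, V x -> forall k, derivable (derive1n k h) x 1.

Lemma smooth1_derive V h : smooth1 V h -> smooth1 V (derive1 h).
Proof. by move=> sh x Vx k; rewrite -derive1Sn; exact: sh. Qed.

Lemma smooth1_is_derive V h x : smooth1 V h -> V x -> is_derive x 1 h (derive1 h x).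
Proof. by move=> sh Vx; rewrite derive1E; apply/derivableP; exact: (sh x Vx 0%N). Qed.

Lemma Ck_comp1 k U V f h : open U -> smooth1 V h -> (forall x, U x -> V (f x)) ->
  Ck k U f -> Ck k U (fun x => h (f x)).
Proof.
move=> oU; have cont h' x : smooth1 V h' -> U x -> (forall x, U x -> V (f x)) ->
    {for x, continuous f} -> {for x, continuous (fun x => h' (f x))}.
  move=> sh Ux UV cf; apply: continuous_comp => //.
  apply: differentiable_continuous; apply/derivable1_diffP.
  exact: (sh _ (UV x Ux) 0%N).
elim: k h => [|k IH] h sh UV Cf.
  by split=> // x Ux; apply: cont => //; exact: Ck_continuous Cf Ux.
apply: (Ck_step (df := fun i x => derive1 h (f x) * partial i f x)) => //.
- by move=> x Ux; apply: cont => //; exact: Ck_continuous Cf Ux.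
- move=> x i Ux; have := Ck_is_derive i Cf Ux.
  move=> Df; apply: (derive_rule_comp Df).
  exact: smooth1_is_derive sh (UV x Ux).
- move=> i; apply: Ck_mul => //; last exact: Ck_partial.
  exact: (IH _ (smooth1_derive sh) UV (CkW Cf)).
Qed.

Lemma Ck_inv k U f : open U -> (forall x, U x -> f x != 0) -> Ck k U f ->
  Ck k U (fun x => (f x)^-1).
Proof.
move=> oU fN0; elim: k => [|k IH] Cf.
  by split=> // x Ux; apply: continuousV; [exact: fN0|exact: Ck_continuous Cf Ux].
apply: (Ck_step (df := fun i x => - 1 * ((f x)^-1 * (f x)^-1 * partial i f x))) => //.
- by move=> x Ux; apply: continuousV; [exact: fN0|exact: Ck_continuous Cf Ux].
- move=> x i Ux; have D := Ck_is_derive i Cf Ux.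
  have DV := is_deriveV (fN0 x Ux : id (f x) != 0) (is_derive_id (f x) 1).
  apply: is_derive_eq (derive_rule_comp D DV) _.
  by rewrite [_ *: _]mulr1 mulN1r mulNr -exprVn expr2.
- move=> i; apply: Ck_mul; [by []|exact: Ck_cst|].
  apply: Ck_mul; [by []| |exact: Ck_partial].
  by apply: Ck_mul => //; apply: IH; exact: CkW.
Qed.

Lemma Ck_sum k U (I : finType) (f : I -> 'rV[R]_n -> R) : open U ->
  (forall i, Ck k U (f i)) -> Ck k U (fun x => \sum_i f i x).
Proof.
move=> oU Cf; suff H (s : seq I) : Ck k U (fun x => \sum_(i <- s) f i x) by exact: H.
elim: s => [|i s IH].
  by apply: (Ck_eq (f := fun=> 0)) => // [x _|]; [rewrite big_nil|exact: Ck_cst].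
apply: (Ck_eq (f := fun x => f i x + \sum_(j <- s) f j x)) => // [x _|].
  by rewrite big_cons.
exact: Ck_add.
Qed.

Lemma Ck_prod k U (I : finType) (f : I -> 'rV[R]_n -> R) : open U ->
  (forall i, Ck k U (f i)) -> Ck k U (fun x => \prod_i f i x).
Proof.
move=> oU Cf; suff H (s : seq I) : Ck k U (fun x => \prod_(i <- s) f i x) by exact: H.
elim: s => [|i s IH].
  by apply: (Ck_eq (f := fun=> 1)) => // [x _|]; [rewrite big_nil|exact: Ck_cst].
apply: (Ck_eq (f := fun x => f i x * \prod_(j <- s) f j x)) => // [x _|].
  by rewrite big_cons.
exact: Ck_mul.
Qed.

Lemma is_derive_coord (i : 'I_n) (x v : 'rV[R]_n) :
  is_derive x v (fun y : 'rV[R]_n => y 0 i) (v 0 i).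
Proof.
apply/is_derive_line; set g := (X in is_derive _ _ X _).
have -> : g = (fun t : R => t * v 0 i + x 0 i).
  by apply/funext => t; rewrite /g !mxE.
by apply: is_derive_eq (is_deriveD (is_derive_mulr _ _) (is_derive_cst _ _ _)) _;
  rewrite addr0.
Qed.

Lemma Ck_coord k U (i : 'I_n) : open U -> Ck k U (fun x => x 0 i).
Proof.
move=> oU; case: k => [|k].
  by split=> // x _; exact: coord_continuous.
apply: (Ck_step (df := fun j _ => (delta_mx 0 j : 'rV[R]_n) 0 i)) => //.
- by move=> x _; exact: coord_continuous.
- by move=> x j _; exact: is_derive_coord.
- by move=> j; exact: Ck_cst.
Qed.

Lemma Ck_sqrt k U f : open U -> (forall x, U x -> 0 < f x) -> Ck k U f ->
  Ck k U (fun x => Num.sqrt (f x)).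
Proof.
move=> oU f0; elim: k => [|k IH] Cf.
  split=> // x Ux; apply: continuous_comp; first exact: Ck_continuous Cf Ux.
  exact: sqrt_continuous.
apply: (Ck_step (df := fun i x => (2 * Num.sqrt (f x))^-1 * partial i f x)) => //.
- move=> x Ux; apply: continuous_comp; first exact: Ck_continuous Cf Ux.
  exact: sqrt_continuous.
- move=> x i Ux; apply: (derive_rule_comp (Ck_is_derive i Cf Ux)).
  exact/is_derive1_sqrt/f0.
- move=> i; apply: Ck_mul; [by []| |exact: Ck_partial].
  apply: Ck_inv => //.
    by move=> x Ux; rewrite mulf_neq0 ?pnatr_eq0 // gt_eqF // sqrtr_gt0 f0.
  by apply: Ck_mul; [by []|exact: Ck_cst|exact: IH (CkW Cf)].
Qed.

End SmoothCalculus.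

(** * Mean value estimates *)

Section MeanValue.
Context {R : realType} {n : nat}.
Implicit Types (U : set 'rV[R]_n) (f g : 'rV[R]_n -> R) (x y z : 'rV[R]_n).

Definition cube x (d : R) : set 'rV[R]_n :=
  [set y | forall i, `|y 0 i - x 0 i| < d].

Lemma cube_center x d : 0 < d -> cube x d x.
Proof. by move=> d0 i; rewrite subrr normr0. Qed.

Lemma nbhs_cubeP x (A : set 'rV[R]_n) :
  nbhs x A <-> exists2 d : R, 0 < d & cube x d `<=` A.
Proof.
split=> [/nbhs_ballP[d /= d0 H]|[d d0 H]].
  exists d => // y yc; apply: H; split => // i j.
  by rewrite (ord1 i) /ball /= distrC.
apply/nbhs_ballP; exists d => // y [_ yb]; apply: H => i.
by have := yb 0 i; rewrite /ball /= distrC.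
Qed.

Lemma cubeE x d : 0 < d -> cube x d = ball x d.
Proof.
move=> d0; apply/seteqP; split=> y; last first.
  by move=> [_ yb] i; have := yb 0 i; rewrite /ball /= distrC.
by move=> yc; split=> // i j; rewrite (ord1 i) /ball /= distrC.
Qed.

Lemma open_cube x d : 0 < d -> open (cube x d).
Proof. by move=> d0; rewrite cubeE //; exact: ball_open. Qed.

Lemma sub_cube x d e : d <= e -> cube x d `<=` cube x e.
Proof. by move=> de y yc i; apply: lt_le_trans (yc i) de. Qed.

Lemma open_cube_sub U x : open U -> U x -> exists2 d : R, 0 < d & cube x d `<=` U.
Proof. by move=> oU Ux; apply/nbhs_cubeP; apply: open_nbhs_nbhs; split. Qed.

Lemma normv_le x (d : R) : 0 <= d -> (`|x| <= d) <-> forall i, `|x 0 i| <= d.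
Proof.
move=> d0; rewrite [X in X <= d]/Num.Def.normr/= mx_normrE.
split=> [/bigmax_leP[_ H] i|H]; first by have := H (0, i) isT.
by apply: bigmax_le => // -[i j] _ /=; rewrite (ord1 i).
Qed.

Lemma cubeP x d y : 0 < d -> cube x d y <-> `|y - x| < d.
Proof. by move=> d0; rewrite cubeE // -ball_normE /ball_ /= distrC. Qed.

Lemma le_normv x i : `|x 0 i| <= `|x|.
Proof. by have [H _] := normv_le x (normr_ge0 x); apply: H. Qed.

Lemma mean_value_segment (g dg : R -> R) (c e : R) :
  (forall t : R, 0 <= t <= 1 -> is_derive t 1 g (dg t)) ->
  (forall t : R, 0 <= t <= 1 -> `|dg t - c| <= e) -> `|g 1 - g 0 - c| <= e.
Proof.
move=> Dg be.
have [t t01 ->] : exists2 t, t \in `]0, 1[%R & g 1 - g 0 = dg t * (1 - 0).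
  apply: MVT => // [t|].
    by rewrite in_itv /= => /andP[t0 t1]; apply: Dg; rewrite !ltW.
  apply: derivable_within_continuous => t; rewrite in_itv /= => t01.
  by have := Dg t t01.
by rewrite subr0 mulr1 be //; move: t01; rewrite in_itv /= => /andP[t0 t1]; rewrite !ltW.
Qed.

Lemma is_derive_coordinate_line f (s t : R) (i : 'I_n) x :
  derivable f ((t * s) *: delta_mx 0 i + x) (delta_mx 0 i) ->
  is_derive t 1 (fun u : R => f ((u * s) *: delta_mx 0 i + x))
    (s * partial i f ((t * s) *: delta_mx 0 i + x)).
Proof.
move=> df.
have H : is_derive (t *: (s *: delta_mx 0 i) + x : 'rV[R]_n) (s *: delta_mx 0 i) f
    (s * partial i f (t *: (s *: delta_mx 0 i) + x)).
  by apply: is_derive_scale; rewrite scalerA; apply/derivableP.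
have := is_derive_along H; rewrite scalerA.
set g := (X in is_derive _ _ X _); set g' := (X in _ -> is_derive _ _ X _).
suff -> : g = g' by [].
by apply/funext => h; rewrite /g /g' /= scalerA.
Qed.

Lemma coordinate_step f (c e s : R) (i : 'I_n) x :
  (forall t : R, 0 <= t <= 1 -> derivable f ((t * s) *: delta_mx 0 i + x) (delta_mx 0 i)) ->
  (forall t : R, 0 <= t <= 1 -> `|partial i f ((t * s) *: delta_mx 0 i + x) - c| <= e) ->
  `|f (s *: delta_mx 0 i + x) - f x - c * s| <= `|s| * e.
Proof.
move=> Df be.
have := @mean_value_segment (fun t => f ((t * s) *: delta_mx 0 i + x))
  (fun t => s * partial i f ((t * s) *: delta_mx 0 i + x)) (c * s) (`|s| * e).
rewrite mul1r mul0r scale0r add0r; apply=> t t01.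
  exact/is_derive_coordinate_line/Df.
by rewrite [c * s]mulrC -mulrBr normrM ler_wpM2l // be.
Qed.

Lemma convex_norm_lt (t a b d : R) : 0 <= t -> t <= 1 -> `|a| < d -> `|b| < d ->
  `|t * a + (1 - t) * b| < d.
Proof.
move=> t0 t1 ad bd; have t1' : 0 <= 1 - t by rewrite subr_ge0.
pose m := Num.max `|a| `|b|; have md : m < d by rewrite gt_max ad bd.
apply: le_lt_trans md; apply: le_trans (ler_normD _ _) _.
rewrite !normrM (ger0_norm t0) (ger0_norm t1').
have -> : m = t * m + (1 - t) * m by ring.
by apply: lerD; apply: ler_wpM2l => //; rewrite le_max lexx ?orbT.
Qed.

(** Walking from [y] to [z] along the coordinate directions, one at a time, stays
    in the cube, and each step is a matter of one partial derivative. *)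
Lemma cube_mean_value f x0 d (c : 'I_n -> R) (e : R) y z :
  (forall x i, cube x0 d x -> derivable f x (delta_mx 0 i)) ->
  (forall x i, cube x0 d x -> `|partial i f x - c i| <= e) ->
  cube x0 d y -> cube x0 d z ->
  `|f z - f y - \sum_i c i * (z 0 i - y 0 i)| <= \sum_i `|z 0 i - y 0 i| * e.
Proof.
move=> Df be yc zc.
(* the corner reached after the first k coordinates have been moved *)
pose p (k : nat) : 'rV[R]_n := \row_j (if (j < k)%N then z 0 j else y 0 j).
have p0 : p 0%N = y by apply/rowP => j; rewrite mxE.
have pn : p n = z by apply/rowP => j; rewrite mxE ltn_ord.
have pS (i : 'I_n) : p i.+1 = (z 0 i - y 0 i) *: delta_mx 0 i + p i.
  apply/rowP => j; rewrite !mxE eqxx /= ltnS leq_eqVlt -val_eqE /=.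
  case: (ltngtP j i) => [||ji] /=; rewrite ?mulr0 ?add0r // mulr1.
  by rewrite (val_inj ji) subrK.
have -> : f z - f y = \sum_(i < n) (f (p i.+1) - f (p i)).
  rewrite -p0 -pn -(telescope_sumr (fun k => f (p k))) //.
  by rewrite big_mkord.
have seg (i : 'I_n) (t : R) : 0 <= t <= 1 ->
    cube x0 d ((t * (z 0 i - y 0 i)) *: delta_mx 0 i + p i).
  move=> /andP[t0 t1] j; rewrite !mxE eqxx /=; have [->|ji] := eqVneq j i.
    rewrite ltnn mulr1.
    have -> : t * (z 0 i - y 0 i) + y 0 i - x0 0 i =
        t * (z 0 i - x0 0 i) + (1 - t) * (y 0 i - x0 0 i) by ring.
    exact: convex_norm_lt t0 t1 (zc i) (yc i).
  by rewrite mulr0 add0r; case: ifP => _; [exact: zc|exact: yc].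
rewrite -sumrB; apply: le_trans (ler_norm_sum _ _ _) _.
apply: ler_sum => i _; rewrite pS; apply: coordinate_step => t t01.
- exact/Df/seg.
- exact/be/seg.
Qed.

(** The error is controlled for two arbitrary points near [x0] rather than for
    one point and [x0]: this is what makes the map of the inverse function
    theorem a contraction and its inverse Lipschitz, and what the symmetry of
    second derivatives needs. *)
Lemma C1_strictly_differentiable U f x0 (e : R) : open U -> Ck 1 U f -> U x0 -> 0 < e ->
  exists d : R, [/\ 0 < d, cube x0 d `<=` U &
    forall y z, cube x0 d y -> cube x0 d z ->
      `|f z - f y - \sum_i partial i f x0 * (z 0 i - y 0 i)| <= e * `|z - y|].
Proof.
move=> oU Cf Ux0 e0; pose e' := e / n.+1%:R.
have e'0 : 0 < e' by rewrite divr_gt0.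
have [d1 d10 d1U] := open_cube_sub oU Ux0.
have [d2 d20 d2e] : exists2 d : R, 0 < d &
    cube x0 d `<=` [set x | forall i, `|partial i f x - partial i f x0| <= e'].
  apply/nbhs_cubeP.
  have : \forall x \near nbhs x0, forall i, `|partial i f x - partial i f x0| <= e'; last by [].
  apply: filter_forall => i.
  have /cvgrPdist_le/(_ _ e'0) := Ck_continuous (Ck_partial i Cf) Ux0.
  by apply: filterS => x; rewrite distrC.
exists (Num.min d1 d2); split.
- by rewrite lt_min d10.
- by apply: subset_trans d1U; apply: sub_cube; rewrite ge_min lexx.
move=> y z yc zc.
apply: le_trans (_ : \sum_i `|z 0 i - y 0 i| * e' <= _).
  apply: cube_mean_value yc zc => x i /sub_cube xc.
    by apply: Ck_derivable Cf _; apply: d1U; apply: xc; rewrite ge_min lexx.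
  by apply: (d2e x (xc d2 _)); rewrite ge_min lexx orbT.
apply: le_trans (_ : \sum_(i < n) `|z - y| * e' <= _).
  apply: ler_sum => i _; apply: ler_wpM2r; first exact: ltW.
  by have := le_normv (z - y) i; rewrite !mxE.
rewrite sumr_const card_ord -mulrnAr mulrC ler_wpM2r //.
rewrite /e' -mulr_natr -mulrA ler_piMr ?(ltW e0) //.
by rewrite mulrC ler_pdivrMr // mul1r ler_nat.
Qed.

(** Partial derivatives that are bounded near [x] make [f] Lipschitz there.  This
    gives the continuity of the primitive of a closed form. *)
Lemma continuous_of_partials U f (b : 'I_n -> 'rV[R]_n -> R) x : open U -> U x ->
  (forall y i, U y -> is_derive y (delta_mx 0 i : 'rV[R]_n) f (b i y)) ->
  (forall i, {for x, continuous (b i)}) -> {for x, continuous f}.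
Proof.
move=> oU Ux Df cb.
have [d1 d10 d1U] := open_cube_sub oU Ux.
have [d2 d20 d2b] : exists2 d : R, 0 < d &
    cube x d `<=` [set y | forall i, `|b i y - b i x| <= 1].
  apply/nbhs_cubeP.
  have : \forall y \near nbhs x, forall i, `|b i y - b i x| <= 1; last by [].
  apply: filter_forall => i.
  have /cvgrPdist_le/(_ _ ltr01) := cb i.
  by apply: filterS => y; rewrite distrC.
pose d := Num.min d1 d2.
have d0 : 0 < d by rewrite lt_min d10.
have sd1 : cube x d `<=` U.
  by apply: subset_trans d1U; apply: sub_cube; rewrite ge_min lexx.
have sd2 : cube x d `<=` cube x d2 by apply: sub_cube; rewrite ge_min lexx orbT.
pose B : R := \sum_i (`|b i x| + 1) + 1.
have B0 : 0 < B by rewrite ltr_wpDl // sumr_ge0 // => i _; rewrite addr_ge0.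
apply/(@cvgrPdist_le _ _ _ (nbhs x)) => e e0; apply/nbhs_cubeP.
have d'0 : 0 < Num.min d (e / B) by rewrite lt_min d0 divr_gt0.
exists (Num.min d (e / B)) => // z zc.
have zd : cube x d z by apply: sub_cube zc; rewrite ge_min lexx.
have ze : `|z - x| <= e / B.
  by move/cubeP: zc => /(_ d'0) /ltW h; apply: le_trans h _; rewrite ge_min lexx orbT.
have := @cube_mean_value f x d (fun i => b i x) 1 x z.
have H1 y i : cube x d y -> derivable f y (delta_mx 0 i).
  by move=> /sd1 Uy; have [] := Df y i Uy.
have H2 y i : cube x d y -> `|partial i f y - b i x| <= 1.
  move=> yc; rewrite /partial; have D := Df y i (sd1 _ yc).
  by rewrite derive_val; apply: d2b; exact: sd2.
move=> /(_ H1 H2 (cube_center _ d0) zd) H.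
rewrite /= distrC -(subrK (\sum_i b i x * (z 0 i - x 0 i)) (f z - f x)).
apply: le_trans (ler_normD _ _) _.
apply: le_trans (_ : \sum_i (`|b i x| + 1) * (e / B) <= _); last first.
  rewrite -mulr_suml -[leRHS](divfK (lt0r_neq0 B0)) mulrC.
  by rewrite ler_pM2l ?divr_gt0 // lerDl.
have zi i : `|z 0 i - x 0 i| <= e / B.
  by apply: le_trans ze; have := le_normv (z - x) i; rewrite !mxE.
apply: le_trans (_ : \sum_i `|z 0 i - x 0 i| * 1 + \sum_i `|b i x| * (e / B) <= _).
  apply: lerD => //; apply: le_trans (ler_norm_sum _ _ _) _.
  by apply: ler_sum => i _; rewrite normrM ler_wpM2l.
rewrite -big_split /=; apply: ler_sum => i _.
by rewrite mulr1 mulrDl mul1r addrC lerD2l.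
Qed.

Lemma C1_differentiable U f x : open U -> Ck 1 U f -> U x ->
  differentiable f x /\
  forall v, 'd f x v = \sum_i v 0 i * partial i f x.
Proof.
move=> oU Cf Ux.
pose l (v : 'rV[R]_n) : R := \sum_i v 0 i * partial i f x.
have lin : linear l.
  move=> a u v; rewrite /l scaler_sumr -big_split /=.
  by apply: eq_bigr => i _; rewrite !mxE mulrDl -mulrA.
pose L := GRing.isLinear.Build _ _ _ _ l lin.
pose F : {linear 'rV[R]_n -> R} := HB.pack l L.
have Fc : continuous F.
  move=> v; apply: (Ck_continuous (k := 0) (U := setT)) => //.
  apply: Ck_sum => [|i]; first exact: openT.
  by apply: Ck_mul; [exact: openT|apply/Ck_coord/openT|apply/Ck_cst/openT].
have [|df dF] := @differentiable_linear_approx R _ _ f F x Fc.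
  move=> e e0; have [d [d0 dU dd]] := C1_strictly_differentiable oU Cf Ux e0.
  apply/nbhs_cubeP; exists d => // h hc /=.
  have hx : cube x d (h + x) by move=> i; have := hc i; rewrite !mxE subr0 addrK.
  have := dd x (h + x) (cube_center _ d0) hx; rewrite addrK.
  have -> // : \sum_i partial i f x * ((h + x) 0 i - x 0 i) = l h.
  by apply: eq_bigr => i _; rewrite mxE addrK mulrC.
by split=> // v; rewrite dF.
Qed.

Lemma chain_curve U f (g : R -> 'rV[R]_n) t v : open U -> Ck 1 U f -> U (g t) ->
  is_derive t 1 g v ->
  is_derive t 1 (fun s => f (g s)) (\sum_i v 0 i * partial i f (g t)).
Proof.
move=> oU Cf Ug Dg.
have [df dfE] := C1_differentiable oU Cf Ug.
have dg : differentiable g t by apply/derivable1_diffP; case: Dg.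
apply: DeriveDef; first by apply/derivable1_diffP; apply: differentiable_comp.
rewrite deriveE; last exact: differentiable_comp.
have vE : v = 'd g t 1 by rewrite -deriveE // derive_val.
by rewrite -dfE (@diff_comp R _ _ _ g f) //= vE.
Qed.

(** As a function of the [j]-th step, the second difference has derivative
    [s (partial j f (y + s e_i) - partial j f y)], which strict differentiability
    of [partial j f] compares with [s^2 partial i (partial j f)]. *)
Lemma second_difference U f x i j (e : R) : open U -> Ck 2 U f -> U x -> 0 < e ->
  exists2 d : R, 0 < d & forall s : R, 0 < s < d ->
    `|f (s *: delta_mx 0 j + (s *: delta_mx 0 i + x))
      - f (s *: delta_mx 0 i + x) - (f (s *: delta_mx 0 j + x) - f x)
      - s ^+ 2 * partial i (partial j f) x| <= s ^+ 2 * e.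
Proof.
move=> oU Cf Ux e0; have Cg := Ck_partial j Cf.
have [d [d0 dU dd]] := C1_strictly_differentiable oU Cg Ux e0.
(* when i = j the two steps add up, whence d / 2 *)
exists (d / 2); first by rewrite divr_gt0.
move=> s /andP[s0 sd].
have deltaE (k l : 'I_n) : (delta_mx 0 k : 'rV[R]_n) 0 l = (l == k)%:R.
  by rewrite mxE eqxx.
have small (a b : R) : 0 <= a -> a <= s -> 0 <= b -> b <= s ->
    cube x d (a *: delta_mx 0 j + (b *: delta_mx 0 i + x)).
  move=> a0 as_ b0 bs k; rewrite !mxE /= addrA addrK.
  apply: le_lt_trans (_ : a + b < d); last by lra.
  rewrite ger0_norm; first by do 2!case: (k == _); rewrite ?mulr1 ?mulr0; lra.
  by rewrite addr_ge0 // mulr_ge0.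
have D (t b : R) : 0 <= t <= 1 -> b = 0 \/ b = s ->
    is_derive t 1 (fun t : R => f ((t * s) *: delta_mx 0 j + (b *: delta_mx 0 i + x)))
      (s * partial j f ((t * s) *: delta_mx 0 j + (b *: delta_mx 0 i + x))).
  move=> /andP[t0 t1] hb; apply: is_derive_coordinate_line.
  apply: Ck_derivable Cf _; apply: dU; apply: small; [nra|nra| |];
    by case: hb => ->; lra.
have := @mean_value_segment
  (fun t => f ((t * s) *: delta_mx 0 j + (s *: delta_mx 0 i + x))
            - f ((t * s) *: delta_mx 0 j + (0 *: delta_mx 0 i + x)))
  (fun t => s * partial j f ((t * s) *: delta_mx 0 j + (s *: delta_mx 0 i + x))
            - s * partial j f ((t * s) *: delta_mx 0 j + (0 *: delta_mx 0 i + x)))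
  (s ^+ 2 * partial i (partial j f) x) (s ^+ 2 * e).
rewrite !mul1r !mul0r !scale0r !add0r.
have -> : forall a b c d k : R, a - b - (c - d) - k = a - c - (b - d) - k.
  by move=> *; ring.
apply=> t t01.
  apply: is_deriveB; first by apply: D => //; right.
  by have := D t 0 t01 (or_introl erefl); rewrite scale0r add0r.
have /andP[t0 t1] := t01.
set z := _ + (s *: _ + x); set y := _ + x.
have yc : cube x d y.
  have := small (t * s) 0; rewrite scale0r add0r; apply; nra.
have zc : cube x d z by apply: small; nra.
have := dd y z yc zc.
have -> : \sum_k partial k (partial j f) x * (z 0 k - y 0 k) =
    s * partial i (partial j f) x.
  rewrite (bigD1 i) //= big1 ?addr0 => [|k ki].
    by rewrite !mxE !eqxx /=; ring.
  by rewrite !mxE !eqxx (negbTE ki) /=; ring.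
have -> : `|z - y| = s.
  have -> : z - y = s *: delta_mx 0 i.
    by apply/rowP => k; rewrite !mxE /=; ring.
  rewrite normrZ gtr0_norm // [X in _ * X](_ : _ = 1) ?mulr1 //.
  apply/eqP; rewrite eq_le; apply/andP; split.
    by apply/normv_le => // k; rewrite deltaE; case: (k == i); rewrite ?normr1 ?normr0.
  by have := le_normv (delta_mx 0 i : 'rV[R]_n) i; rewrite deltaE eqxx normr1.
move=> H; rewrite -mulrBr expr2 -mulrA -mulrBr normrM gtr0_norm // -mulrA ler_pM2l //.
by rewrite [s * e]mulrC.
Qed.

Lemma second_difference_aux (A B B' c p q s e : R) : 0 < s ->
  `|A - B - (B' - c) - s ^+ 2 * p| <= s ^+ 2 * (e / 2) ->
  `|A - B' - (B - c) - s ^+ 2 * q| <= s ^+ 2 * (e / 2) -> `|p - q| <= e.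
Proof.
move=> s0 h h'; have s20 : 0 < s ^+ 2 by rewrite exprn_gt0.
rewrite -(ler_pM2l s20) -[X in X * `|_|]gtr0_norm // -normrM.
have -> : s ^+ 2 * (p - q) =
  (A - B' - (B - c) - s ^+ 2 * q) - (A - B - (B' - c) - s ^+ 2 * p) by ring.
apply: le_trans (ler_normB _ _) _.
have -> : s ^+ 2 * e = s ^+ 2 * (e / 2) + s ^+ 2 * (e / 2) by field.
exact: lerD.
Qed.

(** Symmetry of second derivatives: both are the limit of the same second
    difference divided by [s^2]. *)
Lemma partialC U f x i j : open U -> Ck 2 U f -> U x ->
  partial i (partial j f) x = partial j (partial i f) x.
Proof.
move=> oU Cf Ux; apply/eqP; rewrite -subr_eq0 -normr_le0; apply/ler_addgt0Pl => e e0.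
rewrite addr0; have e20 : 0 < e / 2 by rewrite divr_gt0.
have [d d0 H] := second_difference i j oU Cf Ux e20.
have [d' d'0 H'] := second_difference j i oU Cf Ux e20.
pose s := Num.min d d' / 2.
have m0 : 0 < Num.min d d' by rewrite lt_min d0.
have s0 : 0 < s by rewrite divr_gt0.
have sm : s < Num.min d d' by rewrite /s; lra.
have sd : 0 < s < d by rewrite s0 (lt_le_trans sm) // ge_min lexx.
have sd' : 0 < s < d' by rewrite s0 (lt_le_trans sm) // ge_min lexx orbT.
have {H} := H s sd; have {H'} := H' s sd'.
rewrite addrCA => h h'; exact: (second_difference_aux s0 h' h).
Qed.

End MeanValue.

(** * Local inversion *)

(** Row vectors form a complete normed space, as the contraction principle
    requires. *)
HB.instance Definition _ (R : realType) n := Complete.on 'rV[R]_n.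

Section LocalInversion.
Context {R : realType} {n : nat}.
Implicit Types (U : set 'rV[R]_n) (F : 'rV[R]_n -> 'rV[R]_n) (x y z : 'rV[R]_n).

Definition Jacobian F x : 'M[R]_n := \matrix_(i, j) partial i (fun y => F y 0 j) x.

Definition mx_bound (B : 'M[R]_n) : R := \sum_k \sum_j `|B k j|.

Lemma norm_mulmx_le (a : 'rV[R]_n) (B : 'M[R]_n) : `|a *m B| <= mx_bound B * `|a|.
Proof.
have B0 : 0 <= mx_bound B by apply: sumr_ge0 => k _; apply: sumr_ge0.
apply/normv_le => [|j]; first by rewrite mulr_ge0.
rewrite mxE; apply: le_trans (ler_norm_sum _ _ _) _.
rewrite mulr_suml; apply: ler_sum => k _; rewrite normrM mulrC.
apply: ler_pM => //; last exact: le_normv.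
by rewrite (bigD1 j) //= lerDl sumr_ge0.
Qed.

Lemma mulmx_bounded (B : 'M[R]_n) :
  exists2 m : R, 0 < m & forall a : 'rV[R]_n, `|a *m B| <= m * `|a|.
Proof.
exists (mx_bound B + 1).
  by rewrite ltr_wpDl //; apply: sumr_ge0 => k _; apply: sumr_ge0.
by move=> a; apply: le_trans (norm_mulmx_le _ _) _; rewrite ler_wpM2r // lerDl.
Qed.

Lemma finite_common_radius (P : 'I_n -> R -> Prop) :
  (forall k (d d' : R), d' <= d -> P k d -> P k d') ->
  (forall k, exists2 d : R, 0 < d & P k d) ->
  exists2 d : R, 0 < d & forall k, P k d.
Proof.
move=> mono ex.
have H : \forall d \near (0 : R)^'+, forall k, P k d.
  apply: filter_forall => k; have [d d0 Pd] := ex k.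
  near=> d'; apply: mono Pd; near: d'; exact: nbhs_right_le.
near (0 : R)^'+ => d; exists d => //; near: d; exact: H.
Unshelve. all: by end_near. Qed.

Lemma C1_map_strictly_differentiable U F x0 (e : R) : open U ->
  (forall k, Ck 1 U (fun x => F x 0 k)) -> U x0 -> 0 < e ->
  exists d : R, [/\ 0 < d, cube x0 d `<=` U &
    forall y z, cube x0 d y -> cube x0 d z ->
      `|F z - F y - (z - y) *m Jacobian F x0| <= e * `|z - y|].
Proof.
move=> oU CF Ux0 e0.
have [d1 d10 d1U] := open_cube_sub oU Ux0.
have [||d2 d20 dd] := finite_common_radius (P := fun k d =>
  forall y z, cube x0 d y -> cube x0 d z ->
      `|F z 0 k - F y 0 k - \sum_i partial i (fun x => F x 0 k) x0 * (z 0 i - y 0 i)|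
      <= e * `|z - y|).
- by move=> k d d' d'd H y z /(sub_cube d'd) yc /(sub_cube d'd) zc; apply: H.
- by move=> k; have [d [d0 _ H]] := C1_strictly_differentiable oU (CF k) Ux0 e0; exists d.
exists (Num.min d1 d2); split.
- by rewrite lt_min d10.
- by apply: subset_trans d1U; apply: sub_cube; rewrite ge_min lexx.
have le2 : Num.min d1 d2 <= d2 by rewrite ge_min lexx orbT.
move=> y z /(sub_cube le2) yc /(sub_cube le2) zc.
apply/normv_le => [|k]; first by rewrite mulr_ge0 // ltW.
have := dd k y z yc zc; rewrite !mxE.
rewrite (eq_bigr (fun j => (z - y) 0 j * Jacobian F x0 j k)) // => i _.
by rewrite !mxE mulrC.
Qed.

(** Solving [F y = w] amounts to finding a fixed point of
    [y |-> y - (F y - w) J^-1], with [J] the Jacobian at [x0]; by strict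
    differentiability this map contracts distances by [1/2] near [x0].  The same
    estimate bounds [|z - y|] by a multiple of [|F z - F y|]. *)
Theorem local_inverse U F x0 : open U -> (forall k, Ck 1 U (fun x => F x 0 k)) ->
  U x0 -> Jacobian F x0 \in unitmx ->
  exists d e L : R, [/\ 0 < d, 0 < e, 0 < L /\ cube x0 d `<=` U,
    (forall y z, cube x0 d y -> cube x0 d z -> `|z - y| <= L * `|F z - F y|) &
    (forall w, cube (F x0) e w -> exists2 y, cube x0 d y & F y = w)].
Proof.
move=> oU CF Ux0 Ju; set J := Jacobian F x0 in Ju.
pose B : 'M[R]_n := invmx J; have [m m0 mB] := mulmx_bounded B.
have e0 : 0 < (2 * m)^-1 by rewrite invr_gt0 mulr_gt0.
have [d [d0 dU dd]] := C1_map_strictly_differentiable oU CF Ux0 e0.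
have {}dd y z : cube x0 d y -> cube x0 d z ->
    `|(z - y) - (F z - F y) *m B| <= 2^-1 * `|z - y|.
  move=> yc zc.
  have -> : (z - y) - (F z - F y) *m B = - ((F z - F y - (z - y) *m J) *m B).
    by rewrite [in RHS]mulmxBl (mulmxK Ju) opprB.
  rewrite normrN; apply: le_trans (mB _) _.
  apply: le_trans (_ : m * ((2 * m)^-1 * `|z - y|) <= _).
    by rewrite ler_pM2l // dd.
  by rewrite invfM mulrA mulrCA divff ?gt_eqF // mulr1.
exists d, (d / (4 * m)), (2 * m); split=> //.
- by rewrite divr_gt0 // mulr_gt0.
- by split=> //; rewrite mulr_gt0.
- move=> y z yc zc; have := dd y z yc zc; have := mB (F z - F y).
  set a := `|_ *m B|; set b := `|F z - F y| => h1 h2.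
  have : `|z - y| <= `|z - y - (F z - F y) *m B| + a.
    by rewrite -[X in `|X| <= _](subrK ((F z - F y) *m B)) ler_normD.
  by set q := `|z - y| in h2 *; move: h2; set q' := `| _ |; nra.
move=> w wc.
pose T y := y - (F y - w) *m B.
have d20 : 0 < d / 2 by rewrite divr_gt0.
pose A := closed_ball x0 (d / 2).
have AE : A = [set y | `|y - x0| <= d / 2].
  by rewrite /A closed_ballE //; apply/seteqP; split=> y; rewrite /closed_ball_ /= distrC.
have Ac y : A y -> cube x0 d y.
  by rewrite AE /= => h; apply/cubeP => //; apply: le_lt_trans h _; lra.
have TT y z : T z - T y = (z - y) - (F z - F y) *m B.
  rewrite /T !mulmxBl; move: (F z *m B) (F y *m B) (w *m B) => a b c.
  by apply/rowP => j; rewrite !mxE; ring.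
have Tc y z : A y -> A z -> `|T z - T y| <= 2^-1 * `|z - y|.
  by move=> /Ac yc /Ac zc; rewrite TT dd.
have Ax0 : A x0 by rewrite AE /= subrr normr0 ltW.
have TA : {homo T : y / A y >-> A y}.
  move=> y Ay; have := Tc _ _ Ax0 Ay; move: (Ay); rewrite AE /= => yd Ty.
  rewrite -(subrKA (T x0)); apply: le_trans (ler_normD _ _) _.
  (* T moves the centre by at most d / 4, so the ball of radius d / 2 is stable *)
  have wm : `|T x0 - x0| <= d / 4.
    rewrite /T addrAC subrr add0r normrN; apply: le_trans (mB _) _.
    have we : `|F x0 - w| <= d / (4 * m).
      by rewrite distrC; apply/ltW/cubeP => //; rewrite divr_gt0 // mulr_gt0.
    apply: le_trans (_ : m * (d / (4 * m)) <= _); first by rewrite ler_pM2l.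
    by rewrite [X in X <= _](_ : _ = d / 4) //; field; rewrite gt_eqF.
  have -> : d / 2 = 2^-1 * (d / 2) + d / 4 by field.
  apply: lerD => //; apply: le_trans Ty _; by rewrite ler_pM2l // invr_gt0.
have half0 : 0 <= (2^-1 : R) by rewrite invr_ge0.
pose q : {nonneg R} := NngNum half0.
have ctr : is_contraction (mkfun TA : {fun A >-> A}).
  exists q; split; first by rewrite /= invf_lt1 // ltr1n.
  by move=> [y z] [/= Ay Az]; apply: Tc.
have Acl : closed A by exact: closed_ball_closed.
have An0 : A !=set0 by exists x0.
have [y Ay yT] := banach_fixed_point ctr Acl An0.
exists y; first exact: Ac.
have : (F y - w) *m B = 0.
  by apply/eqP; rewrite -oppr_eq0; apply/eqP; move/(congr1 (fun v => v - y)): yT;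
    rewrite subrr /mkfun /T addrAC subrr add0r.
move/(congr1 (fun v => v *m J)); rewrite mul0mx mulmxKV // => /eqP.
by rewrite subr_eq0 => /eqP.
Qed.

Lemma unitmx_inj (J : 'M[R]_n) : (forall v : 'rV[R]_n, v *m J = 0 -> v = 0) ->
  J \in unitmx.
Proof.
move=> inj; rewrite -row_free_unit -kermx_eq0; apply/eqP/row_matrixP => i.
by rewrite row0; apply: inj; rewrite -row_mul mulmx_ker row0.
Qed.

(** A vector killed by the Jacobian would be a direction in which [F] moves by a
    negligible amount only, against the Lipschitz bound of its inverse. *)
Lemma lipschitz_Jacobian_unit U F x (L : R) : open U ->
  (forall k, Ck 1 U (fun x => F x 0 k)) -> U x -> 0 < L ->
  (forall z, U z -> `|z - x| <= L * `|F z - F x|) -> Jacobian F x \in unitmx.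
Proof.
move=> oU CF Ux L0 FL; set J := Jacobian F x.
have e0 : 0 < (2 * L)^-1 by rewrite invr_gt0 mulr_gt0.
have [d [d0 dU dd]] := C1_map_strictly_differentiable oU CF Ux e0.
apply: unitmx_inj => v vJ; apply/eqP; rewrite -normr_le0 leNgt; apply/negP => v0.
pose s := d / (2 * `|v|).
have s0 : 0 < s by rewrite divr_gt0 // mulr_gt0.
have sv : `|s *: v| < d.
  rewrite normrZ gtr0_norm // [X in X < _](_ : _ = d / 2); first by lra.
  by rewrite /s; field; rewrite gt_eqF.
have xc : cube x d (x + s *: v) by apply/cubeP => //; rewrite addrC addKr.
have := dd x _ (cube_center _ d0) xc; have := FL _ (dU _ xc).
rewrite [x + _]addrC addrK -scalemxAl vJ scaler0 subr0.
set a := `|F _ - _|; set b := `|s *: v|.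
have b0 : 0 < b by rewrite /b normrZ mulr_gt0 // normr_gt0 gt_eqF.
move=> h1 h2; have : b <= L * ((2 * L)^-1 * b).
  by apply: le_trans h1 _; rewrite ler_pM2l.
rewrite [X in _ <= X](_ : _ = b / 2); first by lra.
by field; rewrite gt_eqF.
Qed.

(** This replaces differentiability of the inverse of [F]: leaves are preimages
    of segments, and only such curves have to be differentiated. *)
Lemma inverse_curve_derive U F (g : R -> 'rV[R]_n) t w v (L : R) : open U ->
  (forall k, Ck 1 U (fun x => F x 0 k)) -> 0 < L ->
  (forall y z, U y -> U z -> `|z - y| <= L * `|F z - F y|) ->
  (\forall s \near t, U (g s) /\ F (g s) = s *: v + w) ->
  is_derive t 1 g (v *m invmx (Jacobian F (g t))).
Proof.
move=> oU CF L0 FL ng; have [Ut Ft] := nbhs_singleton ng.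
have Ju := lipschitz_Jacobian_unit oU CF Ut L0 (fun z => FL _ z Ut).
set J := Jacobian F (g t) in Ju *; set u := v *m invmx J.
have lin : linear (fun h : R => h *: u) by move=> a b c; rewrite scalerDl scalerA.
pose l := GRing.isLinear.Build _ _ _ _ (fun h : R => h *: u) lin.
pose G : {linear R -> 'rV[R]_n} := HB.pack (fun h : R => h *: u) l.
have Gc : continuous G by move=> h; apply: scalel_continuous.
have [m m0 mB] := mulmx_bounded (invmx J).
pose c := L * (`|v| + 1).
have c0 : 0 < c by rewrite mulr_gt0 // ltr_wpDl.
have near0 : \forall h \near (0 : R), U (g (h + t)) /\ F (g (h + t)) = (h + t) *: v + w.
  by move: ng; rewrite (near_shift 0 t) /=; apply: filterS => h /=; rewrite subr0.
have lip (h : R) : U (g (h + t)) -> F (g (h + t)) = (h + t) *: v + w ->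
    `|g (h + t) - g t| <= c * `|h|.
  move=> Uh Fh; apply: le_trans (FL _ _ Ut Uh) _; rewrite Fh Ft.
  rewrite [X in `|X|](_ : _ = h *: v); last first.
    by rewrite scalerDl -[_ + _ + w]addrA addrK.
  by rewrite normrZ /c -mulrA ler_pM2l // [_ * `|h|]mulrC ler_wpM2l // lerDl.
have [|dg dgE] := differentiable_linear_approx (f := g) (x := t) Gc.
  move=> e e0; have e'0 : 0 < e / (m * c) by rewrite divr_gt0 // mulr_gt0.
  have [d [d0 dU dd]] := C1_map_strictly_differentiable oU CF Ut e'0.
  have small : \forall h \near (0 : R), `|h| < d / c.
    by apply: nbhs0_lt; rewrite divr_gt0.
  near=> h.
  have [Uh Fh] : U (g (h + t)) /\ F (g (h + t)) = (h + t) *: v + w by near: h.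
  have hd : `|h| < d / c by near: h.
  have lh := lip h Uh Fh.
  have gc : cube (g t) d (g (h + t)).
    by apply/cubeP => //; apply: le_lt_trans lh _; rewrite mulrC -ltr_pdivlMr.
  have := dd _ _ (cube_center _ d0) gc.
  rewrite Fh Ft.
  rewrite [X in X - _ *m _](_ : _ = h *: v); last first.
    by rewrite scalerDl -[_ + _ + w]addrA addrK.
  rewrite -/J => dh.
  have -> : g (h + t) - g t - G h = - ((h *: v - (g (h + t) - g t) *m J) *m invmx J).
    by rewrite mulmxBl (mulmxK Ju) opprB -scalemxAl.
  rewrite normrN; apply: le_trans (mB _) _.
  apply: le_trans (_ : m * (e / (m * c) * (c * `|h|)) <= _).
    rewrite ler_pM2l //; apply: le_trans dh _.
    by rewrite ler_pM2l.
  rewrite [X in X <= _](_ : _ = e * `|h|) //.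
  by field; rewrite !gt_eqF.
apply: DeriveDef; first by apply/derivable1_diffP.
by rewrite deriveE // dgE /G /= scale1r.
Unshelve. all: by end_near. Qed.

End LocalInversion.

(** * The Poincare lemma for one-forms *)

Section Poincare.
Context {R : realType}.
Notation mu := (@lebesgue_measure R).

Lemma Rintegral_derivative (F f : R -> R) :
  (forall t : R, 0 <= t <= 1 -> is_derive t 1 F (f t)) ->
  {within `[0, 1], continuous f} ->
  \int[mu]_(t in `[0, 1]) f t = F 1 - F 0.
Proof.
move=> DF cf.
have Fc (t : R) : 0 <= t <= 1 -> {for t, continuous F}.
  move=> t01; apply: differentiable_continuous; apply/derivable1_diffP.
  by have := DF t t01.
rewrite /Rintegral (@continuous_FTC2 R f F) //.
- split.
  + move=> t; rewrite in_itv /= => /andP[t0 t1].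
    by have [] : is_derive t 1 F (f t) by apply: DF; rewrite !ltW.
  + by apply: cvg_at_right_filter; apply: Fc; rewrite lexx ler01.
  + by apply: cvg_at_left_filter; apply: Fc; rewrite lexx ler01.
- move=> t; rewrite in_itv /= => /andP[t0 t1].
  have D : is_derive t 1 F (f t) by apply: DF; rewrite !ltW.
  by rewrite derive1E derive_val.
Qed.

Lemma is_derive_Rintegral (f df : R -> R -> R) (M e : R) : 0 < e ->
  (forall s : R, `|s| < e -> {within `[0, 1], continuous (f s)}) ->
  (forall s t : R, `|s| < e -> 0 <= t <= 1 -> is_derive s 1 (f ^~ t) (df s t)) ->
  (forall s t : R, `|s| < e -> 0 <= t <= 1 -> `|df s t| <= M) ->
  is_derive (0 : R) 1 (fun s => \int[mu]_(t in `[0, 1]) f s t)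
    (\int[mu]_(t in `[0, 1]) df 0 t).
Proof.
move=> e0 fc Df dfM.
have M0 : 0 <= M.
  apply: le_trans (normr_ge0 (df 0 0)) _.
  by apply: dfM; rewrite ?normr0 ?lexx ?ler01.
have I0 : `] - e, e[%classic (0 : R) by rewrite /= in_itv /= oppr_lt0 e0.
have Is (s : R) : `] - e, e[%classic s -> `|s| < e by rewrite /= in_itv /= ltr_norml.
have Bt (t : R) : `[0, 1]%classic t -> 0 <= t <= 1 by rewrite /= in_itv.
have d1 (s t : R) : `|s| < e -> 0 <= t <= 1 -> partial1of2 f s t = df s t.
  by move=> sl tl; rewrite partial1of2E; have D := Df s t sl tl; rewrite derive_val.
have intf s : `] - e, e[%classic s -> mu.-integrable `[0, 1] (EFin \o f s).
  move=> /Is sl; apply: continuous_compact_integrable; first exact: segment_compact.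
  exact: fc.
have derf (s t : R) : `] - e, e[%classic s -> `[0, 1]%classic t -> derivable (f^~ t) s 1.
  by move=> /Is sl /Bt tl; have [] := Df s t sl tl.
have intG : mu.-integrable `[0, 1] (EFin \o (fun=> M)).
  apply: continuous_compact_integrable; first exact: segment_compact.
  by apply: continuous_subspaceT => x; exact: cst_continuous.
have ub (s t : R) : `] - e, e[%classic s -> `[0, 1]%classic t -> `|partial1of2 f s t| <= M.
  by move=> /Is sl /Bt tl; rewrite d1 // dfM.
have D1 := @derivable_under_integral R _ (measurableTypeR R) mu f `[0, 1]%classic
  (measurable_itv _) _ _ _ I0 intf derf (fun=> M) (fun=> M0) intG ub.
have D2 := @differentiation_under_integral R _ (measurableTypeR R) mu f `[0, 1]%classic
  (measurable_itv _) _ _ _ I0 intf derf (fun=> M) (fun=> M0) intG ub.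
apply: DeriveDef; first exact: D1.
rewrite -derive1E D2; apply: eq_Rintegral => t; rewrite inE => /Bt tl.
by rewrite d1 // normr0.
Qed.

Lemma is_derive_sum_fun (V : normedModType R) n (f : 'I_n -> V -> R) x v
    (d : 'I_n -> R) : (forall i, is_derive x v (f i) (d i)) ->
  is_derive x v (fun y => \sum_i f i y) (\sum_i d i).
Proof.
move=> Df; have := is_derive_sum Df.
suff -> : (fun y => \sum_i f i y) = \sum_i f i by [].
by apply/funext => y; rewrite fct_sumE.
Qed.

Lemma continuous_sum_fun (T : topologicalType) n (f : 'I_n -> T -> R) x :
  (forall i, {for x, continuous (f i)}) -> {for x, continuous (fun y => \sum_i f i y)}.
Proof.
elim: n f => [|n IH] f cf.
  rewrite (_ : (fun y => _) = cst 0); first exact: cst_continuous.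
  by apply/funext => y; rewrite big_ord0.
rewrite (_ : (fun y => _) = (fun y => f ord0 y + \sum_i f (lift ord0 i) y)).
  by apply: continuousD => //; apply: IH.
by apply/funext => y; rewrite big_ord_recl.
Qed.

Context {n : nat}.

Lemma C1_is_derive U (f : 'rV[R]_n -> R) x v : open U -> Ck 1 U f -> U x ->
  is_derive x v f (\sum_i v 0 i * partial i f x).
Proof.
move=> oU Cf Ux; have [df dfE] := C1_differentiable oU Cf Ux.
apply: DeriveDef; first exact: diff_derivable.
by rewrite deriveE // dfE.
Qed.

(** The primitive is the integral of the form along the segment from [x0].
    Differentiating under the integral sign and using that the form is closed
    turns the integrand into the derivative of [t |-> t b_j(x0 + t (x - x0))]. *)
Lemma poincare (x0 : 'rV[R]_n) U (b : 'I_n -> 'rV[R]_n -> R) : open U -> U x0 ->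
  (forall i, Ck 1 U (b i)) ->
  (forall x i j, U x -> partial i (b j) x = partial j (b i) x) ->
  exists f, exists2 d : R, 0 < d & cube x0 d `<=` U /\
    forall x i, cube x0 d x -> is_derive x (delta_mx 0 i : 'rV[R]_n) f (b i x).
Proof.
move=> oU Ux0 Cb closed_b.
(* a common bound near x0, for the domination of the integrands *)
pose M : R := \sum_i (`|b i x0| + \sum_j `|partial j (b i) x0|) + 1.
have [d d0 dU] : exists2 d : R, 0 < d & cube x0 d `<=`
    [set x | U x /\ forall i, `|b i x| <= M /\ forall j, `|partial j (b i) x| <= M].
  apply/nbhs_cubeP; near=> x; split.
    by near: x; apply: open_nbhs_nbhs.
  near: x; apply: filter_forall => i.
  have bM : `|b i x0| + \sum_j `|partial j (b i) x0| + 1 <= M.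
    rewrite lerD2r [leRHS](bigD1 i) //= lerDl; apply: sumr_ge0 => k _.
    by rewrite addr_ge0 // sumr_ge0.
  have near1 (g : 'rV[R]_n -> R) : Ck 0 U g -> `|g x0| + 1 <= M ->
      \forall x \near x0, `|g x| <= M.
    move=> Cg gM; have /cvgrPdist_le/(_ _ ltr01) := Ck_continuous Cg Ux0.
    apply: filterS => x gx; apply: le_trans gM.
    by rewrite -[X in `|X| <= _](subrK (g x0)) addrC (le_trans (ler_normD _ _)) // lerD2l distrC.
  have H1 : \forall x \near x0, `|b i x| <= M.
    apply: near1; first exact: CkW.
    by apply: le_trans bM; rewrite lerD2r lerDl sumr_ge0.
  have H2 : \forall x \near nbhs x0, forall j, `|partial j (b i) x| <= M.
    apply: filter_forall => j; apply: near1; first exact: Ck_partial.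
    apply: le_trans bM; rewrite lerD2r; apply: le_trans (_ : \sum_j `|partial j (b i) x0| <= _).
      by rewrite [leRHS](bigD1 j) //= lerDl sumr_ge0.
    by rewrite lerDr.
  exact: filterI H1 H2.
have M0 : 0 <= M.
  by rewrite addr_ge0 // sumr_ge0 // => i _; rewrite addr_ge0 // sumr_ge0.
pose h (y : 'rV[R]_n) (t : R) := \sum_i b i (t *: y + x0) * y 0 i.
exists (fun x => \int[mu]_(t in `[0, 1]) h (x - x0) t), d => //.
split=> [x /dU[]//|x j xc].
pose y : 'rV[R]_n := x - x0; pose ys (s : R) : 'rV[R]_n := s *: delta_mx 0 j + y.
have [e e0 ec] := open_cube_sub (open_cube d0) xc.
have inc (s t : R) : `|s| < e -> 0 <= t <= 1 -> cube x0 d (t *: ys s + x0).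
  move=> se /andP[t0 t1] i; have : cube x0 d (s *: delta_mx 0 j + x).
    apply: ec => k; rewrite !mxE eqxx addrK /=.
    by case: (k == j); rewrite ?mulr1 ?mulr0 ?normr0.
  move/(_ i); rewrite /ys !mxE addrK eqxx /= => H.
  rewrite normrM ger0_norm // addrA; apply: le_lt_trans H.
  by rewrite ler_piMl.
have deltaE (i : 'I_n) : (delta_mx 0 j : 'rV[R]_n) 0 i = (i == j)%:R.
  by rewrite mxE eqxx.
have Db_t i (s t : R) : `|s| < e -> 0 <= t <= 1 ->
    is_derive t 1 (fun t => b i (t *: ys s + x0))
      (\sum_k ys s 0 k * partial k (b i) (t *: ys s + x0)).
  move=> se t01; apply: is_derive_along; apply: C1_is_derive (Cb i) _ => //.
  by have [] := dU _ (inc s t se t01).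
have Db_s i (s t : R) : `|s| < e -> 0 <= t <= 1 ->
    is_derive s 1 (fun s => b i (t *: ys s + x0))
      (t * partial j (b i) (t *: ys s + x0)).
  move=> se t01; have [Up _] := dU _ (inc s t se t01).
  have E r : t *: ys r + x0 = r *: (t *: delta_mx 0 j) + (t *: y + x0).
    by rewrite /ys scalerDr !scalerA [t * r]mulrC addrA.
  have -> : (fun s => b i (t *: ys s + x0)) =
      (fun s => b i (s *: (t *: delta_mx 0 j) + (t *: y + x0))).
    by apply/funext => r; rewrite E.
  rewrite E in Up *; apply: is_derive_along.
  have D := C1_is_derive (t *: delta_mx 0 j) oU (Cb i) Up.
  apply: is_derive_eq D _; rewrite (bigD1 j) //= big1 => [|k kj].
    by rewrite mxE deltaE eqxx mulr1 addr0.
  by rewrite mxE deltaE (negbTE kj) mulr0 mul0r.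
apply/is_derive_line.
have -> : (fun s => \int[mu]_(t in `[0, 1]) h (s *: delta_mx 0 j + x - x0) t) =
    (fun s => \int[mu]_(t in `[0, 1]) h (ys s) t).
  by apply/funext => s; rewrite /ys addrA.
pose dh (s t : R) := \sum_i (b i (t *: ys s + x0) * (i == j)%:R +
   ys s 0 i * (t * partial j (b i) (t *: ys s + x0))).
have se0 : `|0 : R| < e by rewrite normr0.
have ys0 : ys 0 = y by rewrite /ys scale0r add0r.
have Dcoord i (s : R) : is_derive s 1 (fun s => ys s 0 i) (i == j)%:R.
  have := is_derive_coord i (s *: delta_mx 0 j + y) (delta_mx 0 j).
  by rewrite deltaE => /is_derive_along.
apply: is_derive_eq (@is_derive_Rintegral (fun s => h (ys s)) dh
  (\sum_i (M + (`|y 0 i| + e) * M)) e e0 _ _ _) _.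
- move=> s se; apply: derivable_within_continuous => t; rewrite in_itv /= => t01.
  suff [] : is_derive t 1 (h (ys s))
    (\sum_i (ys s 0 i * \sum_k ys s 0 k * partial k (b i) (t *: ys s + x0))) by [].
  apply: is_derive_sum_fun => i; have D := Db_t i s t se t01.
  apply: is_derive_eq (is_deriveM D (is_derive_cst (ys s 0 i) t 1)) _.
  by rewrite scaler0 add0r.
- move=> s t se t01; apply: is_derive_sum_fun => i.
  exact: is_deriveM (Db_s i s t se t01) (Dcoord i s).
- move=> s t se t01; have [_ bM] := dU _ (inc s t se t01).
  apply: le_trans (ler_norm_sum _ _ _) _; apply: ler_sum => i _.
  have [biM dbM] := bM i; have /andP[t0 t1] := t01.
  apply: le_trans (ler_normD _ _) _; apply: lerD.
    rewrite normrM; apply: le_trans biM; rewrite ler_piMr //.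
    by case: (i == j); rewrite ?normr1 ?normr0.
  rewrite normrM; apply: ler_pM => //.
    rewrite /ys !mxE eqxx /= addrC; apply: le_trans (ler_normD _ _) _.
    rewrite lerD2l normrM; apply: le_trans (ltW se); rewrite ler_piMr //.
    by case: (i == j); rewrite ?normr1 ?normr0.
  rewrite normrM ger0_norm //; apply: le_trans (dbM j).
  by rewrite ler_piMl.
have DF (t : R) : 0 <= t <= 1 ->
    is_derive t 1 (fun t : R => t * b j (t *: ys 0 + x0)) (dh 0 t).
  move=> t01; have [Up _] := dU _ (inc 0 t se0 t01).
  apply: is_derive_eq (is_deriveM (is_derive_id t 1) (Db_t j 0 t se0 t01)) _.
  rewrite /dh [_ *: 1]mulr1 addrC big_split /=; congr (_ + _).
    rewrite (bigD1 j) //= eqxx mulr1 big1 ?addr0 // => k kj.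
    by rewrite (negbTE kj) mulr0.
  rewrite scaler_sumr; apply: eq_bigr => k _.
  by rewrite [_ *: _]mulrCA closed_b.
have cdh : {within `[0, 1], continuous (dh 0)}.
  apply: continuous_in_subspaceT => t; rewrite inE /= in_itv /= => t01.
  have [Up _] := dU _ (inc 0 t se0 t01).
  have ct : {for t, continuous (fun t : R => t *: ys 0 + x0 : 'rV[R]_n)}.
    by apply: continuousD; [exact: scalel_continuous|exact: cst_continuous].
  apply: continuous_sum_fun => i; apply: continuousD.
    apply: continuousM; last exact: cst_continuous.
    by apply: continuous_comp => //; apply: Ck_continuous (Cb i) Up.
  apply: continuousM; first exact: cst_continuous.
  apply: continuousM => //.
  by apply: continuous_comp => //; apply: Ck_continuous (Ck_partial j (Cb i)) Up.
by rewrite (Rintegral_derivative DF cdh) mul1r scale1r mul0r subr0 ys0 subrK.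
Unshelve. all: by end_near. Qed.

End Poincare.

(** * Rules for smooth functions *)

Section SmoothOn.
Context {R : realType} {n : nat}.
Implicit Types (U V : set 'rV[R]_n) (f g : 'rV[R]_n -> R).

Lemma smooth_on_Ck k U f : smooth_on U f -> Ck k U f.
Proof. by move/smooth_onP; exact. Qed.

Lemma smooth_eq U f g : open U -> (forall x, U x -> f x = g x) ->
  smooth_on U f -> smooth_on U g.
Proof.
by move=> oU fg /smooth_onP sf; apply/smooth_onP => k; apply: Ck_eq (sf k).
Qed.

Lemma smooth_subset U V f : V `<=` U -> smooth_on U f -> smooth_on V f.
Proof. by move=> VU sf s x /VU; exact: sf. Qed.

Lemma smooth_cst U (a : R) : open U -> smooth_on U (fun=> a).
Proof. by move=> oU; apply/smooth_onP => k; exact: Ck_cst. Qed.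

Lemma smooth_coord U i : open U -> smooth_on U (fun x => x 0 i).
Proof. by move=> oU; apply/smooth_onP => k; exact: Ck_coord. Qed.

Lemma smooth_add U f g : open U -> smooth_on U f -> smooth_on U g ->
  smooth_on U (fun x => f x + g x).
Proof.
move=> oU /smooth_onP sf /smooth_onP sg; apply/smooth_onP => k.
exact: Ck_add.
Qed.

Lemma smooth_mul U f g : open U -> smooth_on U f -> smooth_on U g ->
  smooth_on U (fun x => f x * g x).
Proof.
move=> oU /smooth_onP sf /smooth_onP sg; apply/smooth_onP => k.
exact: Ck_mul.
Qed.

Lemma smooth_opp U f : open U -> smooth_on U f -> smooth_on U (fun x => - f x).
Proof.
move=> oU sf; apply: (smooth_eq oU (fun x _ => mulN1r (f x))).
exact: smooth_mul oU (smooth_cst (-1) oU) sf.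
Qed.

Lemma smooth_sub U f g : open U -> smooth_on U f -> smooth_on U g ->
  smooth_on U (fun x => f x - g x).
Proof. move=> oU sf sg; exact: smooth_add oU sf (smooth_opp oU sg). Qed.

Lemma smooth_expn U f m : open U -> smooth_on U f -> smooth_on U (fun x => f x ^+ m).
Proof.
move=> oU sf; elim: m => [|m IH].
  exact: smooth_cst.
apply: (smooth_eq oU (fun x _ => esym (exprS (f x) m))).
exact: smooth_mul.
Qed.

Lemma smooth_inv U f : open U -> (forall x, U x -> f x != 0) -> smooth_on U f ->
  smooth_on U (fun x => (f x)^-1).
Proof.
by move=> oU f0 /smooth_onP sf; apply/smooth_onP => k; exact: Ck_inv.
Qed.

Lemma smooth_sqrt U f : open U -> (forall x, U x -> 0 < f x) -> smooth_on U f ->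
  smooth_on U (fun x => Num.sqrt (f x)).
Proof.
by move=> oU f0 /smooth_onP sf; apply/smooth_onP => k; exact: Ck_sqrt.
Qed.

Lemma smooth_comp1 U (V : set R) f h : open U -> smooth1 V h ->
  (forall x, U x -> V (f x)) -> smooth_on U f -> smooth_on U (fun x => h (f x)).
Proof.
move=> oU sh UV /smooth_onP sf; apply/smooth_onP => k.
exact: Ck_comp1 sh UV (sf k).
Qed.

Lemma smooth_sum U (I : finType) (f : I -> 'rV[R]_n -> R) : open U ->
  (forall i, smooth_on U (f i)) -> smooth_on U (fun x => \sum_i f i x).
Proof.
move=> oU sf; apply/smooth_onP => k; apply: Ck_sum => // i.
exact: smooth_on_Ck.
Qed.

Lemma smooth_prod U (I : finType) (f : I -> 'rV[R]_n -> R) : open U ->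
  (forall i, smooth_on U (f i)) -> smooth_on U (fun x => \prod_i f i x).
Proof.
move=> oU sf; apply/smooth_onP => k; apply: Ck_prod => // i.
exact: smooth_on_Ck.
Qed.

Lemma smooth_on_continuous U f x : smooth_on U f -> U x -> {for x, continuous f}.
Proof. by move=> sf; apply: Ck_continuous (smooth_on_Ck 0 sf). Qed.

Lemma smooth_on_is_derive U f x i : smooth_on U f -> U x ->
  is_derive x (delta_mx 0 i : 'rV[R]_n) f (partial i f x).
Proof. by move=> sf; apply: Ck_is_derive (smooth_on_Ck 1 sf). Qed.

End SmoothOn.

(** * Smooth functions of one variable *)

Section SmoothOneVariable.
Context {R : realType}.
Implicit Types (V : set R) (f h : R -> R).

(** Iterated derivatives are handled all at once by a family of functions that
    is stable under derivation. *)
Lemma smooth1_family V (P : (R -> R) -> Prop) :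
  (forall h, P h -> (forall x, V x -> derivable h x 1) /\ P (derive1 h)) ->
  forall h, P h -> smooth1 V h.
Proof.
move=> HP h Ph x Vx k; elim: k h Ph => [|k IH] h Ph.
  by have [dh _] := HP h Ph; exact: dh.
by rewrite derive1Sn; apply: IH; have [] := HP h Ph.
Qed.

Lemma derive1_fun f (df : R -> R) : (forall x : R, is_derive x 1 f (df x)) -> derive1 f = df.
Proof. by move=> Df; apply/funext => x; rewrite derive1E derive_val. Qed.

Lemma smooth1_expR : smooth1 setT (@expR R).
Proof.
apply: (smooth1_family (P := fun h => h = @expR R)) => // h ->.
by split=> [x _|]; [exact: derivable_expR|exact: derive1_fun].
Qed.

Lemma smooth1_trigo : smooth1 setT (@cos R) /\ smooth1 setT (@sin R).
Proof.
pose P (h : R -> R) := exists a b : R, h = (fun x => a * cos x + b * sin x).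
have H h : P h -> smooth1 setT h.
  move: h; apply: smooth1_family => h [a [b ->]].
  have D (x : R) : is_derive x 1 (fun x : R => a * cos x + b * sin x) (b * cos x + (- a) * sin x).
    have Dc := is_deriveM (is_derive_cst a x 1) (is_derive_cos x).
    have Ds := is_deriveM (is_derive_cst b x 1) (is_derive_sin x).
    apply: is_derive_eq (is_deriveD Dc Ds) _.
    by rewrite !scaler0 !addr0 addrC mulNr -mulrN.
  split=> [x _|]; first by have [] := D x.
  by exists b, (- a); exact: derive1_fun.
split; apply: H.
  by exists 1, 0; apply/funext => x; rewrite mul1r mul0r addr0.
by exists 0, 1; apply/funext => x; rewrite mul1r mul0r add0r.
Qed.

(** Smoothness of the profile functions then follows from the rules for
    functions of several variables. *)
Lemma smooth1_of_row V f :
  smooth_on [set x : 'rV[R]_1 | V (x 0 0)] (fun x => f (x 0 0)) -> smooth1 V f.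
Proof.
move=> sf x Vx k; elim: k f sf => [|k IH] f sf.
  have Wx : [set x : 'rV[R]_1 | V (x 0 0)] (x *: delta_mx 0 0 + 0).
    by rewrite /= !mxE eqxx mulr1 addr0.
  have := is_derive_along (smooth_on_is_derive 0 sf Wx).
  rewrite (_ : (fun u : R => f _) = f); first by case.
  by apply/funext => u; rewrite !mxE eqxx mulr1 addr0.
rewrite derive1Sn; apply: IH.
rewrite (_ : (fun x : 'rV[R]_1 => _) = partial 0 (fun x : 'rV[R]_1 => f (x 0 0))).
  exact: smooth_partial.
apply/funext => y; rewrite /partial derive1E -derive_line -[RHS]derive_line.
set g := (X in derive X _ _); set g' := (X in _ = derive X _ _).
suff -> : g = g' by [].
by apply/funext => t; rewrite /g /g' !mxE eqxx.
Qed.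

End SmoothOneVariable.

(** * The entire function (e^u - 1) / u *)

Section ExpQuotient.
Context {R : realType}.

(** The derivatives of [(e^u - 1) / u] are the functions [expqn k], given by the
    power series [\sum_n u^n / (n! (n + k + 1))], or equivalently by the
    integrals of [t^k e^(t u)] over [0 <= t <= 1].  The power series makes them
    smooth at [u = 0], which is where the curvature is maximal. *)
Definition expq_coeff (k n : nat) : R := (n`!%:R * (n + k.+1)%:R)^-1.

Definition expqn (k : nat) (u : R) : R := limn (pseries (expq_coeff k) u).

Definition expq : R -> R := expqn 0.

Lemma expq_coeff_diffs k : pseries_diffs (expq_coeff k) = expq_coeff k.+1.
Proof.
apply/funext => n; rewrite /pseries_diffs /expq_coeff factS natrM addSnnS.
by rewrite -mulrA invfM mulrA divff ?mul1r // pnatr_eq0.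
Qed.

Lemma is_cvg_expq k (u : R) : cvgn (pseries (expq_coeff k) u).
Proof.
apply: normed_cvg.
have := is_cvg_series_exp_coeff `|u|.
apply: series_le_cvg => n.
- exact: normr_ge0.
- by rewrite /exp_coeff /= divr_ge0 // exprn_ge0.
rewrite /exp_coeff /= normrM normrX mulrC ler_wpM2l ?exprn_ge0 //.
rewrite /expq_coeff ger0_norm ?invr_ge0 ?mulr_ge0 //.
by rewrite lef_pV2 ?posrE ?mulr_gt0 ?ltr0n ?fact_gt0 ?addnS // ler_peMr // ler1n.
Qed.

Lemma is_derive_expqn k (u : R) : is_derive u 1 (expqn k) (expqn k.+1 u).
Proof.
have := @pseries_snd_diffs R (expq_coeff k) (`|u| + 1) u.
rewrite !expq_coeff_diffs; apply; try exact: is_cvg_expq.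
by rewrite [ltRHS]ger0_norm ?addr_ge0 // ltrDl.
Qed.

Lemma smooth1_expq : smooth1 setT expq.
Proof.
apply: (smooth1_family (P := fun h => exists k, h = expqn k)); last by exists 0%N.
move=> _ [k ->]; split=> [x _|]; first by have [] := is_derive_expqn k x.
by exists k.+1; apply: derive1_fun => x; exact: is_derive_expqn.
Qed.

Lemma expqE (u : R) : u * expq u = expR u - 1.
Proof.
have c1 : series (exp_coeff u) n.+1 @[n --> \oo] --> expR u.
  by rewrite (cvg_shiftS (series (exp_coeff u))); exact: is_cvg_series_exp_coeff.
have c2 : 1 + u * pseries (expq_coeff 0) u n @[n --> \oo] --> 1 + u * expq u.
  apply: cvgD; first exact: cvg_cst.
  by apply: cvgM; [exact: cvg_cst|exact: is_cvg_expq].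
have E : (fun n => series (exp_coeff u) n.+1) =
    (fun n => 1 + u * pseries (expq_coeff 0) u n).
  apply/funext => n; rewrite /series /= big_nat_recl //.
  rewrite {1}/exp_coeff /= expr0 fact0 divr1 mulr_sumr; congr (_ + _).
  apply: eq_bigr => i _; rewrite /exp_coeff /expq_coeff /= factS addn1 natrM exprS.
  by rewrite -mulrA [_^-1 * _]mulrC [_%:R * _]mulrC.
rewrite E in c1; rewrite (cvg_unique _ c1 c2) //.
by rewrite addrAC subrr add0r.
Qed.

Lemma expqn1E (u : R) : expq u + u * expqn 1 u = expR u.
Proof.
have D1 := is_deriveM (is_derive_id u 1) (is_derive_expqn 0 u).
have D2 := is_deriveB (is_derive_expR u) (is_derive_cst (1 : R) u 1).
have E : (id * expqn 0 : R -> R) = @expR R - cst 1.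
  by apply/funext => v; rewrite !fctE -expqE.
rewrite E in D1; have := @derive_val _ _ _ _ _ _ _ D1.
rewrite (@derive_val _ _ _ _ _ _ _ D2) subr0 => ->.
by rewrite addrC [_ *: 1]mulr1.
Qed.

Lemma expq0 : expq 0 = 1.
Proof. by have := expqn1E 0; rewrite mul0r addr0 expR0. Qed.

Lemma expq_gt0 (u : R) : 0 < u -> 0 < expq u.
Proof.
by move=> u0; rewrite -(pmulr_rgt0 _ u0) expqE subr_gt0 expR_gt1.
Qed.

(** Slopes of chords of the exponential from [0] increase, by convexity. *)
Lemma expq_le (v u : R) : 0 < v -> v <= u -> expq v <= expq u.
Proof.
move=> v0 vu; have u0 : 0 < u by exact: lt_le_trans vu.
have l0 : 0 <= v / u by rewrite divr_ge0 // ltW.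
have l1 : v / u <= 1 by rewrite ler_pdivrMr // mul1r.
have := convex_expR (Itv01 l0 l1) u 0.
rewrite !convRE /= mulr0 addr0 expR0 mulr1 divfK ?gt_eqF // => H.
rewrite -(ler_pM2l v0) expqE.
have -> : v * expq u = v / u * (u * expq u) by field; rewrite gt_eqF.
by rewrite expqE; move: H; rewrite /unstable.onem; lra.
Qed.

End ExpQuotient.

(** * The profile functions *)

Section ProfileFunctions.
Context {R : realType}.
Variable K0 : R.

(** The quotient of [K1^2 + K2^2] by [u = K0 - K], see [den_mul] and
    [slope_den]. *)
Definition den (u : R) : R := (2 * K0 - 3) * expq (2 * u) + 1.

(** The coefficient [m] that makes [a3 + m(u) (K1 a2 - K2 a1)] closed.  That
    condition is the linear equation of [form_coeff_ode], with a singular point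
    at [u = 0]; this is its regular solution there,
    [m = ((K0 - 1) (e^u - 1) + u) / (u den u)]. *)
Definition form_coeff (u : R) : R := ((K0 - 1) * expq u + 1) / den u.

(** The factor by which a vector of squared length [u den u] is rescaled to have
    squared length [4 u], the square of the radius. *)
Definition scale (u : R) : R := 2 / Num.sqrt (den u).

(** The radii at which [Phi] is positive, see [PhiE]. *)
Definition radii : set R := [set x | 0 < x /\ 0 < den (x ^+ 2 / 4)].

Lemma den_mul (u : R) : u * den u = (K0 - 3 / 2) * (expR (2 * u) - 1) + u.
Proof. by rewrite -expqE /den; field. Qed.

(** For [K0 < 3/2] the function [den] decreases on the positive axis, and for
    [K0 >= 3/2] it is positive there; in both cases the radii form an
    interval. *)
Lemma den_decr (u v : R) : 0 < v -> v <= u -> 0 < den u -> 0 < den v.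
Proof.
move=> v0 vu; rewrite /den => du.
have v20 : 0 < 2 * v by rewrite mulr_gt0.
have [K3|K3] := leP 0 (2 * K0 - 3).
  by rewrite ltr_wpDl // mulr_ge0 // ltW // expq_gt0.
have := expq_le v20 (_ : 2 * v <= 2 * u); rewrite ler_pM2l // => /(_ vu).
by nra.
Qed.

Lemma PhiE (r : R) : Phi K0 r =
  Num.sqrt (expR (- (r ^+ 2 / 2)) * (r ^+ 2 / 4 * den (r ^+ 2 / 4))).
Proof.
rewrite /Phi den_mul; congr (Num.sqrt _).
have -> : 2 * (r ^+ 2 / 4) = r ^+ 2 / 2 by field.
have := expRxMexpNx_1 (r ^+ 2 / 2); set a := expR _; set b := expR _ => ab.
transitivity ((K0 - 3 / 2) * (a * b) - (K0 - 3 / 2 - r ^+ 2 / 4) * b).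
  by rewrite ab mulr1.
by field.
Qed.

Lemma is_interval_radii : is_interval radii.
Proof.
move=> x y [x0 dx] [y0 dy] z /andP[xz zy].
have z0 : 0 < z by exact: lt_le_trans xz.
split=> //; apply: den_decr dy; first by rewrite divr_gt0 // exprn_gt0.
by rewrite ler_pM2r ?invr_gt0 // lerXn2r // nnegrE ltW.
Qed.

Lemma smooth_den n (U : set 'rV[R]_n) f : open U -> smooth_on U f ->
  smooth_on U (fun x => den (f x)).
Proof.
move=> oU sf; apply: (smooth_add oU _ (smooth_cst 1 oU)).
apply: (smooth_mul oU (smooth_cst _ oU)).
exact: (smooth_comp1 oU smooth1_expq (fun _ _ => I)
  (smooth_mul oU (smooth_cst 2 oU) sf)).
Qed.

Lemma smooth_form_coeff n (U : set 'rV[R]_n) f : open U ->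
  (forall x, U x -> 0 < den (f x)) -> smooth_on U f ->
  smooth_on U (fun x => form_coeff (f x)).
Proof.
move=> oU d0 sf; apply: (smooth_mul oU).
  apply: (smooth_add oU _ (smooth_cst 1 oU)).
  exact: (smooth_mul oU (smooth_cst _ oU) (smooth_comp1 oU smooth1_expq (fun _ _ => I) sf)).
by apply: (smooth_inv oU _ (smooth_den oU sf)) => x Ux; rewrite gt_eqF // d0.
Qed.

Lemma smooth_scale n (U : set 'rV[R]_n) f : open U ->
  (forall x, U x -> 0 < den (f x)) -> smooth_on U f ->
  smooth_on U (fun x => scale (f x)).
Proof.
move=> oU d0 sf; apply: (smooth_mul oU (smooth_cst 2 oU)).
apply: (smooth_inv oU _ (smooth_sqrt oU d0 (smooth_den oU sf))) => x Ux.
by rewrite gt_eqF // sqrtr_gt0 d0.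
Qed.

(** The derivative involves [expqn 1]; multiplied by [u] it is elementary. *)
Lemma den_derive (u : R) : exists2 dD : R, is_derive u 1 den dD &
  u * dD = (2 * K0 - 3) * expR (2 * u) + 1 - den u.
Proof.
exists ((2 * K0 - 3) * (expqn 1 (2 * u) * 2)).
  have D2 : is_derive u 1 (fun v : R => 2 * v) 2.
    rewrite (_ : (fun v : R => _) = (fun v => v * 2)); first exact: is_derive_mulr.
    by apply/funext => v; rewrite mulrC.
  have Dq := is_derive1_comp (is_derive_expqn 0 (2 * u)) D2.
  have := is_deriveD (is_deriveM (is_derive_cst (2 * K0 - 3) u 1) Dq)
    (is_derive_cst (1 : R) u 1).
  by rewrite scaler0 !addr0.
by rewrite -(expqn1E (2 * u)) /den; ring.
Qed.

Lemma form_coeff_derive (u : R) : 0 < den u -> exists2 dm : R,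
  is_derive u 1 form_coeff dm &
  u * den u * dm = (K0 - 1) * expR u + 1
                   - form_coeff u * ((2 * K0 - 3) * expR (2 * u) + 1).
Proof.
move=> du; have dn0 : den u != 0 by rewrite gt_eqF.
have [dD DD uD] := den_derive u.
pose dN := (K0 - 1) * expqn 1 u.
pose N (v : R) := (K0 - 1) * expq v + 1.
have DN : is_derive u 1 N dN.
  have := is_deriveD (is_deriveM (is_derive_cst (K0 - 1) u 1) (is_derive_expqn 0 u))
    (is_derive_cst (1 : R) u 1).
  by rewrite scaler0 !addr0.
have DV : is_derive u 1 (fun v => (den v)^-1) (- (den u ^- 2) * dD).
  exact: is_deriveV dn0 DD.
exists (N u * (- (den u ^- 2) * dD) + (den u)^-1 * dN).
  exact: is_deriveM DN DV.
have uN : u * dN = (K0 - 1) * (expR u - expq u).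
  by rewrite -(expqn1E u) /dN; ring.
transitivity (u * dN - N u / den u * (u * dD)); first by field.
rewrite uN uD /form_coeff -/(N u).
transitivity ((K0 - 1) * expR u + 1 - N u -
  N u / den u * ((2 * K0 - 3) * expR (2 * u) + 1 - den u)).
  by rewrite /N; ring.
by field.
Qed.

Lemma scale_gt0 (u : R) : 0 < den u -> 0 < scale u.
Proof. by move=> du; rewrite divr_gt0 // sqrtr_gt0. Qed.

Lemma scale_sqr (u : R) : 0 < den u -> scale u ^+ 2 * den u = 4.
Proof.
move=> du; rewrite /scale expr_div_n sqr_sqrtr ?ltW //.
by field; rewrite gt_eqF.
Qed.

Lemma scale_derive (u : R) : 0 < den u -> exists2 dn : R,
  is_derive u 1 scale dn &
  dn * scale u * (u * den u) + scale u ^+ 2 * (((2 * K0 - 3) * expR (2 * u) + 1) / 2) = 2.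
Proof.
move=> du; have [dD DD uD] := den_derive u.
have s0 : 0 < Num.sqrt (den u) by rewrite sqrtr_gt0.
have Ds := is_derive1_comp (is_derive1_sqrt du) DD.
have DV := is_deriveV (lt0r_neq0 s0 : (Num.sqrt \o den) u != 0) Ds.
have := is_deriveM (is_derive_cst (2 : R) u 1) DV; rewrite scaler0 addr0.
set dn := _ *: _ => Dn; exists dn; first exact: Dn.
have E : (Num.sqrt (den u)) ^+ 2 = den u by rewrite sqr_sqrtr // ltW.
set F := _ * expR _ + 1.
have uD' : F = u * dD + den u by rewrite uD subrK.
have sE := scale_sqr du.
have dnE : dn * scale u * den u = - 2 * dD / den u.
  have -> : dn = 2 * (- (Num.sqrt (den u) ^- 2) * ((2 * Num.sqrt (den u))^-1 * dD)) by [].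
  rewrite /scale -[X in _ * X = _ / X]E; field; by rewrite gt_eqF.
transitivity (u * (dn * scale u * den u) + scale u ^+ 2 * (F / 2)); first by ring.
rewrite dnE; apply: (mulIf (lt0r_neq0 du)).
transitivity (- 2 * (u * dD) + (scale u ^+ 2 * den u) * (F / 2)).
  by field; rewrite gt_eqF.
by rewrite sE uD'; field.
Qed.

Lemma open_pos (T : topologicalType) (f : T -> R) : continuous f ->
  open [set x | 0 < f x].
Proof. by move=> cf; apply: (open_comp (fun x _ => cf x) (@open_gt R 0)). Qed.

Lemma open_radii_row : open [set x : 'rV[R]_1 | radii (x 0 0)].
Proof.
have c1 : continuous (fun x : 'rV[R]_1 => x 0 0) by exact: coord_continuous.
have c2 : continuous (fun x : 'rV[R]_1 => den (x 0 0 ^+ 2 / 4)).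
  move=> x; apply: (smooth_on_continuous (U := setT)) => //.
  apply: (smooth_den openT); apply: (smooth_mul openT _ (smooth_cst _ openT)).
  exact: (smooth_expn 2 openT (smooth_coord 0 openT)).
exact: openI (open_pos c1) (open_pos c2).
Qed.

Lemma smooth_Phi_row : smooth_on [set x : 'rV[R]_1 | radii (x 0 0)]
  (fun x => Phi K0 (x 0 0)).
Proof.
have oW := open_radii_row.
pose W := [set x : 'rV[R]_1 | radii (x 0 0)].
have s2 (a : R) : smooth_on W (fun x => x 0 0 ^+ 2 / a).
  exact: (smooth_mul oW (smooth_expn 2 oW (smooth_coord 0 oW)) (smooth_cst _ oW)).
apply: (smooth_eq oW (fun x _ => esym (PhiE (x 0 0)))).
apply: (smooth_sqrt oW).
  move=> x [x0 dx]; apply: mulr_gt0; first exact: expR_gt0.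
  by rewrite mulr_gt0 // divr_gt0 // exprn_gt0.
apply: (smooth_mul oW).
  exact: (smooth_comp1 oW smooth1_expR (fun _ _ => I) (smooth_opp oW (s2 2))).
exact: (smooth_mul oW (s2 4) (smooth_den oW (s2 4))).
Qed.

Lemma Phi_gt0 (x : R) : radii x -> 0 < Phi K0 x.
Proof.
move=> [x0 dx]; rewrite PhiE sqrtr_gt0 mulr_gt0 ?expR_gt0 //.
by rewrite mulr_gt0 // divr_gt0 // exprn_gt0.
Qed.

Lemma smooth_positive_eta : smooth_positive_on radii (eta K0).
Proof.
have oW := open_radii_row.
have s2 (a : R) : smooth_on [set x : 'rV[R]_1 | radii (x 0 0)] (fun x => x 0 0 ^+ 2 / a).
  exact: (smooth_mul oW (smooth_expn 2 oW (smooth_coord 0 oW)) (smooth_cst _ oW)).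
move=> x Ix; split.
  have [x0 _] := Ix; rewrite /eta divr_gt0 ?mulr_gt0 ?expR_gt0 ?Phi_gt0 //.
move: x Ix; apply: smooth1_of_row.
apply: (smooth_mul oW).
  apply: (smooth_mul oW (smooth_coord 0 oW)).
  exact: (smooth_comp1 oW smooth1_expR (fun _ _ => I) (smooth_opp oW (s2 4))).
apply: (smooth_inv oW _ (smooth_mul oW (smooth_cst 2 oW) smooth_Phi_row)) => x Wx.
by rewrite mulf_neq0 ?pnatr_eq0 // gt_eqF // Phi_gt0.
Qed.

Lemma smooth_positive_phi : 1 < K0 -> smooth_positive_on radii (phi K0).
Proof.
move=> K1; have oW := open_radii_row.
move=> x Ix; split.
  by rewrite /phi divr_gt0 ?Phi_gt0 // subr_gt0.
move: x Ix; apply: smooth1_of_row.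
exact: (smooth_mul oW smooth_Phi_row (smooth_cst _ oW)).
Qed.

End ProfileFunctions.

(** * The maximal curvature *)

Section MaximalCurvature.
Context {R : realType}.
Definition potential (x : R) : R := (x - 3 / 2) * expR (2 * x).

Lemma potential_min (x : R) : x != 1 -> potential 1 < potential x.
Proof.
move=> x1; have x0 : - (2 * (x - 1)) != 0.
  by rewrite oppr_eq0 mulf_neq0 ?pnatr_eq0 // subr_eq0.
have := expR_gt1Dx x0; rewrite /potential.
have -> : 2 * x = 2 * (x - 1) + 2 * 1 by ring.
rewrite expRD expRN; set a := expR (2 * (x - 1)); set b := expR (2 * 1).
have a0 : 0 < a by exact: expR_gt0.
have b0 : 0 < b by exact: expR_gt0.
rewrite -(ltr_pM2r a0) mulVf ?gt_eqF // => h.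
rewrite mulrA ltr_pM2r //; lra.
Qed.

(** By the intermediate value theorem, since the potential is unbounded. *)
Lemma potential_surj (c : R) : potential 1 < c -> exists2 K0 : R, 1 < K0 & potential K0 = c.
Proof.
move=> hc.
(* at B the exponential is at least 1, and B - 3 / 2 exceeds |c| *)
pose B : R := `|c| + 2.
have c0 := normr_ge0 c; have cc := ler_norm c.
have B1 : 1 <= B by rewrite /B; lra.
have hB : c <= potential B.
  rewrite /potential; have : 1 <= expR (2 * B).
    by rewrite -expR0 ler_expR mulr_ge0 // (le_trans _ B1).
  by move: (expR _) => e e1; rewrite /B; nra.
have cont : {within `[1, B], continuous potential}.
  suff cp (x : R) : {for x, continuous potential}.
    by apply: continuous_subspaceT => x; exact: cp.
  apply: continuousM.
    by apply: continuousB; [exact: cvg_id|exact: cst_continuous].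
  apply: (@continuous_comp R R R (fun x => 2 * x) expR x); last exact: continuous_expR.
  by apply: continuousM; [exact: cst_continuous|exact: cvg_id].
have [] := @IVT R potential 1 B c B1 cont.
  by rewrite ge_min (ltW hc) le_max hB orbT.
move=> x; rewrite in_itv /= => /andP[x1 _] xc; exists x => //.
by rewrite lt_neqAle x1 andbT; apply: contraTneq hc => x1'; rewrite -xc -x1' ltxx.
Qed.

(** The first integral, solved for [S]. *)
Lemma slope_den (K0 k S : R) : (S + k - 3 / 2) * expR (2 * k) = potential K0 ->
  S = (K0 - k) * den K0 (K0 - k).
Proof.
rewrite den_mul /potential => h.
have -> : 2 * (K0 - k) = 2 * K0 - 2 * k by ring.
rewrite expRB; have e0 : expR (2 * k) != 0 by rewrite gt_eqF ?expR_gt0.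
apply: (mulIf e0); move: h; set e := expR (2 * k); set e' := expR (2 * K0) => h.
have -> : S * e = (S + k - 3 / 2) * e - (k - 3 / 2) * e by ring.
by rewrite h; field.
Qed.

(** As [S >= 0], this shows that the curvature does not exceed [K0]. *)
Lemma den_mul_lt0 (K0 u : R) : 1 < K0 -> u < 0 -> u * den K0 u < 0.
Proof.
move=> K1 u0; rewrite den_mul.
have h1 : expR (2 * u) < 1 by rewrite expR_lt1 pmulr_rlt0.
have h2 := expR_ge1Dx (2 * u).
by move: (expR _) h1 h2 => e h1 h2; have [|] := leP (3 / 2) K0; nra.
Qed.

Lemma den_gt0 (K0 u : R) : 1 < K0 -> 0 < u * den K0 u -> 0 < u /\ 0 < den K0 u.
Proof.
move=> K1 h; have u0 : 0 < u.
  have [//|u0|u0] := ltgtP 0 u.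
    by have := lt_trans h (den_mul_lt0 K1 u0); rewrite ltxx.
  by move: h; rewrite -u0 mul0r ltxx.
by split=> //; rewrite -(pmulr_rgt0 _ u0).
Qed.

Lemma den0 (K0 : R) : den K0 0 = 2 * (K0 - 1).
Proof. by rewrite /den mulr0 expq0; ring. Qed.

(** A critical value of the curvature above [1] is its maximal value [K0]: the
    equation says that the potential takes the same value at [k] and [K0], a
    condition symmetric in the two, and [den_mul_lt0] then excludes both
    [k < K0] and [K0 < k]. *)
Lemma den_mul_eq0 (K0 k : R) : 1 < K0 -> 1 < k -> (K0 - k) * den K0 (K0 - k) = 0 -> k = K0.
Proof.
move=> K1 k1 h; have [kK|kK|//] := ltgtP k K0.
  have uk : k - K0 < 0 by rewrite subr_lt0.
  have := den_mul_lt0 k1 uk; move: h; rewrite !den_mul.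
  have -> : 2 * (k - K0) = - (2 * (K0 - k)) by ring.
  rewrite expRN; have := expR_gt0 (2 * (K0 - k)); move: (expR _) => e e0 h.
  rewrite -(pmulr_llt0 _ e0).
  have -> : ((k - 3 / 2) * (e^-1 - 1) + (k - K0)) * e =
      - ((K0 - 3 / 2) * (e - 1) + (K0 - k)) by field; rewrite gt_eqF.
  by rewrite h oppr0 ltxx.
have uk : K0 - k < 0 by rewrite subr_lt0.
by have := den_mul_lt0 K1 uk; rewrite h ltxx.
Qed.

Lemma form_coeff_mul (K0 u : R) : den K0 u != 0 ->
  u * den K0 u * form_coeff K0 u = (K0 - 1) * (expR u - 1) + u.
Proof. by move=> d0; rewrite -expqE /form_coeff; field. Qed.

(** The condition that [a3 + m(K0 - K) (K1 a2 - K2 a1)] be closed, where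
    [S = K1^2 + K2^2] and [k = K]. *)
Lemma form_coeff_ode (K0 k S : R) : S = (K0 - k) * den K0 (K0 - k) -> 0 < den K0 (K0 - k) ->
  exists2 dm : R, is_derive (K0 - k) 1 (form_coeff K0) dm &
    S * dm = k + form_coeff K0 (K0 - k) * (2 - 2 * k - S).
Proof.
move=> SE d0; have [dm Dm E] := form_coeff_derive d0.
exists dm => //; rewrite SE E.
have := form_coeff_mul (lt0r_neq0 d0); have := den_mul K0 (K0 - k).
set P := _ * den _ _; set m := form_coeff _ _.
set e := expR (K0 - k); set e2 := expR (2 * _) => h2 h1.
have -> : (2 * K0 - 3) * e2 = 2 * (P - (K0 - k)) + (2 * K0 - 3) by lra.
have -> : (K0 - 1) * e = P * m + K0 - 1 - (K0 - k) by lra.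
ring.
Qed.

End MaximalCurvature.

(** * Calculus on a manifold *)

Section ManifoldCalculus.
Context {R : realType} {n : nat} {M : manifold R n}.
Implicit Types (U : set M) (f : M -> R) (p q : M) (c : chart R n M).

Definition chart_image c U : set 'rV[R]_n := cmap c @` (U `&` cdom c).

Lemma chart_image_sub c U V : U `<=` V -> chart_image c U `<=` chart_image c V.
Proof. by move=> UV x [p [Up cp] <-]; exists p => //; split=> //; exact: UV. Qed.

Lemma chart_imageP c U x : chart_image c U x <->
  [/\ U (cinv c x), cdom c (cinv c x) & cmap c (cinv c x) = x].
Proof.
split=> [[p [Up cp] <-]|[Ux cx xE]]; first by rewrite (cmapK cp).
by exists (cinv c x).
Qed.

Lemma mem_chart_image c U p : U p -> cdom c p -> chart_image c U (cmap c p).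
Proof. by move=> Up cp; exists p. Qed.

Lemma open_chart_image c U : open U -> open (chart_image c U).
Proof.
move=> oU; rewrite openE => x [p [Up cp] <-].
have H1 : nbhs (cmap c p) (cmap c @` cdom c).
  by apply: open_nbhs_nbhs; split; [exact: cimg_open|exists p].
have H2 : nbhs (cmap c p) (cinv c @^-1` (U `&` cdom c)).
  apply: (cinv_continuous cp); rewrite (cmapK cp).
  by apply: open_nbhs_nbhs; split; [apply: openI => //; exact: cdom_open|].
apply: filterS (filterI H1 H2) => y /= [[q cq <-]].
by rewrite (cmapK cq) => -[Uq _]; exists q.
Qed.

Lemma open_chart_preimage c U (A : set 'rV[R]_n) : open U -> open A ->
  open [set p | [/\ U p, cdom c p & A (cmap c p)]].
Proof.
move=> oU oA; rewrite openE => p [Up cp Ap].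
have H1 : nbhs p (U `&` cdom c).
  by apply: open_nbhs_nbhs; split; [apply: openI => //; exact: cdom_open|].
have H2 : nbhs p (cmap c @^-1` A).
  by apply: (cmap_continuous cp); apply: open_nbhs_nbhs; split.
by apply: filterS (filterI H1 H2) => q [[]].
Qed.

Lemma nbhs_open (T : topologicalType) (U : set T) (p : T) : open U -> U p -> \forall q \near p, U q.
Proof. by move=> oU Up; apply: open_nbhs_nbhs; split. Qed.

Lemma msmooth_subset U V f : V `<=` U -> msmooth_on U f -> msmooth_on V f.
Proof.
by move=> VU sf c ac; apply: smooth_subset (sf c ac); exact: chart_image_sub.
Qed.

Lemma chart_continuous c U f p : cdom c p -> open U -> U p ->
  {for cmap c p, continuous (f \o cinv c)} -> {for p, continuous f}.
Proof.
move=> cp oU Up cf; rewrite /prop_for /continuous_at -{2}(cmapK cp).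
have cg : {for p, continuous ((f \o cinv c) \o cmap c)}.
  by apply: continuous_comp => //; exact: cmap_continuous.
apply: cvg_trans cg; apply: near_eq_cvg.
apply: filterS (nbhs_open (@cdom_open _ _ _ c) cp) => q cq.
by rewrite /= (cmapK cq).
Qed.

Lemma msmooth_continuous U f p : open U -> msmooth_on U f -> U p -> {for p, continuous f}.
Proof.
move=> oU sf Up; have [c ac cp] := atlas_cover p.
apply: (chart_continuous cp oU Up); apply: smooth_on_continuous (sf c ac) _.
exact: mem_chart_image.
Qed.

Lemma is_derive_on_curve c U f (g : R -> M) (t : R) (v : 'rV[R]_n) : open U ->
  Ck 1 (chart_image c U) (f \o cinv c) -> U (g t) -> cdom c (g t) ->
  {for t, continuous g} -> is_derive t 1 (fun s => cmap c (g s)) v ->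
  is_derive t 1 (fun s => f (g s)) (\sum_i v 0 i * cpartial c i f (g t)).
Proof.
move=> oU Cf Ug cg gc Dx.
have := chain_curve (open_chart_image (c := c) oU) Cf (mem_chart_image Ug cg) Dx.
apply: near_eq_is_derive.
have : \forall s \near t, cdom c (g s) by apply: gc; apply: nbhs_open => //; exact: cdom_open.
by apply: filterS => s cs /=; rewrite (cmapK cs).
Qed.

Lemma is_derive_row (x : R -> 'rV[R]_n) (t : R) (v : 'I_n -> R) :
  (forall i, is_derive t 1 (fun s => x s 0 i) (v i)) -> is_derive t 1 x (\row_i v i).
Proof.
move=> Dx; have dx : derivable x t 1.
  by apply/derivable_mxP => i j; rewrite (ord1 i); have [] := Dx j.
apply: DeriveDef => //; rewrite derive_mx //; apply/rowP => i.
by rewrite !mxE; have D := Dx i; rewrite derive_val.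
Qed.

(** A coordinate line of [c] is a smooth curve in the chart [c'], so [f] has to
    be known as a function of the coordinates of [c'] only. *)
Lemma is_derive_chart_change c c' U f p i : atlas c -> atlas c' -> open U -> U p ->
  cdom c p -> cdom c' p -> Ck 1 (chart_image c' U) (f \o cinv c') ->
  is_derive (cmap c p) (delta_mx 0 i : 'rV[R]_n) (f \o cinv c)
    (\sum_j cpartial c i (fun q => cmap c' q 0 j) p * cpartial c' j f p).
Proof.
move=> ac ac' oU Up cp c'p Cf; apply/is_derive_line.
pose g (t : R) := cinv c (t *: delta_mx 0 i + cmap c p).
have g0 : g 0 = p by rewrite /g scale0r add0r (cmapK cp).
have gc : {for 0, continuous g}.
  have cl : {for (0 : R), continuous (fun t : R => t *: delta_mx 0 i + cmap c p : 'rV[R]_n)}.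
    by apply: continuousD; [exact: scalel_continuous|exact: cst_continuous].
  apply: continuous_comp => //; rewrite scale0r add0r; exact: cinv_continuous.
have Dx : is_derive (0 : R) 1 (fun s => cmap c' (g s))
    (\row_j cpartial c i (fun q => cmap c' q 0 j) p).
  apply: is_derive_row => j; apply/(is_derive_line (fun x => cmap c' (cinv c x) 0 j)).
  apply: smooth_on_is_derive (atlas_compatible ac ac' j) _.
  by exists p.
have := is_derive_on_curve oU Cf; move=> /(_ g 0); rewrite g0 => /(_ _ Up c'p gc Dx).
set s1 := \sum__ _; set s2 := \sum__ _; suff -> : s1 = s2 by [].
by apply: eq_bigr => j _; rewrite mxE.
Qed.

(** A primitive found in one chart is smooth on the manifold when its
    differential is a smooth form: by the transformation rule of forms its
    partial derivatives in every other chart are components of that form. *)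
Lemma smooth_of_differential c0 U f (b : covector_field M) : atlas c0 -> open U ->
  U `<=` cdom c0 ->
  (forall c, atlas c -> forall i,
     smooth_on (chart_image c U) (fun x => b c (cinv c x) 0 i)) ->
  (forall c p, atlas c -> cdom c p -> U p -> forall i, b c p 0 i =
     \sum_j b c0 p 0 j * cpartial c i (fun q => cmap c0 q 0 j) p) ->
  Ck 1 (chart_image c0 U) (f \o cinv c0) ->
  (forall p, U p -> forall j, cpartial c0 j f p = b c0 p 0 j) ->
  msmooth_on U f /\ forall c p i, atlas c -> cdom c p -> U p ->
    is_derive (cmap c p) (delta_mx 0 i : 'rV[R]_n) (f \o cinv c) (b c p 0 i).
Proof.
move=> ac0 oU U0 sb bt Cf df.
have D c p i : atlas c -> cdom c p -> U p ->
    is_derive (cmap c p) (delta_mx 0 i : 'rV[R]_n) (f \o cinv c) (b c p 0 i).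
  move=> ac cp Up.
  have := is_derive_chart_change i ac ac0 oU Up cp (U0 _ Up) Cf.
  rewrite (bt c p) //; set s1 := \sum__ _; set s2 := \sum__ _; suff -> : s1 = s2 by [].
  by apply: eq_bigr => j _; rewrite df // mulrC.
split=> // c ac; have oW := open_chart_image (c := c) oU.
have cf x : chart_image c U x -> {for x, continuous (f \o cinv c)}.
  move=> [p [Up cp] <-]; apply: continuous_comp; first exact: cinv_continuous.
  rewrite (cmapK cp); apply: (chart_continuous (U0 _ Up) oU Up).
  by apply: Ck_continuous Cf _; exact: mem_chart_image (U0 _ Up).
apply/smooth_onP => -[|k]; first by split.
apply: (Ck_step (df := fun i x => b c (cinv c x) 0 i)) => //.
- move=> x i [p [Up cp] <-]; rewrite (cmapK cp); exact: D.
- by move=> i; apply: smooth_on_Ck; exact: sb.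
Qed.

(** The set where [f] takes the value [f p] is closed by continuity, and open by
    the mean value estimate in a chart. *)
Lemma constant_of_null_differential f (C : set M) : (forall p, {for p, continuous f}) ->
  (forall c p i, atlas c -> cdom c p ->
     is_derive (cmap c p) (delta_mx 0 i : 'rV[R]_n) (f \o cinv c) 0) ->
  open C -> connected C -> forall p q, C p -> C q -> f q = f p.
Proof.
move=> cf Df oC cC p q Cp Cq.
pose B := [set q | f q = f p].
have loc q0 : \forall q \near q0, f q = f q0.
  have [c ac cq] := atlas_cover q0.
  have [d d0 dU] := open_cube_sub (open_chart_image (c := c) openT)
    (mem_chart_image (U := setT) I cq).
  have oN := open_chart_preimage c openT (open_cube (x := cmap c q0) d0).
  have := nbhs_open oN (And3 I cq (cube_center _ d0)).
  apply: filterS => q1 [_ cq1 q1d].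
  have D1 x i : cube (cmap c q0) d x ->
      is_derive x (delta_mx 0 i : 'rV[R]_n) (f \o cinv c) 0.
    by move=> /dU [q2 [_ cq2] <-]; apply: Df.
  have := @cube_mean_value _ _ (f \o cinv c) (cmap c q0) d (fun=> 0) 0 (cmap c q0) (cmap c q1).
  rewrite /= !cmapK //.
  under [X in _ - _ - X]eq_bigr do rewrite mul0r.
  under [leRHS]eq_bigr do rewrite mulr0.
  rewrite !big1 // subr0 normr_le0 subr_eq0 => H; apply/eqP; apply: H => //.
  - by move=> x i xd; have [] := D1 x i xd.
  - move=> x i xd; rewrite /partial; have D2 := D1 x i xd.
    by rewrite derive_val subr0 normr0.
  - exact: cube_center.
have BC : C `&` B = C.
  apply: cC; first by exists p.
  - exists B => //; rewrite openE => q0 q0B.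
    by have := loc q0; apply: filterS => q1; rewrite /B /= => ->.
  - exists B => //; have -> : B = f @^-1` [set f p] by apply/seteqP; split.
    by apply: closed_comp => [x _|]; [exact: cf|exact: closed_eq].
by have [] : (C `&` B) q by rewrite BC.
Qed.

End ManifoldCalculus.

(** * Coframings *)

Section SmoothMatrices.
Context {R : realType} {n : nat}.
Implicit Types (U : set 'rV[R]_n).

Lemma smooth_det k U (B : 'rV[R]_n -> 'M[R]_k) : open U ->
  (forall i j, smooth_on U (fun x => B x i j)) -> smooth_on U (fun x => \det (B x)).
Proof.
move=> oU sB; rewrite /determinant.
apply: (smooth_sum oU) => s; apply: (smooth_mul oU (smooth_cst _ oU)).
by apply: (smooth_prod oU) => i; exact: sB.
Qed.

Lemma smooth_invmx k U (B : 'rV[R]_n -> 'M[R]_k) : open U ->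
  (forall i j, smooth_on U (fun x => B x i j)) -> (forall x, U x -> B x \in unitmx) ->
  forall i j, smooth_on U (fun x => invmx (B x) i j).
Proof.
move=> oU sB uB i j.
have E x : U x -> (\det (B x))^-1 * ((-1) ^+ (j + i) * \det (row' j (col' i (B x))))
    = invmx (B x) i j.
  by move=> Ux; rewrite /invmx uB // !mxE.
apply: (smooth_eq oU E); apply: (smooth_mul oU).
  apply: (smooth_inv oU _ (smooth_det oU sB)) => x Ux.
  by have := uB x Ux; rewrite unitmxE unitfE.
apply: (smooth_mul oU (smooth_cst _ oU)); apply: (smooth_det oU) => k1 k2.
rewrite (_ : (fun x => _) = (fun x => B x (lift j k1) (lift i k2))); first exact: sB.
by apply/funext => x; rewrite !mxE.
Qed.

End SmoothMatrices.

Section Coframing.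
Context {R : realType} {M : manifold R 3}.
Variables (a1 a2 a3 : covector_field M).
Hypothesis Ha : coframing a1 a2 a3.
Implicit Types (c : chart R 3 M) (p : M).

Definition frame_mx c p : 'M[R]_3 := col_mx (a1 c p) (col_mx (a2 c p) (a3 c p)).

Let i1 : 'I_(1 + (1 + 1)) := lshift (1 + 1) (@ord0 0).
Let i2 : 'I_(1 + (1 + 1)) := rshift 1 (lshift 1 (@ord0 0)).
Let i3 : 'I_(1 + (1 + 1)) := rshift 1 (rshift 1 (@ord0 0)).

Let row3E (x y z : R) : let v := row_mx x%:M (row_mx y%:M z%:M) : 'rV[R]_(1 + (1 + 1)) in
  [/\ v 0 i1 = x, v 0 i2 = y & v 0 i3 = z].
Proof.
move=> v; rewrite /v /i1 /i2 /i3.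
by split; rewrite !(row_mxEl, row_mxEr) mxE eqxx mulr1n.
Qed.

Lemma frame_mxE c p (x y z : R) :
  x *: a1 c p + y *: a2 c p + z *: a3 c p =
  (row_mx x%:M (row_mx y%:M z%:M) : 'rV[R]_(1 + (1 + 1))) *m frame_mx c p.
Proof. by rewrite /frame_mx !mul_row_col !mul_scalar_mx addrA. Qed.

Lemma frame_mx_unit c p : atlas c -> cdom c p -> frame_mx c p \in unitmx.
Proof.
by move=> ac cp; have [_ _ _ H] := Ha; rewrite -row_free_unit; apply: H.
Qed.

(** Evaluation on the dual frame, for reading off the coefficients of a linear
    combination of the coframe. *)
Lemma dual_frame c p : atlas c -> cdom c p -> exists e1 e2 e3 : 'cV[R]_3,
  forall x y z : R, let w := x *: a1 c p + y *: a2 c p + z *: a3 c p in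
  [/\ (w *m e1) 0 0 = x, (w *m e2) 0 0 = y & (w *m e3) 0 0 = z].
Proof.
move=> ac cp; have Fu := frame_mx_unit ac cp.
pose E := invmx (frame_mx c p).
exists (col i1 E), (col i2 E), (col i3 E) => x y z w.
have wE : w *m E = row_mx x%:M (row_mx y%:M z%:M) :> 'rV[R]_(1 + (1 + 1)).
  by rewrite /w frame_mxE mulmxK.
have H k : (w *m col k E) 0 0 = (w *m E) 0 k.
  by rewrite [LHS]mxE [RHS]mxE; apply: eq_bigr => j _; rewrite [col _ _ _ _]mxE.
rewrite !H wE.
exact: row3E.
Qed.

Lemma one_form_smooth c (U : set M) (a : covector_field M) j : one_form a -> atlas c ->
  smooth_on (chart_image c U) (fun x => a c (cinv c x) 0 j).
Proof.
move=> [sa _] ac; apply: smooth_subset (sa c ac j c ac).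
by move=> x [p [Up cp] <-]; exists p.
Qed.

Lemma smooth_frame_mx c U : atlas c -> open U -> forall i j,
  smooth_on (chart_image c U) (fun x => frame_mx c (cinv c x) i j).
Proof.
move=> ac oU i j; have oW := open_chart_image (c := c) oU.
have [s1 s2 s3 _] := Ha.
have S (a : covector_field M) : one_form a ->
    smooth_on (chart_image c U) (fun x => a c (cinv c x) 0 j).
  by move=> fa; exact: one_form_smooth.
suff key (k : 'I_(1 + (1 + 1))) : smooth_on (chart_image c U) (fun x =>
    col_mx (a1 c (cinv c x)) (col_mx (a2 c (cinv c x)) (a3 c (cinv c x))) k j).
  exact: key.
move: {i} k => i; case: (split_ordP i) => k ->.
  rewrite (_ : (fun x => _) = (fun x => a1 c (cinv c x) 0 j)); first exact: S.
  by apply/funext => x; rewrite col_mxEu (ord1 k).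
case: (split_ordP k) => l ->.
  rewrite (_ : (fun x => _) = (fun x => a2 c (cinv c x) 0 j)); first exact: S.
  by apply/funext => x; rewrite col_mxEd col_mxEu (ord1 l).
rewrite (_ : (fun x => _) = (fun x => a3 c (cinv c x) 0 j)); first exact: S.
by apply/funext => x; rewrite !col_mxEd (ord1 l).
Qed.

(** The coframe derivatives are the solution of a linear system with smooth
    coefficients, and Cramer's formula is smooth. *)
Lemma smooth_coframe_derivatives f f1 f2 f3 : msmooth_on setT f ->
  coframe_derivatives a1 a2 a3 f f1 f2 f3 ->
  [/\ msmooth_on setT f1, msmooth_on setT f2 & msmooth_on setT f3].
Proof.
move=> sf Hf.
have key c (g : M -> R) (k : 'I_3) : atlas c ->
    (forall p, (row_mx (f1 p)%:M (row_mx (f2 p)%:M (f3 p)%:M) : 'rV[R]_3) 0 k = g p) ->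
    smooth_on (chart_image c setT) (g \o cinv c).
  move=> ac gE; have oW := open_chart_image (c := c) openT.
  have E x : chart_image c setT x ->
      \sum_j partial j (f \o cinv c) x * invmx (frame_mx c (cinv c x)) j k = (g \o cinv c) x.
    move=> [p [_ cp] <-]; rewrite /= (cmapK cp).
    have := Hf c p ac cp I; rewrite frame_mxE => /(congr1 (fun w => (w *m invmx (frame_mx c p)) 0 k)).
    rewrite (mulmxK (frame_mx_unit ac cp)) gE => <-; rewrite mxE.
    by apply: eq_bigr => j _; rewrite mxE.
  apply: (smooth_eq oW E); apply: (smooth_sum oW) => j.
  apply: (smooth_mul oW (smooth_partial _ (sf c ac))).
  apply: (smooth_invmx oW (smooth_frame_mx ac openT)) => x [p [_ cp] <-].
  by rewrite (cmapK cp); exact: frame_mx_unit.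
split=> c ac.
- apply: (key c f1 i1 ac) => p.
  by have [] := row3E (f1 p) (f2 p) (f3 p).
- apply: (key c f2 i2 ac) => p.
  by have [] := row3E (f1 p) (f2 p) (f3 p).
- apply: (key c f3 i3 ac) => p.
  by have [] := row3E (f1 p) (f2 p) (f3 p).
Qed.

End Coframing.

(** * Flow boxes *)

Section FlowBox.
Context {R : realType} {M : manifold R 3}.
Variables (a1 a2 a3 : covector_field M).
Hypothesis Ha : coframing a1 a2 a3.
Variables (U : set M) (X Y A B D E : M -> R).
Hypothesis oU : open U.
Hypothesis sX : msmooth_on U X.
Hypothesis sY : msmooth_on U Y.
Hypothesis dX : forall c p i, atlas c -> cdom c p -> U p ->
  is_derive (cmap c p) (delta_mx 0 i : 'rV[R]_3) (X \o cinv c)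
    (A p * a1 c p 0 i + B p * a2 c p 0 i).
Hypothesis dY : forall c p i, atlas c -> cdom c p -> U p ->
  is_derive (cmap c p) (delta_mx 0 i : 'rV[R]_3) (Y \o cinv c)
    (D p * a1 c p 0 i + E p * a2 c p 0 i).
Hypothesis det0 : forall p, U p -> A p * E p - B p * D p != 0.

Lemma pairingE (v a b : 'rV[R]_3) (x y : R) :
  \sum_i v 0 i * (x * a 0 i + y * b 0 i) = x * (a *m v^T) 0 0 + y * (b *m v^T) 0 0.
Proof.
rewrite !mxE !mulr_sumr -big_split /=; apply: eq_bigr => i _.
by rewrite !mxE; ring.
Qed.

Lemma det_solve (x y z w p q : R) : x * w - y * z != 0 ->
  x * p + y * q = 0 -> z * p + w * q = 0 -> p = 0 /\ q = 0.
Proof.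
move=> h e1 e2; split; apply: (mulfI h); rewrite mulr0.
  transitivity (w * (x * p + y * q) - y * (z * p + w * q)); first by ring.
  by rewrite e1 e2; ring.
transitivity (x * (z * p + w * q) - z * (x * p + y * q)); first by ring.
by rewrite e1 e2; ring.
Qed.

Lemma cpartial_pair f c p i (x y : R) :
  is_derive (cmap c p) (delta_mx 0 i : 'rV[R]_3) (f \o cinv c)
    (x * a1 c p 0 i + y * a2 c p 0 i) ->
  cpartial c i f p = x * a1 c p 0 i + y * a2 c p 0 i.
Proof. by move=> Df; rewrite /cpartial /partial derive_val. Qed.

(** The differentials of [X] and [Y] vanish on vectors tangent to a leaf. *)
Lemma leaf_constant V q q' : V `<=` U -> same_leaf a1 a2 V q q' ->
  X q = X q' /\ Y q = Y q'.
Proof.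
move=> VU [g [g0 g1 Hg]].
have key (f x y : M -> R) : msmooth_on U f ->
    (forall c p i, atlas c -> cdom c p -> U p ->
      is_derive (cmap c p) (delta_mx 0 i : 'rV[R]_3) (f \o cinv c)
      (x p * a1 c p 0 i + y p * a2 c p 0 i)) -> f q = f q'.
  move=> sf df.
  suff : `|f (g 1) - f (g 0) - 0| <= 0.
    by rewrite g0 g1 subr0 normr_le0 subr_eq0 => /eqP.
  apply: (@mean_value_segment R (fun t => f (g t)) (fun=> 0)) => t t01; last first.
    by rewrite subrr normr0.
  have [Vg gc Hc] := Hg t t01; have Ug := VU _ Vg.
  have [c ac cg] := atlas_cover (g t).
  have [dx E1 E2] := Hc c ac cg.
  have Dx := derivableP dx; rewrite -derive1E in Dx.
  have := is_derive_on_curve oU (smooth_on_Ck 1 (sf c ac)) Ug cg gc Dx.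
  under eq_bigr do rewrite (cpartial_pair (df c _ _ ac cg Ug)).
  by rewrite pairingE E1 E2 mxE !mulr0 addr0.
by split; [apply: (key X A B)|apply: (key Y D E)].
Qed.

(** Together with a third coordinate transverse to [(X, Y)], the functions [X]
    and [Y] form a local diffeomorphism [F] near [p0], and [Om] is the preimage of
    a box.  Two points of [Om] with the same [(X, Y)] have images joined by a
    segment of the box, parallel to the third axis; its preimage is tangent to
    the leaves because [dX] and [dY] vanish on it and determine [a1] and [a2].
    The predicate [P] allows [Om] to be cut down afterwards by any condition on
    [(X, Y)], which holds along the whole curve if it holds at an end. *)
Theorem flow_box p0 : U p0 -> exists (Om : set M) (e : R),
  [/\ open Om /\ Om p0, Om `<=` U, 0 < e,
    (forall x y, `|x - X p0| < e -> `|y - Y p0| < e ->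
       exists q, [/\ Om q, X q = x & Y q = y]) &
    forall (P : R -> R -> Prop) q q', Om q -> Om q' -> P (X q) (Y q) ->
      X q = X q' -> Y q = Y q' ->
      same_leaf a1 a2 (Om `&` [set p | P (X p) (Y p)]) q q'].
Proof.
move=> Up0; have [c0 ac0 c0p0] := atlas_cover p0.
pose x0 := cmap c0 p0.
have oW := open_chart_image (c := c0) oU.
have Wx0 : chart_image c0 U x0 by exact: mem_chart_image.
have [e1 [e2 [e3 He]]] := dual_frame Ha ac0 c0p0.
(* the k-th coordinate varies along the leaf direction e3 of the dual frame *)
have [k ek] : exists k, e3 k 0 != 0.
  apply: contrapT => H; have e30 : e3 = 0.
    apply/matrixP => i j; rewrite (ord1 j) mxE; apply/eqP; apply: contrapT => /negP h.
    by apply: H; exists i.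
  have [_ _] := He 0 0 1; rewrite e30 mulmx0 mxE => /eqP.
  by rewrite eq_sym oner_eq0.
pose F (x : 'rV[R]_3) : 'rV[R]_3 := \row_(j < 3)
  (if val j == 0%N then X (cinv c0 x) else if val j == 1%N then Y (cinv c0 x) else x 0 k).
pose j1 : 'I_3 := lift ord0 ord0; pose j2 : 'I_3 := lift ord0 (lift ord0 ord0).
have FX x : F x 0 ord0 = X (cinv c0 x) by rewrite mxE.
have FY x : F x 0 j1 = Y (cinv c0 x) by rewrite mxE.
have Fz x : F x 0 j2 = x 0 k by rewrite mxE.
have row3 (P : 'I_3 -> Prop) : P ord0 -> P j1 -> P j2 -> forall j, P j.
  move=> P0 P1 P2 [[|[|[|//]]] lj].
  - by rewrite (_ : Ordinal lj = ord0) //; apply/val_inj.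
  - by rewrite (_ : Ordinal lj = j1) //; apply/val_inj.
  - by rewrite (_ : Ordinal lj = j2) //; apply/val_inj.
have CF : forall j, Ck 1 (chart_image c0 U) (fun x => F x 0 j).
  apply: row3.
  - exact: Ck_eq oW (fun x _ => esym (FX x)) (smooth_on_Ck 1 (sX ac0)).
  - exact: Ck_eq oW (fun x _ => esym (FY x)) (smooth_on_Ck 1 (sY ac0)).
  - exact: Ck_eq oW (fun x _ => esym (Fz x)) (Ck_coord 1 k oW).
have Ju : Jacobian F x0 \in unitmx.
  rewrite -unitmx_tr; apply: unitmx_inj => v vJ.
  have vi i : v 0 ord0 * (A p0 * a1 c0 p0 0 i + B p0 * a2 c0 p0 0 i)
      + v 0 j1 * (D p0 * a1 c0 p0 0 i + E p0 * a2 c0 p0 0 i)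
      + v 0 j2 * (i == k)%:R = 0.
    move/rowP/(_ i) : vJ; rewrite !mxE !big_ord_recl big_ord0 addr0 !mxE -/j1 -/j2 addrA.
    rewrite (_ : (fun y => F y 0 ord0) = X \o cinv c0); last exact/funext.
    rewrite (_ : (fun y => F y 0 j1) = Y \o cinv c0); last exact/funext.
    rewrite (_ : (fun y => F y 0 j2) = (fun y => y 0 k)); last exact/funext.
    have -> : partial i (X \o cinv c0) x0 = A p0 * a1 c0 p0 0 i + B p0 * a2 c0 p0 0 i.
      exact: cpartial_pair (dX i ac0 c0p0 Up0).
    have -> : partial i (Y \o cinv c0) x0 = D p0 * a1 c0 p0 0 i + E p0 * a2 c0 p0 0 i.
      exact: cpartial_pair (dY i ac0 c0p0 Up0).
    have Dz := is_derive_coord k x0 (delta_mx 0 i).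
    by rewrite /partial derive_val mxE eqxx /= eq_sym.
  pose xi := v 0 ord0 * A p0 + v 0 j1 * D p0; pose yi := v 0 ord0 * B p0 + v 0 j1 * E p0.
  have w0 : xi *: a1 c0 p0 + yi *: a2 c0 p0 + 0 *: a3 c0 p0 = - v 0 j2 *: delta_mx 0 k.
    apply/rowP => i; have := vi i; rewrite !mxE eqxx /= /xi /yi.
    by move: (i == k)%:R => d; lra.
  have v2 : v 0 j2 = 0.
    have [_ _] := He xi yi 0; rewrite w0 -scalemxAl -rowE mxE mxE => /eqP.
    by rewrite mulf_eq0 oppr_eq0 (negbTE ek) orbF => /eqP.
  have [xi0 yi0 _] : [/\ xi = 0, yi = 0 & 0 = 0 :> R].
    have [h1 h2 _] := He xi yi 0; rewrite w0 v2 oppr0 scale0r mul0mx mxE in h1.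
    by rewrite w0 v2 oppr0 scale0r mul0mx mxE in h2; rewrite -h1 -h2.
  have := @det_solve (A p0) (D p0) (B p0) (E p0) (v 0 ord0) (v 0 j1).
  have -> : A p0 * E p0 - D p0 * B p0 = A p0 * E p0 - B p0 * D p0 by ring.
  have xi0' : A p0 * v 0 ord0 + D p0 * v 0 j1 = 0 by rewrite -xi0 /xi; ring.
  have yi0' : B p0 * v 0 ord0 + E p0 * v 0 j1 = 0 by rewrite -yi0 /yi; ring.
  move=> /(_ (det0 Up0) xi0' yi0')[v0 v1]; apply/rowP; apply: row3; by rewrite mxE.
have [d [e [L [d0 e0 [L0 dW] Flip Fsurj]]]] := local_inverse oW CF Wx0 Ju.
pose O := [set x | cube x0 d x /\ cube (F x0) e (F x)].
have oO : open O.
  rewrite openE => x [xd xe].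
  have H1 : nbhs x (cube x0 d) by apply: open_nbhs_nbhs; split=> //; exact: open_cube.
  have H2 : \forall y \near nbhs x, forall j, `|F y 0 j - F x0 0 j| < e.
    apply: filter_forall => j.
    have cj := Ck_continuous (CF j) (dW _ xd).
    have oB : open [set z : R | `|z - F x0 0 j| < e].
      rewrite (_ : [set z | _] = ball (F x0 0 j) e); first exact: ball_open.
      by apply/seteqP; split=> z; rewrite /ball /= distrC.
    exact: (cj _ (nbhs_open oB (xe j))).
  by apply: filterS (filterI H1 H2) => y [].
pose Om := [set p | [/\ U p, cdom c0 p & O (cmap c0 p)]].
have oOm : open Om by exact: open_chart_preimage.
have OmU : Om `<=` U by move=> p [].
have back y : cube x0 d y -> cube (F x0) e (F y) ->
    Om (cinv c0 y) /\ cmap c0 (cinv c0 y) = y.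
  move=> yd ye; have /chart_imageP[Uy cy yE] := dW y yd.
  by split=> //; split=> //; rewrite yE.
have FXp p : cdom c0 p -> F (cmap c0 p) 0 ord0 = X p by move=> cp; rewrite FX (cmapK cp).
have FYp p : cdom c0 p -> F (cmap c0 p) 0 j1 = Y p by move=> cp; rewrite FY (cmapK cp).
exists Om, e; split=> //.
- split=> //; split=> //; split; exact: cube_center.
- move=> x y xe ye.
  pose w : 'rV[R]_3 := \row_j (if val j == 0%N then x else if val j == 1%N then y else x0 0 k).
  have we : cube (F x0) e w.
    apply: row3; rewrite !mxE /=.
    + by rewrite (cmapK c0p0).
    + by rewrite (cmapK c0p0).
    + by rewrite subrr normr0.
  have [z zd Fzw] := Fsurj w we.
  have [Omz zE] := back z zd (eq_ind_r (cube (F x0) e) we Fzw).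
  exists (cinv c0 z); split=> //.
    by rewrite -FX Fzw mxE.
  by rewrite -FY Fzw mxE.
move=> P q q' [Uq cq [qd qe]] [Uq' cq' [q'd q'e]] Pq XX YY.
pose w := F (cmap c0 q); pose v := F (cmap c0 q') - w.
have v_on (j : 'I_3) : j = ord0 \/ j = j1 -> v 0 j = 0.
  by case=> ->; rewrite !mxE /= !(cmapK cq) !(cmapK cq') ?XX ?YY subrr.
have vE j : v 0 j = F (cmap c0 q') 0 j - w 0 j by rewrite /v [LHS]mxE [X in _ + X]mxE.
have lE (t : R) j : (t *: v + w) 0 j = t * v 0 j + w 0 j.
  by rewrite [LHS]mxE [X in X + _]mxE.
pose T := [set t : R | cube (F x0) e (t *: v + w)].
have line_cont (t : R) : {for t, continuous (fun t : R => t *: v + w : 'rV[R]_3)}.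
  by apply: continuousD; [exact: scalel_continuous|exact: cst_continuous].
have nearT (t : R) : T t -> \forall s \near t, T s.
  by move=> Tt; exact: (line_cont t _ (nbhs_open (open_cube e0) Tt)).
have T01 (t : R) : 0 <= t <= 1 -> T t.
  move=> /andP[t0 t1] j; rewrite [X in X - _](_ : _ =
    t * F (cmap c0 q') 0 j + (1 - t) * F (cmap c0 q) 0 j); last first.
    by rewrite lE vE /w; ring.
  rewrite [X in `|X|](_ : _ = t * (F (cmap c0 q') 0 j - F x0 0 j)
    + (1 - t) * (F (cmap c0 q) 0 j - F x0 0 j)); last by ring.
  exact: convex_norm_lt t0 t1 (q'e j) (qe j).
(* y is the curve straightened by F; 0 is a dummy value for t outside T *)
have /choice[y Hy] t : exists y, T t -> cube x0 d y /\ F y = t *: v + w.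
  have [Tt|nTt] := pselect (T t); last by exists 0.
  by have [z zd zE] := Fsurj _ Tt; exists z.
have yE (t : R) z : T t -> cube x0 d z -> F z = t *: v + w -> y t = z.
  move=> Tt zd zE; have [yd Fy] := Hy t Tt.
  have := Flip _ _ zd yd; rewrite Fy zE subrr normr0 mulr0 normr_le0 subr_eq0.
  by move/eqP.
pose g t := cinv c0 (y t).
have gE (t : R) : T t -> [/\ Om (g t), cmap c0 (g t) = y t, X (g t) = X q & Y (g t) = Y q].
  move=> Tt; have [yd Fy] := Hy t Tt.
  have [Omg gy] := back (y t) yd (eq_ind_r (cube (F x0) e) Tt Fy).
  split=> //.
    by rewrite /g -FX Fy lE v_on ?mulr0 ?add0r ?FXp //; left.
  by rewrite /g -FY Fy lE v_on ?mulr0 ?add0r ?FYp //; right.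
have T0 : T 0 by apply: T01; rewrite lexx ler01.
have T1 : T 1 by apply: T01; rewrite lexx ler01.
exists g; split.
- by rewrite /g (yE 0 (cmap c0 q)) ?(cmapK cq) // scale0r add0r.
- by rewrite /g (yE 1 (cmap c0 q')) ?(cmapK cq') // scale1r /v subrK.
move=> t t01; have Tt := T01 t t01; have [Omg gy Xg Yg] := gE t Tt.
have [Ug c0g Og] := Omg.
have CFd j : Ck 1 (cube x0 d) (fun x => F x 0 j) by exact: Ck_sub dW (CF j).
have Dy : is_derive t 1 y (v *m invmx (Jacobian F (y t))).
  apply: (inverse_curve_derive (w := w) (open_cube d0) CFd L0 Flip).
  by apply: filterS (nearT t Tt) => s Ts; exact: Hy.
have gc : {for t, continuous g}.
  apply: continuous_comp.
    by apply: differentiable_continuous; apply/derivable1_diffP; case: Dy.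
  by rewrite -gy; exact: cinv_continuous.
split=> //; first by split=> //=; rewrite Xg Yg.
move=> c ac cg x.
have oV : open (cmap c0 @` (cdom c0 `&` cdom c)).
  by rewrite setIC; apply: open_chart_image; exact: cdom_open.
have Vy : (cmap c0 @` (cdom c0 `&` cdom c)) (y t) by exists (g t).
have Dx := is_derive_row (fun i => chain_curve oV
  (smooth_on_Ck 1 (atlas_compatible ac0 ac i)) Vy Dy).
set u := \row_i _ in Dx.
have xE : x = (fun s => cmap c (cinv c0 (y s))) by [].
have dx : derivable x t 1.
  by rewrite xE; case: Dx.
have x'E : derive1 x t = u by rewrite derive1E xE derive_val.
have H (f a b : M -> R) : msmooth_on U f -> (forall p i, cdom c p -> U p ->
      is_derive (cmap c p) (delta_mx 0 i : 'rV[R]_3) (f \o cinv c)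
        (a p * a1 c p 0 i + b p * a2 c p 0 i)) ->
    (forall s, T s -> f (g s) = f q) ->
    a (g t) * (a1 c (g t) *m u^T) 0 0 + b (g t) * (a2 c (g t) *m u^T) 0 0 = 0.
  move=> sf df fg.
  have Df := is_derive_on_curve oU (smooth_on_Ck 1 (sf c ac)) Ug cg gc Dx.
  have Df0 : is_derive t 1 (fun s => f (g s)) 0.
    apply: near_eq_is_derive (is_derive_cst (f q) t 1).
    by apply: filterS (nearT t Tt) => s Ts; rewrite fg.
  rewrite -pairingE -[RHS](@derive_val _ _ _ _ _ _ _ Df0) (@derive_val _ _ _ _ _ _ _ Df).
  by apply: eq_bigr => i _; rewrite (cpartial_pair (df _ i cg Ug)).
have HX := H X A B sX (fun p i cp => dX i ac cp) (fun s Ts => let: And4 _ _ E _ := gE s Ts in E).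
have HY := H Y D E sY (fun p i cp => dY i ac cp) (fun s Ts => let: And4 _ _ _ E := gE s Ts in E).
have [z1 z2] := det_solve (det0 Ug) HX HY.
rewrite x'E; split; first exact: dx.
- by apply/matrixP => i j; rewrite (ord1 i) (ord1 j) [RHS]mxE; exact: z1.
- by apply/matrixP => i j; rewrite (ord1 i) (ord1 j) [RHS]mxE; exact: z2.
Qed.

End FlowBox.

(** * Pointwise derivation rules *)

Section DerivativeRules.
Context {R : realType} {V : normedModType R}.
Implicit Types (f g : V -> R) (x v : V) (a b : R).

(** Derivation rules for pointwise expressions, with products in place of
    scaling: the derivative of a compound expression comes out as an expression
    to be simplified by [ring]. *)
Lemma derive_rule_add f g x v a b : is_derive x v f a -> is_derive x v g b ->
  is_derive x v (fun y => f y + g y) (a + b).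
Proof. exact: is_deriveD. Qed.

Lemma derive_rule_sub f g x v a b : is_derive x v f a -> is_derive x v g b ->
  is_derive x v (fun y => f y - g y) (a - b).
Proof. exact: is_deriveB. Qed.

Lemma derive_rule_mul f g x v a b : is_derive x v f a -> is_derive x v g b ->
  is_derive x v (fun y => f y * g y) (f x * b + g x * a).
Proof. exact: is_deriveM. Qed.

Lemma derive_rule_cst (k : R) x v : is_derive x v (fun=> k) 0.
Proof. exact: is_derive_cst. Qed.

Lemma derive_rule_inv f x v a : is_derive x v f a -> f x != 0 ->
  is_derive x v (fun y => (f y)^-1) (- (f x ^- 2) * a).
Proof.
move=> Df f0; have DV := is_deriveV (f0 : id (f x) != 0) (is_derive_id (f x) 1).
apply: is_derive_eq (derive_rule_comp Df DV) _.
by rewrite [_ *: _]mulr1.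
Qed.

End DerivativeRules.

(** * The rotated gradient *)

Section PolarAlgebra.
Context {R : realType}.
Variables (cs sn k1 k2 k n dn m : R).
Hypothesis circ : cs ^+ 2 + sn ^+ 2 = 1.

(** [(rotX, - rotY)] is the gradient [(k1, k2)] turned back by the angle with
    cosine [cs] and sine [sn], which compensates its rotation along the
    leaves. *)
Definition rotX : R := k1 * cs + k2 * sn.
Definition rotY : R := k1 * sn - k2 * cs.
(** With [d chi = a3 + m (k1 a2 - k2 a1)] and [dn] the derivative of the factor
    [n] with respect to [K0 - K], the differentials of [n rotX] and [n rotY] are
    [coefX1 a1 + coefX2 a2] and [coefY1 a1 + coefY2 a2]: the terms in [a3]
    cancel. *)
Definition coefX1 : R :=
  n * (cs * (1 - k - k1 ^+ 2) - sn * (k1 * k2) + rotY * m * k2) - dn * rotX * k1.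
Definition coefX2 : R :=
  n * (sn * (1 - k - k2 ^+ 2) - cs * (k1 * k2) - rotY * m * k1) - dn * rotX * k2.
Definition coefY1 : R :=
  n * (sn * (1 - k - k1 ^+ 2) + cs * (k1 * k2) - rotX * m * k2) - dn * rotY * k1.
Definition coefY2 : R :=
  n * (- (cs * (1 - k - k2 ^+ 2)) - sn * (k1 * k2) + rotX * m * k1) - dn * rotY * k2.

Lemma rot_sqr : rotX ^+ 2 + rotY ^+ 2 = k1 ^+ 2 + k2 ^+ 2.
Proof.
rewrite -[RHS]mulr1 -circ /rotX /rotY; ring.
Qed.

Lemma rot_back : rotX * cs + rotY * sn = k1 /\ rotX * sn - rotY * cs = k2.
Proof.
rewrite -[X in _ = X /\ _]mulr1 -[X in _ /\ _ = X]mulr1 -circ /rotX /rotY.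
by split; ring.
Qed.

(** Half of the differential of [X^2 + Y^2 = 4 u] is [- 2 dK]; the hypothesis on
    [n] is half of the derivative of [n^2 S = 4 u] with respect to [u]. *)
Lemma polar_radial : dn * n * (k1 ^+ 2 + k2 ^+ 2) + n ^+ 2 * (k1 ^+ 2 + k2 ^+ 2 + k - 1) = 2 ->
  n * rotX * coefX1 + n * rotY * coefY1 = - 2 * k1 /\
  n * rotX * coefX2 + n * rotY * coefY2 = - 2 * k2.
Proof.
move=> <-; have [E1 E2] := rot_back; have E := rot_sqr.
split.
  transitivity (n ^+ 2 * ((rotX * cs + rotY * sn) * (1 - k - k1 ^+ 2)
      - (rotX * sn - rotY * cs) * (k1 * k2)) - dn * n * (rotX ^+ 2 + rotY ^+ 2) * k1).
    by rewrite /coefX1 /coefY1; ring.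
  by rewrite E1 E2 E; ring.
transitivity (n ^+ 2 * ((rotX * sn - rotY * cs) * (1 - k - k2 ^+ 2)
    - (rotX * cs + rotY * sn) * (k1 * k2)) - dn * n * (rotX ^+ 2 + rotY ^+ 2) * k2).
  by rewrite /coefX2 /coefY2; ring.
by rewrite E1 E2 E; ring.
Qed.

(** [X dY - Y dX] is a multiple of [k1 a2 - k2 a1]. *)
Lemma polar_angular : let l := (k1 ^+ 2 + k2 ^+ 2) * m - (1 - k) in
  n * rotX * coefY1 - n * rotY * coefX1 = - k2 * (n ^+ 2 * l) /\
  n * rotX * coefY2 - n * rotY * coefX2 = k1 * (n ^+ 2 * l).
Proof.
have [E1 E2] := rot_back; have E := rot_sqr.
split.
  transitivity (n ^+ 2 * ((rotX * sn - rotY * cs) * (1 - k - k1 ^+ 2)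
     + (rotX * cs + rotY * sn) * (k1 * k2) - (rotX ^+ 2 + rotY ^+ 2) * m * k2)).
    by rewrite /coefX1 /coefY1; ring.
  by rewrite E1 E2 E; ring.
transitivity (n ^+ 2 * (- (rotX * cs + rotY * sn) * (1 - k - k2 ^+ 2)
     - (rotX * sn - rotY * cs) * (k1 * k2) + (rotX ^+ 2 + rotY ^+ 2) * m * k1)).
  by rewrite /coefX2 /coefY2; ring.
by rewrite E1 E2 E; ring.
Qed.

(** [polar_radial] and [polar_angular] give the determinant times [X^2 + Y^2],
    which says nothing where the gradient vanishes. *)
Lemma polar_centre : k1 = 0 -> k2 = 0 ->
  coefX1 * coefY2 - coefX2 * coefY1 = - (n ^+ 2 * (1 - k) ^+ 2).
Proof.
move=> k10 k20; transitivity (- (n ^+ 2 * (1 - k) ^+ 2) * (cs ^+ 2 + sn ^+ 2)).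
  by rewrite /coefX1 /coefX2 /coefY1 /coefY2 /rotX /rotY k10 k20; ring.
by rewrite circ mulr1.
Qed.

End PolarAlgebra.

(** * Structures with the prescribed second derivatives of the curvature *)

Section CartanGeometry.
Context {R : realType} {M : manifold R 3}.
Variables (K : M -> R) (a1 a2 a3 : covector_field M).
Variables (K1 K2 K3 K11 K12 K13 K21 K22 K23 : M -> R).
Hypothesis HC : Cartan_structure K a1 a2 a3.
Hypothesis HK : coframe_derivatives a1 a2 a3 K K1 K2 K3.
Hypothesis HK1 : coframe_derivatives a1 a2 a3 K1 K11 K12 K13.
Hypothesis HK2 : coframe_derivatives a1 a2 a3 K2 K21 K22 K23.
Hypothesis H3 : forall p, K3 p = 0.
Hypothesis H11 : forall p, K11 p = 1 - K p - K1 p ^+ 2.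
Hypothesis H12 : forall p, K12 p = - (K1 p * K2 p).
Hypothesis H21 : forall p, K21 p = - (K1 p * K2 p).
Hypothesis H22 : forall p, K22 p = 1 - K p - K2 p ^+ 2.
Implicit Types (c : chart R 3 M) (p q : M) (i j : 'I_3).

Notation pd c i f p a := (is_derive (cmap c p) (delta_mx 0 i : 'rV[R]_3) (f \o cinv c) a).

Let Hcof : coframing a1 a2 a3. Proof. by case: HC. Qed.

Lemma coframe_free c p (x y z : R) : atlas c -> cdom c p ->
  x *: a1 c p + y *: a2 c p + z *: a3 c p = 0 -> [/\ x = 0, y = 0 & z = 0].
Proof.
move=> ac cp; have [e1 [e2 [e3 H]]] := dual_frame Hcof ac cp.
by have := H x y z => /= + w0; rewrite w0 !mul0mx !mxE => -[].
Qed.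

Lemma smooth_pd f c p i : msmooth_on setT f -> atlas c -> cdom c p ->
  pd c i f p (cpartial c i f p).
Proof.
move=> sf ac cp; apply: smooth_on_is_derive (sf c ac) _.
exact: mem_chart_image.
Qed.

Lemma coframe_pd f f1 f2 f3 c p i : msmooth_on setT f ->
  coframe_derivatives a1 a2 a3 f f1 f2 f3 -> atlas c -> cdom c p ->
  pd c i f p (f1 p * a1 c p 0 i + f2 p * a2 c p 0 i + f3 p * a3 c p 0 i).
Proof.
move=> sf Hf ac cp; have := smooth_pd i sf ac cp.
by have /rowP/(_ i) := Hf c p ac cp I; rewrite !mxE => ->.
Qed.

Let sK : msmooth_on setT K. Proof. by case: HC. Qed.

Let sK1 : msmooth_on setT K1.
Proof. by have [] := smooth_coframe_derivatives Hcof sK HK. Qed.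

Let sK2 : msmooth_on setT K2.
Proof. by have [] := smooth_coframe_derivatives Hcof sK HK. Qed.

Lemma curvature_pd c p i : atlas c -> cdom c p ->
  pd c i K p (K1 p * a1 c p 0 i + K2 p * a2 c p 0 i).
Proof.
by move=> ac cp; have := coframe_pd i sK HK ac cp; rewrite H3 mul0r addr0.
Qed.

Lemma one_form_pd a c p i j : one_form a -> atlas c -> cdom c p ->
  pd c i (fun q => a c q 0 j) p (cpartial c i (fun q => a c q 0 j) p).
Proof.
move=> [sa _] ac cp; apply: smooth_on_is_derive (sa c ac j c ac) _.
exact: mem_chart_image.
Qed.

Let fa1 : one_form a1. Proof. by case: Hcof. Qed.
Let fa2 : one_form a2. Proof. by case: Hcof. Qed.
Let fa3 : one_form a3. Proof. by case: Hcof. Qed.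

Lemma structure_equations c p i j : atlas c -> cdom c p ->
  let d (a : covector_field M) := cpartial c i (fun q => a c q 0 j) p
    - cpartial c j (fun q => a c q 0 i) p in
  let w (a b : covector_field M) := a c p 0 i * b c p 0 j - a c p 0 j * b c p 0 i in
  [/\ d a1 = w a2 a3, d a2 = - w a1 a3 & d a3 = K p * w a1 a2].
Proof.
move=> ac cp d w; have [_ _ H] := HC.
have [/matrixP/(_ i j) E1 /matrixP/(_ i j) E2 /matrixP/(_ i j) E3] := H c p ac cp I.
by move: E1 E2 E3; rewrite !mxE.
Qed.

(** This is [d(dK) = 0]: by the structure equations the terms of [d(dK)] in
    [a2 /\ a3] and [a1 /\ a3] are [K1 - K23] and [- (K2 + K13)], and the term in
    [a1 /\ a2] is [K21 - K12 = 0]. *)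
Lemma curvature_second_derivatives p : K13 p = - K2 p /\ K23 p = K1 p.
Proof.
have [c ac cp] := atlas_cover p.
have oW := open_chart_image (c := c) openT.
have Wp : chart_image c setT (cmap c p) by exact: mem_chart_image.
have D i j : partial i (partial j (K \o cinv c)) (cmap c p) =
    K1 p * cpartial c i (fun q => a1 c q 0 j) p
    + a1 c p 0 j * (K11 p * a1 c p 0 i + K12 p * a2 c p 0 i + K13 p * a3 c p 0 i)
    + (K2 p * cpartial c i (fun q => a2 c q 0 j) p
    + a2 c p 0 j * (K21 p * a1 c p 0 i + K22 p * a2 c p 0 i + K23 p * a3 c p 0 i)).
  have := derive_rule_add
    (derive_rule_mul (coframe_pd i sK1 HK1 ac cp) (one_form_pd i j fa1 ac cp))
    (derive_rule_mul (coframe_pd i sK2 HK2 ac cp) (one_form_pd i j fa2 ac cp)).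
  rewrite /= (cmapK cp) => Dk.
  rewrite [LHS]/partial -(@derive_val _ _ _ _ _ _ _ Dk).
  apply: near_eq_derive; apply: filterS (nbhs_open oW Wp) => x [q [_ cq] <-].
  by rewrite /partial; have Dq := curvature_pd j ac cq; rewrite derive_val /= (cmapK cq).
have T i j : (K1 p - K23 p) * (a2 c p 0 i * a3 c p 0 j - a2 c p 0 j * a3 c p 0 i)
    - (K13 p + K2 p) * (a1 c p 0 i * a3 c p 0 j - a1 c p 0 j * a3 c p 0 i) = 0.
  have := partialC i j oW (smooth_on_Ck 2 (sK ac)) Wp.
  have [E1 E2 _] := structure_equations i j ac cp.
  rewrite !D H12 H21 => E; move: E1 E2.
  move/(congr1 (fun z => K1 p * z)) => E1 /(congr1 (fun z => K2 p * z)) E2.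
  by move: E E1 E2; lra.
have T3 i : (K1 p - K23 p) * a2 c p 0 i - (K13 p + K2 p) * a1 c p 0 i = 0.
  have := @coframe_free c p ((K13 p + K2 p) * a3 c p 0 i) (- (K1 p - K23 p) * a3 c p 0 i)
    ((K1 p - K23 p) * a2 c p 0 i - (K13 p + K2 p) * a1 c p 0 i) ac cp.
  move=> []//; apply/rowP => j; rewrite !mxE; have := T i j; lra.
have [] // := @coframe_free c p (- (K13 p + K2 p)) (K1 p - K23 p) 0 ac cp.
  by apply/rowP => i; rewrite !mxE; have := T3 i; lra.
by move=> h1 h2 _; split; lra.
Qed.

Lemma K1_pd c p i : atlas c -> cdom c p ->
  pd c i K1 p ((1 - K p - K1 p ^+ 2) * a1 c p 0 i - K1 p * K2 p * a2 c p 0 i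
               - K2 p * a3 c p 0 i).
Proof.
move=> ac cp; have := coframe_pd i sK1 HK1 ac cp.
have [-> _] := curvature_second_derivatives p.
by rewrite H11 H12 !mulNr.
Qed.

Lemma K2_pd c p i : atlas c -> cdom c p ->
  pd c i K2 p (- (K1 p * K2 p * a1 c p 0 i) + (1 - K p - K2 p ^+ 2) * a2 c p 0 i
               + K1 p * a3 c p 0 i).
Proof.
move=> ac cp; have := coframe_pd i sK2 HK2 ac cp.
have [_ ->] := curvature_second_derivatives p.
by rewrite H21 H22 !mulNr.
Qed.

Definition slope p : R := K1 p ^+ 2 + K2 p ^+ 2.

Definition first_integral p : R := (slope p + K p - 3 / 2) * expR (2 * K p).

Lemma slope_pd c p i : atlas c -> cdom c p ->
  pd c i slope p (2 * (1 - K p - slope p) * (K1 p * a1 c p 0 i + K2 p * a2 c p 0 i)).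
Proof.
move=> ac cp; have D1 := K1_pd i ac cp; have D2 := K2_pd i ac cp.
have := derive_rule_add (derive_rule_mul D1 D1) (derive_rule_mul D2 D2).
rewrite /= (cmapK cp) => D; apply: is_derive_eq D _.
by rewrite /slope; ring.
Qed.

(** With [dS = 2 (1 - K - S) dK], the differential is
    [e^(2 K) (2 (1 - K - S) + 1 + 2 (S + K - 3/2)) dK = 0]. *)
Lemma first_integral_pd c p i : atlas c -> cdom c p -> pd c i first_integral p 0.
Proof.
move=> ac cp; have DK := curvature_pd i ac cp.
have D1 := derive_rule_sub (derive_rule_add (slope_pd i ac cp) DK)
  (derive_rule_cst (3 / 2) (cmap c p) (delta_mx 0 i)).
have D2 := derive_rule_mul (derive_rule_cst 2 (cmap c p) (delta_mx 0 i)) DK.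
have D3 := derive_rule_comp D2 (is_derive_expR _).
have := derive_rule_mul D1 D3; rewrite /= (cmapK cp) => D.
by apply: is_derive_eq D _; field.
Qed.

Lemma first_integral_constant (C : set M) : open C -> connected C ->
  forall p q, C p -> C q -> first_integral q = first_integral p.
Proof.
move=> oC cC; apply: constant_of_null_differential => // [p|c p i]; last exact: first_integral_pd.
have cont f : msmooth_on setT f -> {for p, continuous f}.
  by move=> sf; apply: msmooth_continuous openT sf _.
have [k k1 k2] := And3 (cont _ sK) (cont _ sK1) (cont _ sK2).
apply: continuousM.
  apply: continuousB; last exact: cst_continuous.
  apply: continuousD => //; apply: continuousD; exact: continuousM.
apply: (continuous_comp (f := fun p => 2 * K p)); last exact: continuous_expR.
by apply: continuousM => //; exact: cst_continuous.
Qed.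

(** * Polar coordinates on the space of leaves *)

Section NormalForm.
Variables (K0 : R) (C : set M).
Hypothesis K0gt1 : 1 < K0.
Hypothesis oC : open C.
Hypothesis slopeE : forall p, C p -> slope p = (K0 - K p) * den K0 (K0 - K p).

(** The differential of the angle by which the gradient has to be turned back. *)
Definition angle_form : covector_field M := fun c p =>
  a3 c p + form_coeff K0 (K0 - K p) *: (K1 p *: a2 c p - K2 p *: a1 c p).

(** This part of [C] contains the leaves with [dK <> 0], where [S > 0], and the
    centres, as [den K0 0 = 2 (K0 - 1)]. *)
Definition regular : set M := C `&` [set p | 0 < den K0 (K0 - K p)].

Lemma open_regular : open regular.
Proof.
apply: openI => //; apply: open_pos => p.
apply: (@continuous_comp M R R (fun p => K0 - K p) (den K0) p).
  apply: continuousB; first exact: cst_continuous.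
  exact: msmooth_continuous openT sK I.
have [dD DD _] := den_derive K0 (K0 - K p).
by apply: differentiable_continuous; apply/derivable1_diffP.
Qed.

Let sub_chart f c U : atlas c -> msmooth_on setT f ->
  smooth_on (chart_image c U) (fun x => f (cinv c x)).
Proof. by move=> ac sf; apply: smooth_subset (sf c ac); exact: chart_image_sub. Qed.

Let depth_smooth c U : atlas c -> open U ->
  smooth_on (chart_image c U) (fun x => K0 - K (cinv c x)).
Proof.
move=> ac oU; have oW := open_chart_image (c := c) oU.
exact: (smooth_sub oW (smooth_cst K0 oW) (sub_chart ac sK)).
Qed.

Let den_pos c U x : U `<=` regular -> chart_image c U x -> 0 < den K0 (K0 - K (cinv c x)).
Proof. by move=> UR /chart_imageP[Ux _ _]; have [_] := UR _ Ux. Qed.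

Lemma angle_form_smooth c i : atlas c ->
  smooth_on (chart_image c regular) (fun x => angle_form c (cinv c x) 0 i).
Proof.
move=> ac; have oW := open_chart_image (c := c) open_regular.
have E x : chart_image c regular x -> a3 c (cinv c x) 0 i +
    form_coeff K0 (K0 - K (cinv c x)) *
      (K1 (cinv c x) * a2 c (cinv c x) 0 i - K2 (cinv c x) * a1 c (cinv c x) 0 i) =
    angle_form c (cinv c x) 0 i.
  by move=> _; rewrite /angle_form !mxE.
apply: (smooth_eq oW E); apply: (smooth_add oW (one_form_smooth i fa3 ac)).
apply: (smooth_mul oW).
  apply: (smooth_form_coeff oW _ (depth_smooth ac open_regular)) => x.
  exact: den_pos.
apply: (smooth_sub oW).
  exact: (smooth_mul oW (sub_chart ac sK1) (one_form_smooth i fa2 ac)).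
exact: (smooth_mul oW (sub_chart ac sK2) (one_form_smooth i fa1 ac)).
Qed.

Lemma angle_form_change c c0 p i : atlas c -> atlas c0 -> cdom c p -> cdom c0 p ->
  angle_form c p 0 i =
  \sum_j angle_form c0 p 0 j * cpartial c i (fun q => cmap c0 q 0 j) p.
Proof.
move=> ac ac0 cp c0p; have [[_ t1] [_ t2] [_ t3]] := And3 fa1 fa2 fa3.
rewrite /angle_form !mxE (t1 c c0) // (t2 c c0) // (t3 c c0) //.
rewrite !mulr_sumr -sumrB mulr_sumr -big_split /=.
by apply: eq_bigr => j _; rewrite !mxE; ring.
Qed.

(** The exterior derivative is
    [(K + m (2 - 2 K - S) - S m') a1 /\ a2], so the equation for [m] in
    [form_coeff_ode] makes it vanish. *)
Lemma angle_form_closed c p i j : atlas c -> cdom c p -> regular p ->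
  cpartial c i (fun q => angle_form c q 0 j) p = cpartial c j (fun q => angle_form c q 0 i) p.
Proof.
move=> ac cp [Cp dp].
have [dm Dm SE] := form_coeff_ode (slopeE Cp) dp.
pose v k l := cpartial c k (fun q => a3 c q 0 l) p +
  (form_coeff K0 (K0 - K p) * (
     (K1 p * cpartial c k (fun q => a2 c q 0 l) p + a2 c p 0 l *
       ((1 - K p - K1 p ^+ 2) * a1 c p 0 k - K1 p * K2 p * a2 c p 0 k - K2 p * a3 c p 0 k))
   - (K2 p * cpartial c k (fun q => a1 c q 0 l) p + a1 c p 0 l *
       (- (K1 p * K2 p * a1 c p 0 k) + (1 - K p - K2 p ^+ 2) * a2 c p 0 k
               + K1 p * a3 c p 0 k)))
   + (K1 p * a2 c p 0 l - K2 p * a1 c p 0 l) *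
       (dm * (0 - (K1 p * a1 c p 0 k + K2 p * a2 c p 0 k)))).
have D k l : cpartial c k (fun q => angle_form c q 0 l) p = v k l.
  have Du := derive_rule_sub (derive_rule_cst K0 (cmap c p) (delta_mx 0 k))
    (curvature_pd k ac cp).
  have Dm' : is_derive ((fun y => K0 - (K \o cinv c) y) (cmap c p)) 1 (form_coeff K0) dm.
    by rewrite /= (cmapK cp).
  have := derive_rule_add (one_form_pd k l fa3 ac cp)
    (derive_rule_mul (derive_rule_comp Du Dm')
      (derive_rule_sub (derive_rule_mul (K1_pd k ac cp) (one_form_pd k l fa2 ac cp))
                       (derive_rule_mul (K2_pd k ac cp) (one_form_pd k l fa1 ac cp)))).
  rewrite /= (cmapK cp) => Dv.
  rewrite /cpartial /partial.
  rewrite [X in derive X](_ : _ = (fun y : 'rV[R]_3 => a3 c (cinv c y) 0 l +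
    form_coeff K0 (K0 - K (cinv c y)) *
      (K1 (cinv c y) * a2 c (cinv c y) 0 l - K2 (cinv c y) * a1 c (cinv c y) 0 l))).
    by rewrite (@derive_val _ _ _ _ _ _ _ Dv).
  by apply/funext => y; rewrite /= /angle_form !mxE.
have [E1 E2 E3] := structure_equations i j ac cp.
rewrite !D; apply: subr0_eq.
have E : v i j - v j i = (a1 c p 0 i * a2 c p 0 j - a1 c p 0 j * a2 c p 0 i) *
    (K p + form_coeff K0 (K0 - K p) * (2 - 2 * K p - slope p) - slope p * dm).
  have subE (x y z : R) : x - y = z -> x = y + z by move=> <-; rewrite addrC subrK.
  by rewrite /v (subE _ _ _ E1) (subE _ _ _ E2) (subE _ _ _ E3) /slope; ring.
by rewrite E SE subrr mulr0.
Qed.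

Lemma exists_angle p0 : regular p0 -> exists (U : set M) (chi : M -> R),
  [/\ open U, U p0, U `<=` regular, msmooth_on U chi &
    forall c p i, atlas c -> cdom c p -> U p -> pd c i chi p (angle_form c p 0 i)].
Proof.
move=> Rp0; have [c0 ac0 c0p0] := atlas_cover p0.
have oW := open_chart_image (c := c0) open_regular.
pose b i (x : 'rV[R]_3) := angle_form c0 (cinv c0 x) 0 i.
have Cb i k : Ck k (chart_image c0 regular) (b i).
  exact: smooth_on_Ck (angle_form_smooth i ac0).
have [|f [d d0 [dW Df]]] := poincare oW (mem_chart_image Rp0 c0p0) (Cb ^~ 1%N).
  by move=> _ i j [p [Rp cp] <-]; exact: angle_form_closed i j ac0 cp Rp.
pose U := [set p | [/\ regular p, cdom c0 p & cube (cmap c0 p0) d (cmap c0 p)]].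
have oU : open U by exact: open_chart_preimage open_regular (open_cube d0).
have Uc0 : U `<=` cdom c0 by move=> p [].
have cubeU x : chart_image c0 U x -> cube (cmap c0 p0) d x by move=> [p [[_ _ h] _] <-].
have oV := open_chart_image (c := c0) oU.
pose chi := f \o cmap c0.
have chiE x : chart_image c0 U x -> f x = (chi \o cinv c0) x.
  by move=> [p [_ cp] <-]; rewrite /chi /= (cmapK cp).
have VW : chart_image c0 U `<=` chart_image c0 regular.
  by apply: chart_image_sub => p [].
have Cchi : Ck 1 (chart_image c0 U) (chi \o cinv c0).
  apply: (Ck_eq oV chiE); apply: (Ck_step (df := b)) => //.
  - move=> x Vx; apply: (continuous_of_partials oV Vx (b := b)).
      by move=> y i /cubeU; exact: Df.
    by move=> i; apply: Ck_continuous (Cb i 0%N) _; exact: VW.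
  - by move=> x i /cubeU; exact: Df.
  - by move=> i; apply: Ck_sub VW (Cb i 0%N).
have [|||schi dchi] := smooth_of_differential (b := angle_form) ac0 oU Uc0 _ _ Cchi.
- move=> c ac i; apply: smooth_subset (angle_form_smooth i ac).
  by apply: chart_image_sub => p [].
- by move=> c p ac cp Up i; apply: angle_form_change => //; exact: Uc0.
- move=> p Up j; rewrite /cpartial /partial.
  have Vp := mem_chart_image Up (Uc0 _ Up).
  have D : is_derive (cmap c0 p) (delta_mx 0 j : 'rV[R]_3) (chi \o cinv c0) (b j (cmap c0 p)).
    apply: near_eq_is_derive (Df _ j (cubeU _ Vp)).
    by apply: filterS (nbhs_open oV Vp) => x; exact: chiE.
  by rewrite derive_val /b (cmapK (Uc0 _ Up)).
exists U, chi; split=> //; first by split=> //; exact: cube_center.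
by move=> p [].
Qed.

(** [X dY - Y dX] divided by [K1 a2 - K2 a1]. *)
Definition angular_factor p : R :=
  scale K0 (K0 - K p) ^+ 2 * ((K0 - 1) * expR (K0 - K p)).

(** [X] and [Y] are, up to a sign, the rescaled components of the gradient
    turned back by the angle [chi].  Their differentials are independent also where the gradient
    vanishes, so they serve as coordinates near the centre as well. *)
Lemma polar_coordinates p0 : regular p0 ->
  exists (U : set M) (X Y A B D E : M -> R),
  [/\ open U, U p0, U `<=` regular, msmooth_on U X /\ msmooth_on U Y &
    forall p, U p ->
    [/\ forall c i, atlas c -> cdom c p ->
          pd c i X p (A p * a1 c p 0 i + B p * a2 c p 0 i) /\
          pd c i Y p (D p * a1 c p 0 i + E p * a2 c p 0 i),
        X p ^+ 2 + Y p ^+ 2 = 4 * (K0 - K p),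
        X p * A p + Y p * D p = - 2 * K1 p /\ X p * B p + Y p * E p = - 2 * K2 p,
        X p * D p - Y p * A p = - K2 p * angular_factor p /\
        X p * E p - Y p * B p = K1 p * angular_factor p &
        A p * E p - B p * D p != 0]].
Proof.
move=> Rp0; have [U [chi [oU Up0 UR schi dchi]]] := exists_angle Rp0.
pose cs p := cos (chi p); pose sn p := sin (chi p).
have circ p : cs p ^+ 2 + sn p ^+ 2 = 1 by exact: cos2Dsin2.
pose n p := scale K0 (K0 - K p); pose m p := form_coeff K0 (K0 - K p).
pose X p := n p * rotX (cs p) (sn p) (K1 p) (K2 p).
pose Y p := n p * rotY (cs p) (sn p) (K1 p) (K2 p).
have /choice[dn Hdn] p : exists dn : R, U p ->
    is_derive (K0 - K p) 1 (scale K0) dn /\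
    dn * n p * slope p + n p ^+ 2 * (slope p + K p - 1) = 2.
  have [Up|nUp] := pselect (U p); last by exists 0.
  have [Cp dp] := UR p Up; have [dn Dn En] := scale_derive dp.
  exists dn => _; split=> //; rewrite (slopeE Cp) -En.
  have := den_mul K0 (K0 - K p); rewrite -(slopeE Cp) => SE.
  congr (_ + _ * _); rewrite (slopeE Cp) in SE *.
  by move: SE; set e := expR _; set P := _ * _; lra.
exists U, X, Y.
exists (fun p => coefX1 (cs p) (sn p) (K1 p) (K2 p) (K p) (n p) (dn p) (m p)).
exists (fun p => coefX2 (cs p) (sn p) (K1 p) (K2 p) (K p) (n p) (dn p) (m p)).
exists (fun p => coefY1 (cs p) (sn p) (K1 p) (K2 p) (K p) (n p) (dn p) (m p)).
exists (fun p => coefY2 (cs p) (sn p) (K1 p) (K2 p) (K p) (n p) (dn p) (m p)).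
have [scos ssin] := @smooth1_trigo R.
split; [by []|by []|by []| |].
  split=> c ac; have oW := open_chart_image (c := c) oU;
    have sn' := smooth_scale oW (fun x => den_pos UR) (depth_smooth ac oU);
    have s1 := sub_chart (U := U) ac sK1; have s2 := sub_chart (U := U) ac sK2;
    have sc := smooth_comp1 oW scos (fun _ _ => I) (schi c ac);
    have ss := smooth_comp1 oW ssin (fun _ _ => I) (schi c ac).
    exact: (smooth_mul oW sn' (smooth_add oW (smooth_mul oW s1 sc) (smooth_mul oW s2 ss))).
  exact: (smooth_mul oW sn' (smooth_sub oW (smooth_mul oW s1 ss) (smooth_mul oW s2 sc))).
move=> p Up; have [Cp dp] := UR p Up; have [Dn En] := Hdn p Up.
have SE := slopeE Cp.
have XY : X p ^+ 2 + Y p ^+ 2 = 4 * (K0 - K p).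
  transitivity (n p ^+ 2 * (rotX (cs p) (sn p) (K1 p) (K2 p) ^+ 2
      + rotY (cs p) (sn p) (K1 p) (K2 p) ^+ 2)); first by rewrite /X /Y; ring.
  by rewrite rot_sqr // -/(slope p) SE -(scale_sqr dp) -/(n p); ring.
have lE : (K1 p ^+ 2 + K2 p ^+ 2) * m p - (1 - K p) = (K0 - 1) * expR (K0 - K p).
  rewrite -/(slope p) SE /m (form_coeff_mul (lt0r_neq0 dp)); ring.
have [ang1 ang2] := polar_angular (K1 p) (K2 p) (K p) (n p) (dn p) (m p) (circ p).
have rad := polar_radial (m p) (circ p) En.
rewrite lE in ang1 ang2.
split=> //.
- move=> c i ac cp.
  have Dchi := dchi c p i ac cp Up.
  have Dc := derive_rule_comp Dchi (is_derive_cos _).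
  have Ds := derive_rule_comp Dchi (is_derive_sin _).
  have Dn' : is_derive ((fun y => K0 - (K \o cinv c) y) (cmap c p)) 1 (scale K0) (dn p).
    by rewrite /= (cmapK cp).
  have Du := derive_rule_sub (derive_rule_cst K0 (cmap c p) (delta_mx 0 i))
    (curvature_pd i ac cp).
  have DN := derive_rule_comp Du Dn'.
  have D1 := K1_pd i ac cp; have D2 := K2_pd i ac cp.
  have DX := derive_rule_mul DN
    (derive_rule_add (derive_rule_mul D1 Dc) (derive_rule_mul D2 Ds)).
  have DY := derive_rule_mul DN
    (derive_rule_sub (derive_rule_mul D1 Ds) (derive_rule_mul D2 Dc)).
  rewrite /= (cmapK cp) in DX DY.
  split; [apply: is_derive_eq DX _|apply: is_derive_eq DY _];
    rewrite /angle_form !mxE -/(n p) -/(m p) -/(cs p) -/(sn p).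
    by rewrite /coefX1 /coefX2 /rotX /rotY; ring.
  by rewrite /coefY1 /coefY2 /rotX /rotY; ring.
- have [u0|uN0] := eqVneq (K0 - K p) 0.
    have S0 : K1 p ^+ 2 + K2 p ^+ 2 = 0 by rewrite -/(slope p) SE u0 mul0r.
    move/eqP: S0; rewrite paddr_eq0 ?sqr_ge0 // !sqrf_eq0 => /andP[/eqP k1 /eqP k2].
    rewrite polar_centre // oppr_eq0; apply: mulf_neq0; rewrite sqrf_eq0.
      by rewrite gt_eqF // scale_gt0.
    by rewrite lt_eqF //; move: u0 K0gt1; lra.
  apply/eqP => det0; have [rad1 rad2] := rad.
  have det (x y A B D E : R) : (x * A + y * D) * (x * E - y * B)
      - (x * B + y * E) * (x * D - y * A) = (x ^+ 2 + y ^+ 2) * (A * E - B * D) by ring.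
  have := det (X p) (Y p) (coefX1 (cs p) (sn p) (K1 p) (K2 p) (K p) (n p) (dn p) (m p))
    (coefX2 (cs p) (sn p) (K1 p) (K2 p) (K p) (n p) (dn p) (m p))
    (coefY1 (cs p) (sn p) (K1 p) (K2 p) (K p) (n p) (dn p) (m p))
    (coefY2 (cs p) (sn p) (K1 p) (K2 p) (K p) (n p) (dn p) (m p)).
  rewrite det0 mulr0 rad1 rad2 ang1 ang2.
  set f := n p ^+ 2 * _ => E0.
  have f0 : f != 0.
    apply: lt0r_neq0; apply: mulr_gt0; first by rewrite exprn_gt0 // scale_gt0.
    by rewrite mulr_gt0 ?expR_gt0 // subr_gt0.
  have : slope p * f = 0 by move: E0; rewrite /slope; lra.
  by apply/eqP; rewrite mulf_neq0 // SE mulf_neq0 // gt_eqF.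
Qed.

Definition radius p : R := 2 * Num.sqrt (K0 - K p).

Definition angle (X Y : M -> R) p : R * R := (X p / radius p, Y p / radius p).

Lemma radius_sqr p : 0 <= K0 - K p -> radius p ^+ 2 = 4 * (K0 - K p).
Proof. by move=> u0; rewrite /radius exprMn sqr_sqrtr //; ring. Qed.

Lemma row_free2 (u v : 'rV[R]_3) :
  (forall x y : R, x *: u + y *: v = 0 -> x = 0 /\ y = 0) ->
  row_free (col_mx u v : 'M[R]_(1 + 1, 3)).
Proof.
move=> H; rewrite -kermx_eq0; apply/eqP/row_matrixP => i; rewrite row0.
set w := row i _; have : w *m col_mx u v = 0 by rewrite -row_mul mulmx_ker row0.
rewrite -[w]hsubmxK mul_row_col [lsubmx w]mx11_scalar [rsubmx w]mx11_scalar !mul_scalar_mx.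
by move=> /H[-> ->]; rewrite !raddf0 row_mx0.
Qed.

Lemma squareE (a : covector_field M) c p i j : square a c p i j = a c p 0 i * a c p 0 j.
Proof. by rewrite /square mxE big_ord1 mxE. Qed.

Section PolarChart.
Variables (V : set M) (X Y A B D E : M -> R).
Hypothesis oV : open V.
Hypothesis VR : V `<=` regular.
Hypothesis sX : msmooth_on V X.
Hypothesis sY : msmooth_on V Y.
Hypothesis HV : forall p, V p ->
  [/\ forall c i, atlas c -> cdom c p ->
        pd c i X p (A p * a1 c p 0 i + B p * a2 c p 0 i) /\
        pd c i Y p (D p * a1 c p 0 i + E p * a2 c p 0 i),
      X p ^+ 2 + Y p ^+ 2 = 4 * (K0 - K p),
      X p * A p + Y p * D p = - 2 * K1 p /\ X p * B p + Y p * E p = - 2 * K2 p,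
      X p * D p - Y p * A p = - K2 p * angular_factor p /\
      X p * E p - Y p * B p = K1 p * angular_factor p &
      A p * E p - B p * D p != 0].
Hypothesis Vpos : forall p, V p -> 0 < K0 - K p.
Hypothesis Vleaf : forall q q', V q -> V q' ->
  (same_leaf a1 a2 V q q' <-> X q = X q' /\ Y q = Y q').

Let radius_gt0 p : V p -> 0 < radius p.
Proof. by move=> Vp; rewrite mulr_gt0 // sqrtr_gt0 Vpos. Qed.

Let radius_sqrV p : V p -> radius p ^+ 2 = 4 * (K0 - K p).
Proof. by move=> Vp; rewrite radius_sqr // ltW // Vpos. Qed.

Let smooth_radius : msmooth_on V radius.
Proof.
move=> c ac; have oW := open_chart_image (c := c) oV.
apply: (smooth_mul oW (smooth_cst 2 oW) (smooth_sqrt oW _ (depth_smooth ac oV))).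
by move=> x /chart_imageP[Vx _ _]; exact: Vpos.
Qed.

Let smooth_over_radius f : msmooth_on V f -> msmooth_on V (fun p => f p / radius p).
Proof.
move=> sf c ac; have oW := open_chart_image (c := c) oV.
apply: (smooth_mul oW (sf c ac) (smooth_inv oW _ (smooth_radius ac))).
by move=> x /chart_imageP[Vx _ _]; rewrite gt_eqF // radius_gt0.
Qed.

Let radius_pd c p i : atlas c -> cdom c p -> V p ->
  pd c i radius p (- (Num.sqrt (K0 - K p))^-1 * (K1 p * a1 c p 0 i + K2 p * a2 c p 0 i)).
Proof.
move=> ac cp Vp; have u0 := Vpos Vp.
have Du := derive_rule_sub (derive_rule_cst K0 (cmap c p) (delta_mx 0 i))
  (curvature_pd i ac cp).
have Ds : is_derive ((fun y => K0 - (K \o cinv c) y) (cmap c p)) 1 Num.sqrt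
    (2 * Num.sqrt (K0 - K p))^-1.
  by rewrite /= (cmapK cp); exact: is_derive1_sqrt.
have := derive_rule_mul (derive_rule_cst 2 (cmap c p) (delta_mx 0 i)) (derive_rule_comp Du Ds).
move=> Dr; apply: is_derive_eq Dr _.
by field; rewrite gt_eqF // sqrtr_gt0.
Qed.

Let differential_radius c p : atlas c -> cdom c p -> V p ->
  differential radius c p =
  - (Num.sqrt (K0 - K p))^-1 *: (K1 p *: a1 c p + K2 p *: a2 c p).
Proof.
move=> ac cp Vp; apply/rowP => i; rewrite !mxE.
by have Dr := radius_pd i ac cp Vp; rewrite /cpartial /partial derive_val.
Qed.

Let dangleE c p : atlas c -> cdom c p -> V p ->
  dangle (angle X Y) c p =
  ((K0 - 1) * expR (K0 - K p) / slope p) *: (K1 p *: a2 c p - K2 p *: a1 c p).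
Proof.
move=> ac cp Vp; have [Hd XY _ [ang1 ang2] _] := HV Vp.
have r0 := radius_gt0 Vp.
have [Cp dp] := VR Vp; have u0 := Vpos Vp.
apply/rowP => i; rewrite !mxE.
have [DX DY] := Hd c i ac cp.
have r0' : radius (cinv c (cmap c p)) != 0 by rewrite (cmapK cp) gt_eqF.
have Dr := derive_rule_inv (radius_pd i ac cp Vp) r0'.
set dr := _ * _ in Dr.
have := derive_rule_mul DX Dr; have := derive_rule_mul DY Dr.
rewrite /= (cmapK cp) => DY' DX'.
rewrite /angle /= /cpartial /partial.
rewrite (@derive_val _ _ _ _ _ _ _ DX') (@derive_val _ _ _ _ _ _ _ DY').
transitivity (((X p * D p - Y p * A p) * a1 c p 0 i + (X p * E p - Y p * B p) * a2 c p 0 i)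
  / radius p ^+ 2); first by field; rewrite gt_eqF.
rewrite ang1 ang2 (radius_sqrV Vp) /angular_factor (slopeE Cp).
rewrite -(scale_sqr dp); field.
by rewrite !gt_eqF // scale_gt0.
Qed.

Let slope_gt0 p : V p -> 0 < slope p.
Proof.
by move=> Vp; have [Cp dp] := VR Vp; rewrite (slopeE Cp) mulr_gt0 // Vpos.
Qed.

(** Here [dr = - dK / sqrt u] and [dtheta = (X dY - Y dX) / r^2] are orthogonal
    nonzero combinations of [a1] and [a2]. *)
Lemma polar_leaf_coordinates : leaf_coordinates a1 a2 V (radii K0) radius (angle X Y).
Proof.
split; first exact: oV.
- by split; [exact: smooth_radius|exact: smooth_over_radius|exact: smooth_over_radius].
- move=> q Vq; have r0 := radius_gt0 Vq; have rs := radius_sqrV Vq.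
  have [Cq dq] := VR Vq; have [_ XY _ _ _] := HV Vq.
  split; first by split=> //; rewrite rs mulrC mulKf ?pnatr_eq0.
  rewrite /circle /= !expr_div_n -mulrDl XY rs divff //.
  by rewrite mulf_neq0 ?pnatr_eq0 // gt_eqF // Vpos.
- move=> c q ac cq Vq; rewrite differential_radius // dangleE //.
  apply: row_free2 => x y; have S0 := slope_gt0 Vq; have u0 := Vpos Vq.
  set s := (Num.sqrt _)^-1; set f := _ / slope q => H.
  have s0 : 0 < s by rewrite invr_gt0 sqrtr_gt0.
  have f0 : 0 < f by rewrite divr_gt0 // mulr_gt0 ?expR_gt0 // subr_gt0.
  have [] := @coframe_free c q (- s * K1 q * x + - (f * K2 q) * y)
    (- s * K2 q * x + f * K1 q * y) 0 ac cq.
    rewrite -[RHS]H; apply/rowP => i; rewrite !mxE; ring.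
  move=> e1 e2 _; apply: det_solve e1 e2.
  have -> : - s * K1 q * (f * K1 q) - - (f * K2 q) * (- s * K2 q) = - (s * f * slope q).
    by rewrite /slope; ring.
  rewrite oppr_eq0; apply: lt0r_neq0; apply: mulr_gt0 S0; exact: mulr_gt0.
- move=> q q' Vq Vq'; rewrite (Vleaf Vq Vq').
  have [_ XY _ _ _] := HV Vq; have [_ XY' _ _ _] := HV Vq'.
  split=> [[EX EY]|[Er [EX EY]]].
    have EK : K0 - K q = K0 - K q' by rewrite EX EY in XY; lra.
    have Er : radius q = radius q' by rewrite /radius EK.
    by rewrite /angle EX EY Er.
  have r0 := lt0r_neq0 (radius_gt0 Vq).
  split; apply: (mulIf (invr_neq0 r0)); first by rewrite EX Er.
  by rewrite EY Er.
Qed.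

(** As [eta^2 dr^2 = (K1 a1 + K2 a2)^2 / S] and
    [phi^2 dtheta^2 = (K1 a2 - K2 a1)^2 / S], the mixed terms cancel and the sum
    is [a1^2 + a2^2]. *)
Lemma polar_induced_metric :
  induced_metric a1 a2 V (eta K0) (phi K0) radius (angle X Y).
Proof.
move=> c q ac cq Vq; have S0 := slope_gt0 Vq; have u0 := Vpos Vq.
have [Cq dq] := VR Vq; have rs := radius_sqrV Vq.
have r4 : radius q ^+ 2 / 4 = K0 - K q by rewrite rs mulrC mulKf ?pnatr_eq0.
have r2 : radius q ^+ 2 / 2 = 2 * (K0 - K q) by rewrite rs; field.
have Phi2 : Phi K0 (radius q) ^+ 2 = expR (K0 - K q) ^- 2 * slope q.
  rewrite PhiE r4 r2 -(slopeE Cq) sqr_sqrtr ?mulr_ge0 ?expR_ge0 ?(ltW S0) //.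
  by rewrite expRN -expRM_natl.
have s2 : Num.sqrt (K0 - K q) ^+ 2 = K0 - K q by rewrite sqr_sqrtr // ltW.
have e0 : expR (K0 - K q) != 0 by rewrite gt_eqF ?expR_gt0.
have K00 : K0 - 1 != 0 by rewrite gt_eqF // subr_gt0.
have s0 : Num.sqrt (K0 - K q) != 0 by rewrite gt_eqF // sqrtr_gt0.
have eta2 : eta K0 (radius q) ^+ 2 = (K0 - K q) / slope q.
  rewrite /eta; move: (radius q) rs r4 Phi2 => r rs r4 Phi2 {r2}.
  rewrite r4 expr_div_n !exprMn Phi2 rs expRN.
  by field; rewrite e0 gt_eqF.
have phi2 : phi K0 (radius q) ^+ 2 = expR (K0 - K q) ^- 2 * slope q / (K0 - 1) ^+ 2.
  by rewrite /phi expr_div_n Phi2.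
apply/matrixP => i j.
have addE (N N' : 'M[R]_3) : (N + N') i j = N i j + N' i j by rewrite mxE.
have scaleE (x : R) (N : 'M[R]_3) : (x *: N) i j = x * N i j by rewrite mxE.
rewrite !addE !scaleE !squareE.
rewrite differential_radius // dangleE // eta2 phi2 !mxE -{1}s2.
transitivity ((K1 q ^+ 2 + K2 q ^+ 2) * (a1 c q 0 i * a1 c q 0 j + a2 c q 0 i * a2 c q 0 j)
  / slope q).
  by rewrite -/(slope q) mulrAC divff ?mul1r // gt_eqF.
by field; rewrite e0 K00 s0 gt_eqF.
Qed.

End PolarChart.

(** The neighbourhoods of the theorem are parts of one flow box: a part where
    [r > 0] near a leaf on which [dK] does not vanish, a disk and a punctured disk
    in the plane of [(X, Y)] near a centre. *)
Lemma polar_flow_box p0 : regular p0 ->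
  exists (Om : set M) (X Y : M -> R) (e : R),
  [/\ [/\ open Om, Om p0, Om `<=` regular & 0 < e],
    [/\ msmooth_on Om X, msmooth_on Om Y &
      forall p, Om p -> X p ^+ 2 + Y p ^+ 2 = 4 * (K0 - K p)],
    forall x y, `|x - X p0| < e -> `|y - Y p0| < e ->
      exists q, [/\ Om q, X q = x & Y q = y],
    forall P : R -> R -> Prop, let V := Om `&` [set p | P (X p) (Y p)] in
      forall q q', V q -> V q' ->
      (same_leaf a1 a2 V q q' <-> X q = X q' /\ Y q = Y q') &
    forall P : R -> R -> Prop, let V := Om `&` [set p | P (X p) (Y p)] in
      open V -> (forall p, V p -> 0 < K0 - K p) ->
      leaf_coordinates a1 a2 V (radii K0) radius (angle X Y) /\
      induced_metric a1 a2 V (eta K0) (phi K0) radius (angle X Y)].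
Proof.
move=> Rp0.
have [U [X [Y [A [B [D [E [oU Up0 UR [sX sY] HU]]]]]]]] := polar_coordinates Rp0.
have dX c p i : atlas c -> cdom c p -> U p ->
    pd c i X p (A p * a1 c p 0 i + B p * a2 c p 0 i).
  by move=> ac cp Up; have [H _ _ _ _] := HU p Up; have [] := H c i ac cp.
have dY c p i : atlas c -> cdom c p -> U p ->
    pd c i Y p (D p * a1 c p 0 i + E p * a2 c p 0 i).
  by move=> ac cp Up; have [H _ _ _ _] := HU p Up; have [] := H c i ac cp.
have det p : U p -> A p * E p - B p * D p != 0.
  by move=> Up; have [] := HU p Up.
have [Om [e [[oOm Omp0] OmU e0 Hsurj Hleaf]]] := flow_box Hcof oU sX sY dX dY det Up0.
have leafP (P : R -> R -> Prop) q q' : let V := Om `&` [set p | P (X p) (Y p)] in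
    V q -> V q' -> (same_leaf a1 a2 V q q' <-> X q = X q' /\ Y q = Y q').
  move=> V [Oq Pq] [Oq' _]; split; last by move=> [EX EY]; exact: Hleaf.
  by apply: (leaf_constant oU sX sY dX dY) => p [/OmU].
exists Om, X, Y, e; split.
- by split=> //; exact: subset_trans UR.
- split; [exact: msmooth_subset OmU sX|exact: msmooth_subset OmU sY|].
  by move=> p /OmU Up; have [] := HU p Up.
- exact: Hsurj.
- by move=> P V q q'; exact: leafP.
move=> P V oV Vpos; have VU : V `<=` U by move=> p [/OmU].
have VR : V `<=` regular by exact: subset_trans UR.
have HV p (Vp : V p) := HU p (VU p Vp).
have sXV := msmooth_subset VU sX; have sYV := msmooth_subset VU sY.
split; first exact: (polar_leaf_coordinates oV VR sXV sYV HV Vpos (@leafP P)).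
exact: (polar_induced_metric VR HV Vpos).
Qed.

Lemma open_below : open [set p | 0 < K0 - K p].
Proof.
apply: open_pos => p; apply: continuousB; first exact: cst_continuous.
exact: msmooth_continuous openT sK I.
Qed.

Lemma coordinates_near_leaf p : C p -> (K1 p, K2 p) <> (0, 0) ->
  exists (U : set M) (r : M -> R) (th : M -> R * R),
    [/\ U p, leaf_coordinates a1 a2 U (radii K0) r th &
        induced_metric a1 a2 U (eta K0) (phi K0) r th].
Proof.
move=> Cp KN0.
have S0 : 0 < slope p.
  rewrite lt_neqAle addr_ge0 ?sqr_ge0 // andbT eq_sym; apply/eqP => /eqP.
  rewrite paddr_eq0 ?sqr_ge0 // !sqrf_eq0 => /andP[/eqP k1 /eqP k2].
  by apply: KN0; rewrite k1 k2.
rewrite (slopeE Cp) in S0; have [u0 dp] := den_gt0 K0gt1 S0.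
have [Om [X [Y [e [[oOm Omp OmR e0] [sX sY XY] _ _ H]]]]] := polar_flow_box (conj Cp dp).
pose P (x y : R) := 0 < x ^+ 2 + y ^+ 2.
pose V := Om `&` [set q | P (X q) (Y q)].
have VE : V = Om `&` [set q | 0 < K0 - K q].
  apply/seteqP; split=> q [Oq] h; split=> //; move: h;
    by rewrite /= /P (XY _ Oq) pmulr_rgt0.
have oV : open V by rewrite VE; apply: openI => //; exact: open_below.
have [|leaf metric] := H P oV; first by move=> q; rewrite -/V VE => -[].
exists V, radius, (angle X Y); split=> //.
by rewrite VE.
Qed.

(** In the flow box [(X, Y)] takes all values in a square of half-width [e] about
    the origin, hence all values in the disk of radius [e]. *)
Lemma coordinates_near_centre p : C p -> (K1 p, K2 p) = (0, 0) -> 1 < K p ->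
  exists (U : set M) (r : M -> R) (th : M -> R * R), exists2 eps : R, 0 < eps &
    let U' := U `&` [set q | r q <> 0] in
    [/\ open U /\ U p,
        forall q, U q -> (r q = 0 <-> same_leaf a1 a2 U p q),
        msmooth_on U (fun q => r q * (th q).1) /\
        msmooth_on U (fun q => r q * (th q).2),
        (fun q => (r q, th q)) @` U' =
          [set x : R | 0 < x < eps] `*` @circle R &
        leaf_coordinates a1 a2 U' (radii K0) r th /\
        induced_metric a1 a2 U' (eta K0) (phi K0) r th].
Proof.
move=> Cp [k1 k2] Kp1.
have S0 : slope p = 0 by rewrite /slope k1 k2 expr0n addr0.
have KE : K p = K0 by apply: den_mul_eq0 => //; rewrite -slopeE.
have u0 : K0 - K p = 0 by rewrite KE subrr.
have dp : 0 < den K0 (K0 - K p) by rewrite u0 den0 mulr_gt0 // subr_gt0.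
have [Om [X [Y [e [[oOm Omp OmR e0] [sX sY XY] surj leafP H]]]]] :=
  polar_flow_box (conj Cp dp).
have [Xp Yp] : X p = 0 /\ Y p = 0.
  have /eqP := XY p Omp; rewrite u0 mulr0 paddr_eq0 ?sqr_ge0 // !sqrf_eq0.
  by move=> /andP[/eqP -> /eqP ->].
have u_ge0 q : Om q -> 0 <= K0 - K q.
  by move=> Oq; rewrite -(pmulr_rge0 _ (_ : 0 < 4)) // -XY // addr_ge0 ?sqr_ge0.
have rsqr q : Om q -> radius q ^+ 2 = X q ^+ 2 + Y q ^+ 2.
  by move=> Oq; rewrite XY // radius_sqr // u_ge0.
have r_ge0 q : 0 <= radius q by rewrite mulr_ge0 // sqrtr_ge0.
pose P (x y : R) := x ^+ 2 + y ^+ 2 < e ^+ 2.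
pose P' (x y : R) := P x y /\ 0 < x ^+ 2 + y ^+ 2.
pose U := Om `&` [set q | P (X q) (Y q)].
pose U' := Om `&` [set q | P' (X q) (Y q)].
have r0P q : Om q -> radius q = 0 <-> X q = 0 /\ Y q = 0.
  move=> Oq; split=> [r0|[X0 Y0]].
    have /eqP := rsqr q Oq; rewrite r0 expr0n eq_sym paddr_eq0 ?sqr_ge0 // !sqrf_eq0.
    by move=> /andP[/eqP -> /eqP ->].
  by apply/eqP; rewrite -sqrf_eq0 rsqr // X0 Y0 expr0n addr0.
have U'E : U `&` [set q | radius q <> 0] = U'.
  apply/seteqP; split=> q.
    move=> [[Oq Pq] rq]; split=> //; split=> //; rewrite -rsqr // exprn_gt0 //.
    by rewrite lt_neqAle r_ge0 andbT eq_sym; apply/eqP.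
  move=> [Oq [Pq pos]]; split=> // rq; move: pos.
  by rewrite -rsqr // rq expr0n ltxx.
have oU : open U.
  have -> : U = Om `&` [set q | 0 < K q - (K0 - e ^+ 2 / 4)].
    apply/seteqP; split=> q [Oq] h; split=> //; move: h; rewrite /= /P XY //; lra.
  apply: openI => //; apply: open_pos => q.
  apply: (@continuousB _ _ _ K (cst (K0 - e ^+ 2 / 4)) q); last exact: cst_continuous.
  exact: msmooth_continuous openT sK I.
have oU' : open U'.
  have -> : U' = U `&` [set q | 0 < K0 - K q].
    apply/seteqP; split=> q.
      by move=> [Oq [Pq]]; rewrite XY // pmulr_rgt0.
    by move=> [[Oq Pq] h]; split=> //; split=> //; rewrite XY // pmulr_rgt0.
  by apply: openI => //; exact: open_below.
have Up : U p by split=> //; rewrite /= /P Xp Yp expr0n addr0 exprn_gt0.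
have UOm : U `<=` Om by move=> q [].
have smooth_back f : msmooth_on Om f -> (forall q, Om q -> radius q = 0 -> f q = 0) ->
    msmooth_on U (fun q => radius q * (f q / radius q)).
  move=> sf f0 c ac; have oW := open_chart_image (c := c) oU.
  apply: (smooth_eq oW _ (msmooth_subset UOm sf ac)) => x /chart_imageP[/UOm Oq _ _] /=.
  have [r0|rN0] := eqVneq (radius (cinv c x)) 0; first by rewrite r0 mul0r f0.
  by rewrite mulrC divfK.
exists U, radius, (angle X Y), e => // U''; rewrite /U'' U'E; split.
- by split.
- move=> q Uq; have Oq := UOm q Uq; rewrite (r0P q Oq) (leafP P p q Up Uq) Xp Yp.
  by split=> -[-> ->].
- split; apply: smooth_back => // q Oq /(r0P q Oq)[] //.
- apply/seteqP; split=> [_ [q [Oq [Pq pos]] <-]|[rho [c s]] [/= /andP[rho0 rhoe] cs]].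
    have rq : 0 < radius q.
      by rewrite lt_neqAle r_ge0 andbT eq_sym; apply: contraTneq pos => r0;
        rewrite -rsqr // r0 expr0n ltxx.
    split; rewrite /=.
      by rewrite rq /= -(ltr_pXn2r (_ : 0 < 2)%N) ?nnegrE ?(ltW e0) // rsqr.
    by rewrite /circle /= !expr_div_n -mulrDl -rsqr // divff // expf_neq0 // gt_eqF.
  have bound (z w : R) : z ^+ 2 + w ^+ 2 = 1 -> `|rho * z| < e.
    move=> zw; apply: le_lt_trans rhoe; rewrite normrM gtr0_norm // ler_piMr ?(ltW rho0) //.
    rewrite -(@ler_pXn2r _ 2) ?nnegrE // expr1n -normrX ger0_norm ?sqr_ge0 //.
    by rewrite -zw lerDl sqr_ge0.
  have [q [Oq Xq Yq]] : exists q, [/\ Om q, X q = rho * c & Y q = rho * s].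
    apply: surj; rewrite ?Xp ?Yp subr0; first exact: (bound c s cs).
    by apply: (bound s c); rewrite addrC.
  have rE : radius q = rho.
    apply/eqP; rewrite -(eqrXn2 (_ : 0 < 2)%N) ?(ltW rho0) // rsqr // Xq Yq.
    by rewrite !exprMn -mulrDr cs mulr1.
  exists q; last by rewrite /angle Xq Yq rE ![rho * _]mulrC !mulfK ?gt_eqF.
  split=> //; rewrite /= /P' /P -rsqr // rE exprn_gt0 //; split=> //.
  by rewrite ltr_pXn2r ?nnegrE ?(ltW rho0) ?(ltW e0).
- apply: (H P' oU') => q [Oq [_]]; rewrite XY // pmulr_rgt0 //.
Qed.

End NormalForm.

(** When [S = 0] and [K = 1] at [p0] the first integral is the minimum of the
    potential, which is attained at no [K0 > 1]; [S > 0] or [K > 1] puts it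
    above the minimum. *)
Lemma exists_maximal_curvature (C : set M) p0 : open C -> connected C -> C p0 ->
  0 < slope p0 \/ 1 < K p0 ->
  exists2 K0 : R, 1 < K0 &
    forall p, C p -> slope p = (K0 - K p) * den K0 (K0 - K p).
Proof.
move=> oC cC Cp0 H.
have S0 : 0 <= slope p0 by rewrite addr_ge0 ?sqr_ge0.
have fiE : first_integral p0 = slope p0 * expR (2 * K p0) + potential (K p0).
  by rewrite /first_integral /potential; ring.
have e0 := expR_gt0 (2 * K p0).
have [K0 K01 K0E] : exists2 K0 : R, 1 < K0 & potential K0 = first_integral p0.
  apply: potential_surj; rewrite fiE; have [Kp|Kp] := eqVneq (K p0) 1.
    by case: H; rewrite Kp ?ltxx // => S0'; rewrite ltrDr mulr_gt0.
  have := potential_min Kp; have : 0 <= slope p0 * expR (2 * K p0).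
    by rewrite mulr_ge0 // ltW.
  by move: (potential _) (potential _) (_ * _) => x y z; lra.
exists K0 => // p Cp; apply: slope_den.
by rewrite K0E -(first_integral_constant oC cC Cp0 Cp).
Qed.

End CartanGeometry.

Theorem theorem6p1 (R : realType) (M : manifold R 3)
  (K : M -> R) (a1 a2 a3 : covector_field M)
  (K1 K2 K3 K11 K12 K13 K21 K22 K23 : M -> R)
  (HC : Cartan_structure K a1 a2 a3)
  (HK : coframe_derivatives a1 a2 a3 K K1 K2 K3)
  (HK1 : coframe_derivatives a1 a2 a3 K1 K11 K12 K13)
  (HK2 : coframe_derivatives a1 a2 a3 K2 K21 K22 K23)
  (H3 : forall p, K3 p = 0)
  (H11 : forall p, K11 p = 1 - K p - K1 p ^+ 2)
  (H12 : forall p, K12 p = - (K1 p * K2 p))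
  (H21 : forall p, K21 p = - (K1 p * K2 p))
  (H22 : forall p, K22 p = 1 - K p - K2 p ^+ 2) :
  (* on each connected piece C of the 3-manifold, e.g. each component *)
  forall C : set M, open C -> connected C ->
  exists (K0 : R) (I : set R),
    [/\ 1 < K0,
        [/\ is_interval I, (forall x, I x -> 0 < x),
            smooth_positive_on I (eta K0) & smooth_positive_on I (phi K0)],
        (* near a leaf on which dK <> 0 *)
        (forall p, C p -> (K1 p, K2 p) <> (0, 0) ->
           exists (U : set M) (r : M -> R) (th : M -> R * R),
             [/\ U p, leaf_coordinates a1 a2 U I r th &
                 induced_metric a1 a2 U (eta K0) (phi K0) r th]) &
        (* near the centre r = 0: the leaves on which K has its maximum *)
        (forall p, C p -> (K1 p, K2 p) = (0, 0) -> 1 < K p ->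
           exists (U : set M) (r : M -> R) (th : M -> R * R), exists2 eps : R, 0 < eps &
             let U' := U `&` [set q | r q <> 0] in
             [/\ open U /\ U p,
                 forall q, U q -> (r q = 0 <-> same_leaf a1 a2 U p q),
                 msmooth_on U (fun q => r q * (th q).1) /\
                 msmooth_on U (fun q => r q * (th q).2),
                 (fun q => (r q, th q)) @` U' =
                   [set x : R | 0 < x < eps] `*` @circle R &
                 leaf_coordinates a1 a2 U' I r th /\
                 induced_metric a1 a2 U' (eta K0) (phi K0) r th])].

Proof.
move=> C oC cC.
have [[p0 [Cp0 H]]|H] := pselect (exists p0, C p0 /\ (0 < slope K1 K2 p0 \/ 1 < K p0)).
  have [K0 K01 slopeE] := exists_maximal_curvature HC HK HK1 HK2 H3 H11 H12 H21 H22
    oC cC Cp0 H.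
  exists K0, (radii K0); split=> //.
  - split; [exact: is_interval_radii|by move=> x []| |].
      exact: smooth_positive_eta.
    exact: smooth_positive_phi.
  - move=> p; exact: (coordinates_near_leaf HC HK HK1 HK2 H3 H11 H12 H21 H22 K01 oC slopeE).
  - move=> p; exact: (coordinates_near_centre HC HK HK1 HK2 H3 H11 H12 H21 H22 K01 oC slopeE).
(* otherwise no leaf in C calls for coordinates, and any K0 above 1 will do *)
have flat p : C p -> slope K1 K2 p = 0 /\ K p <= 1.
  move=> Cp; split; last by rewrite leNgt; apply/negP => K1p; apply: H; exists p; split=> //; right.
  apply/eqP; rewrite eq_le addr_ge0 ?sqr_ge0 // andbT leNgt; apply/negP => S0.
  by apply: H; exists p; split=> //; left.
have K02 : (1 : R) < 2 by rewrite ltr1n.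
exists 2, (radii 2); split=> //.
- split; [exact: is_interval_radii|by move=> x []| |].
    exact: smooth_positive_eta.
  exact: smooth_positive_phi.
- move=> p Cp KN0; have [/eqP S0 _] := flat p Cp; exfalso; apply: KN0.
  by move: S0; rewrite paddr_eq0 ?sqr_ge0 // !sqrf_eq0 => /andP[/eqP -> /eqP ->].
- by move=> p Cp _; rewrite ltNge; have [_ ->] := flat p Cp.
Qed.
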